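(* Let $X$ be a real or complex Banach space, let $T=(T(t))_{t\ge 0}$ be a $C_0$-semigroup on $X$ with generator $-A$, let $\tau>0$, and let $\Phi\colon X\to X$ be linear. The following statements are equivalent. (i) For all $f\in C([0,\tau];X)$ there exists a unique weak solution $u$ of $\dot u+Au=f$ satisfying $u(0)=\Phi u(\tau)$. (ii) $I-\Phi T(\tau)\colon X\to X$ is bijective. (iii) For all $f\in L^1(0,\tau;X)$ and for all $y_0\in X$ there exists a unique weak solution $u$ of $\dot u+Au=f$ satisfying $u(0)=\Phi u(\tau)+y_0$.
   Context: $\Phi$ is not assumed to be bounded. For $f\in L^1(0,\tau;X)$, a function $u$ is a weak solution of $\dot u+Au=f$ if $u\in C([0,\tau];X)$ and for all $x'\in D(A')$ (where $A'$ is the adjoint of $A$ on the dual space $X'$) one has $\langle x',u\rangle\in W^{1,1}(0,\tau)$ and $$\frac{d}{dt}\langle x',u(t)\rangle+\langle A'x',u(t)\rangle=\langle x',f(t)\rangle\quad\text{for a.e. } t\in(0,\tau).$$ *)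

(* Defs.v *)
From HB Require Import structures.
From mathcomp Require Import all_boot all_order all_algebra.
From mathcomp Require Import complex.
From mathcomp Require Import all_classical all_reals all_analysis.

Set Implicit Arguments.
Unset Strict Implicit.
Unset Printing Implicit Defensive.

Import Order.TTheory GRing.Theory Num.Theory.
Import numFieldNormedType.Exports.

Local Open Scope classical_set_scope.
Local Open Scope ring_scope.

Variant scalar_kind := RealScalars | ComplexScalars.

Definition scalars (R : realType) (k : scalar_kind) : numFieldType :=
  match k with
  | RealScalars => R
  | ComplexScalars => R[i]
  end.

Definition of_real (R : realType) (k : scalar_kind) : R -> scalars R k :=
  match k return R -> scalars R k with
  | RealScalars => id
  | ComplexScalars => fun r => r%:C%C
  end.

Definition re_part (R : realType) (k : scalar_kind) : scalars R k -> R :=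
  match k return scalars R k -> R with
  | RealScalars => id
  | ComplexScalars => @complex.Re R
  end.

Definition im_part (R : realType) (k : scalar_kind) : scalars R k -> R :=
  match k return scalars R k -> R with
  | RealScalars => fun=> 0
  | ComplexScalars => @complex.Im R
  end.

Section Definitions.
Context (R : realType) (k : scalar_kind).
Local Notation K := (scalars R k).
Local Notation mu := (@lebesgue_measure R).

(* A closed support contained in ]0, tau[ is bounded, hence compact. *)
Definition test_function (tau : R) (phi : R -> R) : Prop :=
  (forall n t, derivable (phi^`(n))%classic t 1) /\
  closure [set t | phi t != 0] `<=` `]0, tau[.

(* g belongs to W^{1,1}(0, tau) and h is its distributional derivative. *)
Definition W11_derivative_real (tau : R) (g h : R -> R) : Prop :=
  [/\ mu.-integrable `]0, tau[ (EFin \o g),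
      mu.-integrable `]0, tau[ (EFin \o h) &
      forall phi : R -> R, test_function tau phi ->
        \int[mu]_(t in `]0, tau[) (g t * (phi^`())%classic t) =
        - \int[mu]_(t in `]0, tau[) (h t * phi t)].

Definition W11_derivative (tau : R) (g h : R -> K) : Prop :=
  W11_derivative_real tau (@re_part R k \o g) (@re_part R k \o h) /\
  W11_derivative_real tau (@im_part R k \o g) (@im_part R k \o h).

Section BanachSpace.
Context (X : completeNormedModType K).

Definition simple_function (s : R -> X) : Prop :=
  finite_set (range s) /\ forall x, measurable (s @^-1` [set x]).

Definition strongly_measurable (D : set R) (f : R -> X) : Prop :=
  exists2 s : nat -> R -> X, (forall n, simple_function (s n)) &
    {ae mu, forall t, D t -> s n t @[n --> \oo] --> f t}.

(* The norm of X takes its values in K (in its real nonnegative elements),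
   hence the use of re_part. *)
Definition bochner_integrable (D : set R) (f : R -> X) : Prop :=
  strongly_measurable D f /\
  (\int[mu]_(t in D) (re_part `|f t|)%:E < +oo)%E.

Record dual := Dual {
  dual_fun :> {scalar X};
  dual_continuous : continuous dual_fun }.

(* Unbounded operators are represented by their graphs. *)

(* x' belongs to D(A') and A'x' = y'. *)
Definition adjoint (A : X -> X -> Prop) (x' y' : dual) : Prop :=
  forall x y, A x y -> y' x = x' y.

(* Only the values T t for t >= 0 are relevant. *)
Definition C0_semigroup (T : R -> {linear X -> X}) : Prop :=
  [/\ forall t, 0 <= t -> continuous (T t),
      forall x, T 0 x = x,
      forall s t x, 0 <= s -> 0 <= t -> T (s + t) x = T s (T t x) &
      forall x, T t x @[t --> 0^'+] --> x].

Definition generator (T : R -> {linear X -> X}) (x y : X) : Prop :=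
  @of_real R k h^-1 *: (T h x - x) @[h --> 0^'+] --> y.

Definition weak_solution (A : X -> X -> Prop) (tau : R) (f u : R -> X) : Prop :=
  {within `[0, tau], continuous u} /\
  forall x' y' : dual, adjoint A x' y' ->
    exists2 h : R -> K, W11_derivative tau (fun t => x' (u t)) h &
      {ae mu, forall t, `]0, tau[%classic t -> h t + y' (u t) = x' (f t)}.

(* Existence and uniqueness of a function on [0, tau]: its values outside
   [0, tau] are junk, so uniqueness is equality on [0, tau]. *)
Definition exists_unique_on (tau : R) (P : (R -> X) -> Prop) : Prop :=
  exists2 u : R -> X, P u & forall v, P v -> {in `[0, tau], v =1 u}.

End BanachSpace.
End Definitions.

Arguments of_real {R} k.
Arguments re_part {R k}.
Arguments im_part {R k}.

(* Main.v *)
(* The problem transfers to the real Banach space underlying [X], the real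
   functionals being the real parts of the scalar ones.

   Uniqueness: if [u] is a weak solution for f = 0 with u(0) = 0 and [r] is in
   D(A'), then du Bois-Reymond applied to s |-> <r, u(s)> shows that
   s |-> <r, T(t - s) u(s)> has zero derivative, so <r, u(t)> = 0; and D(A')
   separates points, as it contains x |-> int_0^h <xi, T(s) x> ds for all [xi].

   Existence: for f(t) = 1_E(t) T(t - a) x with E in [a, oo[ the solution is
   |E /\ [0, t]| T(t - a) x by Fubini. Sums of these approximate every Bochner
   integrable [f] in L^1, and the mild formula
   <r, u(t)> = int_0^t <r, T(t - s) f(s)> ds, tested on norming functionals,
   bounds [u] uniformly by the L^1 norm of [f].

   So the weak solutions are the functions T(t) x + w(t) with [w] the solution
   starting at 0, and the boundary condition reads
   (I - Phi T(tau)) x = Phi w(tau) + y0. For (i) => (ii), f(t) = T(t) y / tau is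
   continuous with w(tau) = T(tau) y; a solution with u(0) = Phi u(tau) then gives
   (I - Phi T(tau)) (u(0) + y) = y. *)
From HB Require Import structures.
Require Import Defs.
From mathcomp Require Import all_boot all_order all_algebra.
From mathcomp Require Import complex.
From mathcomp Require Import all_classical all_reals all_analysis.
From mathcomp Require Import measurable_realfun.
From mathcomp Require Import ring lra.

Set Implicit Arguments.
Unset Strict Implicit.
Unset Printing Implicit Defensive.

Import Order.TTheory GRing.Theory Num.Theory.
Import numFieldNormedType.Exports.

Local Open Scope classical_set_scope.
Local Open Scope ring_scope.

(** * Real scalars inside the scalar field *)

Section Scalars.
Variables (R : realType) (k : scalar_kind).
Implicit Types (a b : R) (z : scalars R k).

(** No vector-valued integral is ever formed: every identity is stated after applying a bounded
    functional, and a vector such as the integral of an orbit is obtained as the value of a limit of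
    explicit solutions. This is why norming functionals are constructed, and why a limit has to
    carry both the tested mild formula, which controls norms, and the weak equation.

    The passage to real scalars loses nothing because [re_part (c * z)] for all [c] determines [z],
    and because the generator's graph is stable under every scalar.

    [D(A')] separates points but need not be norm dense in the dual. The adjoint relation is
    therefore used in the integrated form r(T(t) x) - r(x) = - int_0^t q(T(s) x) ds, which holds for
    every x and not only on the domain of the generator.

    The factor 1 / tau in the source T(t) y / tau compensates for int_0^tau T(tau - s) T(s) y ds =
    tau T(tau) y. *)

Lemma of_realD : {morph @of_real R k : a b / a + b}.
Proof. by case: k => a b //=; rewrite -raddfD. Qed.

Lemma of_realM : {morph @of_real R k : a b / a * b}.
Proof. by case: k => a b //=; rewrite -rmorphM. Qed.

Lemma of_real1 : of_real k (1 : R) = 1.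
Proof. by case: k. Qed.

Lemma of_real0 : of_real k (0 : R) = 0.
Proof. by case: k. Qed.

Lemma norm_of_real a : `|of_real k a| = of_real k `|a|.
Proof. by case: k => //=; rewrite normc_def/= expr0n/= addr0 sqrtr_sqr. Qed.

Lemma ltr_of_real a b : (of_real k a < of_real k b) = (a < b).
Proof. by case: k => //=; rewrite ltcR. Qed.

Lemma ler_of_real a b : (of_real k a <= of_real k b) = (a <= b).
Proof. by case: k => //=; rewrite lecR. Qed.

Lemma re_partK z : 0 <= z -> of_real k (re_part z) = z.
Proof.
by case: k z => //= -[x y]; rewrite lecE/= => /andP[/eqP -> _].
Qed.

Lemma re_partD : {morph @re_part R k : z w / z + w : scalars R k >-> z + w}.
Proof. by case: k => //= -[a b] [c d]. Qed.

Lemma re_partN z : re_part (- z) = - re_part z.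
Proof. by case: k z => //= -[]. Qed.

Lemma re_part_of_realM a z : re_part (of_real k a * z) = a * re_part z.
Proof. by case: k z => //= -[x y] /=; rewrite mul0r subr0. Qed.

Lemma ler_norm_re_part z : `|re_part z| <= re_part `|z|.
Proof.
case: k z => //= -[x y] /=; rewrite -[`|x|]sqrtr_sqr ler_wsqrtr //.
by rewrite lerDl sqr_ge0.
Qed.

End Scalars.

(** * The underlying real Banach space *)

(** A separate name keeps the real structures apart from the scalar ones. Carrier, addition and
    uniform structure are copied from [X], so continuity and limits transfer by conversion. *)
Definition realified (R : realType) (k : scalar_kind)
  (X : completeNormedModType (scalars R k)) : Type := X.

Section Realified.
Variables (R : realType) (k : scalar_kind).
Variable X : completeNormedModType (scalars R k).
Local Notation Y := (realified X).

HB.instance Definition _ := Complete.copy Y X.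
HB.instance Definition _ := GRing.Zmodule.copy Y X.

Let scale (a : R) (x : Y) : Y := of_real k a *: (x : X).

Let scaleA a b x : scale a (scale b x) = scale (a * b) x.
Proof. by rewrite /scale scalerA of_realM. Qed.

Let scale1 : left_id 1 scale.
Proof. by move=> x; rewrite /scale of_real1 scale1r. Qed.

Let scaleDr : right_distributive scale +%R.
Proof. by move=> a x y; rewrite /scale scalerDr. Qed.

Let scaleDl x : {morph scale^~ x : a b / a + b}.
Proof. by move=> a b; rewrite /scale of_realD scalerDl. Qed.

HB.instance Definition _ :=
  GRing.Zmodule_isLmodule.Build R Y scaleA scale1 scaleDr scaleDl.

Lemma realified_scaleE (a : R) (x : Y) : a *: x = of_real k a *: (x : X).
Proof. by []. Qed.

Let norm (x : Y) : R := re_part `|x : X|.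

Let of_real_norm x : of_real k (norm x) = `|x : X|.
Proof. by rewrite re_partK. Qed.

Let norm_triangle x y : norm (x + y) <= norm x + norm y.
Proof. by rewrite -(ler_of_real k) of_realD !of_real_norm; exact: ler_normD. Qed.

Let norm_eq0 x : norm x = 0 -> x = 0.
Proof.
move=> x0; apply/eqP; have := of_real_norm x.
by rewrite x0 of_real0 => /esym/eqP; rewrite normr_eq0.
Qed.

Let normZ (a : R) x : norm (a *: x) = `|a| * norm x.
Proof.
by rewrite /norm realified_scaleE normrZ norm_of_real re_part_of_realM.
Qed.

Let normMn x n : norm (x *+ n) = norm x *+ n.
Proof. by rewrite -scaler_nat normZ ger0_norm// mulr_natl. Qed.

Let normN x : norm (- x) = norm x.
Proof. by rewrite /norm (normrN (x : X)). Qed.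

HB.instance Definition _ :=
  Num.Zmodule_isNormed.Build R Y norm_triangle norm_eq0 normMn normN.

Lemma realified_normE (x : Y) : `|x| = re_part `|x : X|.
Proof. by []. Qed.

Let ball_center (x : Y) (e : R) : 0 < e -> ball_ Num.norm x e x.
Proof. by rewrite /ball_/= subrr normr0. Qed.

Let ball_sym (x y : Y) (e : R) : ball_ Num.norm x e y -> ball_ Num.norm y e x.
Proof. by rewrite /ball_/= distrC. Qed.

Let ball_triangle (x y z : Y) (e1 e2 : R) : ball_ Num.norm x e1 y ->
  ball_ Num.norm y e2 z -> ball_ Num.norm x (e1 + e2) z.
Proof.
rewrite /ball_/= => ? ?; rewrite -[x](subrK y) -(addrA (x + _)).
by rewrite (le_lt_trans (ler_normD _ _))// ltrD.
Qed.

Let ballE (x y : Y) (e : R) :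
  ball_ Num.norm x e y <-> ball (x : X) (of_real k e) (y : X).
Proof.
by rewrite -ball_normE /ball_/= -of_real_norm ltr_of_real.
Qed.

(** Positive elements of the scalar field are real, so balls with scalar radii and balls with real
    radii generate the same uniformity. This reconciles the new norm with the copied uniform
    structure. *)
Let entourageE : @entourage Y = entourage_ (ball_ (@Num.norm R Y)).
Proof.
rewrite -[LHS](@entourage_ballE _ X); apply/seteqP; split => A [e /= e0 eA].
- exists (re_part e).
    by rewrite /= -(ltr_of_real k) of_real0 re_partK// ltW.
  by move=> xy /ballE; rewrite re_partK ?ltW//; exact: eA.
- exists (of_real k e); first by rewrite /= -(of_real0 R k) ltr_of_real.
  by move=> xy /ballE; exact: eA.
Qed.

HB.instance Definition _ := Uniform_isPseudoMetric.Build R Y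
  ball_center ball_sym ball_triangle entourageE.

HB.instance Definition _ := NormedZmod_PseudoMetric_eq.Build R Y erefl.

HB.instance Definition _ :=
  PseudoMetricNormedZmod_Lmodule_isNormedModule.Build R Y normZ.

End Realified.

Definition realify (R : realType) (k : scalar_kind)
  (X : completeNormedModType (scalars R k)) : completeNormedModType R :=
  realified X.

(** * Norming functionals from minimal sublinear functionals *)

Section HahnBanach.
Variables (R : realType) (X : normedModType R).
Implicit Types (x y z : X) (q : X -> R).

Let sublinear q := [/\ forall x y, q (x + y) <= q x + q y,
  forall (a : R) x, 0 < a -> q (a *: x) = a * q x & forall x, q x <= `|x|].

(** This bound makes the pointwise infimum of a chain finite. *)
Let sublinear_ge q : sublinear q -> forall x, - `|x| <= q x.
Proof.
case=> qD qZ qn x; have q0 : q 0 = 0.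
  by have := qZ 2 0 (ltr0Sn R 1); rewrite scaler0 => q0; lra.
have := qD x (- x); rewrite subrr q0.
by have := qn (- x); rewrite normrN; lra.
Qed.

(** The choice t = 1 at the point - z gives a value at most - q z. A minimal [q] equals its own
    shift, hence satisfies q (- z) <= - q z for all z; it is then odd, and a sublinear odd
    functional is linear. *)
Let shift_set q z x := [set q (x + t *: z) - t * q z | t in [set t : R | 0 <= t]].
Let shift q z x := inf (shift_set q z x).

Let shift_lbound q z x : sublinear q -> lbound (shift_set q z x) (- `|x|).
Proof.
move=> sq; have [qD qZ qn] := sq; move=> _ [t /= t0 <-].
have := qD (x + t *: z) (- x); rewrite addrAC subrr add0r.
have -> : q (t *: z) = t * q z.
  move: t0; rewrite le_eqVlt => /predU1P[<-|/qZ ->//].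
  have := qZ 2 0 (ltr0Sn R 1); rewrite scaler0 scale0r => q0; lra.
have := qn (- x); rewrite normrN; lra.
Qed.

Let shift_set0 q z x : shift_set q z x !=set0.
Proof. by exists (q (x + 0 *: z) - 0 * q z); exists 0 => /=. Qed.

Let shift_has_inf q z x : sublinear q -> has_inf (shift_set q z x).
Proof. by move=> sq; split => //; exists (- `|x|); exact: shift_lbound. Qed.

Let shift_le q z x t : sublinear q -> 0 <= t ->
  shift q z x <= q (x + t *: z) - t * q z.
Proof.
move=> sq t0; apply: ge_inf; first by exists (- `|x|); exact: shift_lbound.
by exists t.
Qed.

Let sublinear_shift q z : sublinear q -> sublinear (shift q z).
Proof.
move=> sq; have [qD qZ qn] := sq; split.
- move=> x y; apply/ler_addgt0Pr => e e0.
  have e20 : 0 < e / 2 by rewrite divr_gt0.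
  have [_ [s /= s0 <-] hs] := inf_adherent e20 (shift_has_inf z x sq).
  have [_ [t /= t0 <-] ht] := inf_adherent e20 (shift_has_inf z y sq).
  apply: le_trans (shift_le z (x + y) sq (addr_ge0 s0 t0)) _.
  rewrite scalerDl addrACA.
  have := qD (x + s *: z) (y + t *: z).
  rewrite -/(shift q z x) in hs; rewrite -/(shift q z y) in ht; lra.
- have shift_ge a x : 0 < a -> a * shift q z x <= shift q z (a *: x).
    move=> a0; apply: lb_le_inf => // _ [t /= t0 <-].
    have ta : 0 <= t / a by rewrite divr_ge0// ltW.
    have := shift_le z x sq ta; rewrite -(ler_pM2l a0) => /le_trans; apply.
    rewrite mulrBr -(qZ a (_ + _))// scalerDr scalerA.
    have -> : a * (t / a) = t by rewrite mulrC divfK ?gt_eqF.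
    by rewrite (mulrA a) [a * (t / a)]mulrC divfK ?gt_eqF.
  move=> a x a0; apply/eqP; rewrite eq_le shift_ge// andbT.
  have := shift_ge a^-1 (a *: x); rewrite invr_gt0 scalerA mulVf ?gt_eqF//.
  by rewrite scale1r ler_pdivrMl// => /(_ a0).
- move=> x; apply: le_trans (qn x).
  by have := @shift_le q z x 0 sq (lexx _); rewrite scale0r mul0r addr0 subr0.
Qed.

Let sublinear_minimal q : sublinear q -> exists2 p, sublinear p &
  (forall x, p x <= q x) /\
  forall p', sublinear p' -> (forall x, p' x <= p x) -> p' = p.
Proof.
move=> sq; pose S := {p | sublinear p /\ forall x, p x <= q x}.
(* The order is reversed, so the maximal element given by Zorn is a minimal functional. *)
pose le (p p' : S) := `[< forall x, sval p' x <= sval p x >].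
have [||||[p [sp pq]] pmin] := @Zorn S le.
- by move=> p; apply/asboolP.
- by move=> p p' p'' /asboolP h /asboolP h'; apply/asboolP => x; exact: le_trans.
- move=> [p hp] [p' hp'] /asboolP/= h /asboolP/= h'; apply: eq_exist => /=.
  by apply/funext => x; apply/eqP; rewrite eq_le h h'.
- move=> C Ctot.
  (* The empty chain is bounded by [q] itself; a nonempty one by its pointwise infimum. *)
  have [[p0 Cp0]|C0] := pselect (exists p, C p); last first.
    by exists (exist _ q (conj sq (fun=> lexx _))) => s Cs; exfalso; apply: C0; exists s.
  pose V x := [set sval p x | p in C].
  have lbV x : lbound (V x) (- `|x|).
    by move=> _ [[p [sp ?]] /= _ <-]; exact: sublinear_ge.
  have V0 x : V x !=set0 by exists (sval p0 x); exists p0.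
  have infV x : has_inf (V x) by split => //; exists (- `|x|).
  pose m x := inf (V x).
  have m_le x p : C p -> m x <= sval p x.
    by move=> Cp; apply: ge_inf; [exists (- `|x|)|exists p].
  have sm : sublinear m.
    split.
    - move=> x y; apply/ler_addgt0Pr => e e0.
      have e20 : 0 < e / 2 by rewrite divr_gt0.
      have [_ [s Cs <-] hs] := inf_adherent e20 (infV x).
      have [_ [t Ct <-] ht] := inf_adherent e20 (infV y).
      (* Subadditivity needs one functional that is nearly minimal at both points; in a chain, the
         smaller of the two near-minimisers is such a one. *)
      have [p [Cp [ps pt]]] : exists p, C p /\
          (sval p x <= sval s x) /\ (sval p y <= sval t y).
        by have [/asboolP h|/asboolP h] := Ctot _ _ Cs Ct; [exists t|exists s].
      apply: le_trans (m_le _ _ Cp) _.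
      case: (svalP p) => -[pD _ _] _; have := pD x y.
      rewrite -/(m x) in hs; rewrite -/(m y) in ht; lra.
    - have m_ge a x : 0 < a -> a * m x <= m (a *: x).
        move=> a0; apply: lb_le_inf => // _ [p Cp <-].
        case: (svalP p) => -[_ pZ _] _.
        by rewrite pZ// ler_pM2l// m_le.
      move=> a x a0; apply/eqP; rewrite eq_le m_ge// andbT.
      have := m_ge a^-1 (a *: x); rewrite invr_gt0 scalerA mulVf ?gt_eqF//.
      by rewrite scale1r ler_pdivrMl// => /(_ a0).
    - move=> x; apply: le_trans (m_le x _ Cp0) _.
      by case: (svalP p0) => -[].
  have mq x : m x <= q x.
    by apply: le_trans (m_le x _ Cp0) _; case: (svalP p0).
  exists (exist _ m (conj sm mq)) => s Cs; apply/asboolP => x /=; exact: m_le.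
- exists p => //; split => // p' sp' p'p.
  have hp' : sublinear p' /\ forall x, p' x <= q x.
    by split => // x; exact: le_trans (p'p x) (pq x).
  have := pmin (exist _ p' hp'); rewrite /le/= => /(_ (asboolT p'p)).
  by move=> /(congr1 sval).
Qed.

(* A minimal sublinear functional is linear; minimising below
   [inf_(t >= 0) (|x + t z| - t |z|)] forces the value [|z|] at [z]. *)
Lemma norming_functional z : exists r : X -> R,
  [/\ forall x y, r (x + y) = r x + r y, forall (a : R) x, r (a *: x) = a * r x,
      forall x, `|r x| <= `|x| & r z = `|z|].
Proof.
have sn : sublinear (fun x => `|x|).
  split => [x y|a x a0|//]; first exact: ler_normD.
  by rewrite normrZ gtr0_norm.
have [r sr [rle rmin]] := sublinear_minimal (sublinear_shift z sn).
have [rD rZ rn] := sr.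
have r0 : r 0 = 0.
  by have := rZ 2 0 (ltr0Sn R 1); rewrite scaler0 => q0; lra.
have rN x : r (- x) = - r x.
  apply/eqP; rewrite eq_le; apply/andP; split; last first.
    by have := rD x (- x); rewrite subrr r0; lra.
  have shr y : shift r x y <= r y.
    by have := @shift_le r x y 0 sr (lexx _); rewrite scale0r mul0r addr0 subr0.
  have := rmin _ (sublinear_shift x sr) shr => /(congr1 (@^~ (- x))) <-.
  have := @shift_le r x (- x) 1 sr ler01.
  by rewrite scale1r addNr r0 mul1r sub0r.
exists r; split.
- move=> x y; apply/eqP; rewrite eq_le rD/=.
  by have := rD (- x) (- y); rewrite -opprD !rN; lra.
- move=> a x; have [a0|a0|->] := ltrgt0P a; first exact: rZ; last first.
    by rewrite scale0r r0 mul0r.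
  have := rZ (- a) x; rewrite oppr_gt0 scaleNr rN => /(_ a0); lra.
- move=> x; rewrite ler_norml sublinear_ge//=; exact: rn.
- apply/eqP; rewrite eq_le rn/=.
  have := @shift_le _ z (- z) 1 sn ler01; have := rle (- z).
  by rewrite scale1r addNr normr0 mul1r sub0r rN; lra.
Qed.

End HahnBanach.

(** * Semigroups on a real Banach space *)

(** A predicate on bare functions: composites with the semigroup, integrals of functionals and real
    parts of scalar functionals all have to qualify. *)
Definition functional (R : realType) (X : normedModType R) (r : X -> R) :=
  [/\ forall x y, r (x + y) = r x + r y,
      forall (a : R) x, r (a *: x) = a * r x &
      exists2 C : R, 0 <= C & forall x, `|r x| <= C * `|x|].

Section Functional.
Variables (R : realType) (X : normedModType R) (r : X -> R).
Hypothesis hr : functional r.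

Lemma functionalD x y : r (x + y) = r x + r y. Proof. by case: hr. Qed.

Lemma functionalZ (a : R) x : r (a *: x) = a * r x. Proof. by case: hr. Qed.

Lemma functional0 : r 0 = 0.
Proof. by rewrite -(scale0r (0 : X)) functionalZ mul0r. Qed.

Lemma functionalN x : r (- x) = - r x.
Proof. by rewrite -scaleN1r functionalZ mulN1r. Qed.

Lemma functionalB x y : r (x - y) = r x - r y.
Proof. by rewrite functionalD functionalN. Qed.

Lemma functional_continuous : continuous r.
Proof.
case: hr => _ _ [C C0 rC] x; apply/cvgrPdist_le => e e0.
have C1 : 0 < C + 1 by rewrite ltr_wpDl.
near=> y; rewrite -functionalB (le_trans (rC _))//.
have : `|x - y| <= e / (C + 1).
  by near: y; apply: cvgr_dist_le => //; rewrite divr_gt0.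
rewrite ler_pdivlMr// => h; apply: le_trans h.
by rewrite mulrC ler_wpM2l// lerDl.
Unshelve. all: by end_near. Qed.

End Functional.

(* Extending by the identity to negative times makes orbits continuous on [R]. *)
Definition semigroup (R : realType) (X : normedModType R)
    (S : R -> {linear X -> X}) :=
  [/\ forall t, continuous (S t),
      forall t x, t <= 0 -> S t x = x,
      forall s t x, 0 <= s -> 0 <= t -> S (s + t) x = S s (S t x) &
      forall x, S t x @[t --> 0^'+] --> x].

Section Semigroup.
Variables (R : realType) (X : completeNormedModType R).
Variables (S : R -> {linear X -> X}) (hS : semigroup S).

Lemma semigroup_cvg0 x : S t x @[t --> (0 : R)] --> x.
Proof.
have [_ S0 _ Sr] := hS; apply/cvgrPdist_le => e e0.
have /cvgrPdist_le/(_ e e0) := Sr x.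
rewrite near_withinE; apply: filter_app; near=> t => h.
by have [t0|/h//] := leP t 0; rewrite S0// subrr normr0 ltW.
Unshelve. all: by end_near. Qed.

Let linear_norm_bound (f : {linear X -> X}) : continuous f ->
  exists2 C : R, 0 <= C & forall x, `|f x| <= C * `|x|.
Proof.
move=> cf; have /linear_boundedP h : bounded_near f (nbhs (0 : X)).
  by apply/linear_bounded_continuous.
near +oo_R => C; exists C; first by near: C; exact: nbhs_pinfty_ge.
by near: C.
Unshelve. all: by end_near. Qed.

(** Uniform boundedness: otherwise there are times t_n <= 1 / (n + 1) at which the operator norm
    exceeds n + 1, although each orbit stays bounded along them by continuity at 0. *)
Let bound_near0 : exists (d C : R), [/\ 0 < d, 1 <= C &
  forall t, t <= d -> forall x, `|S t x| <= C * `|x|].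
Proof.
have [cS S0 _ _] := hS; apply: contrapT => nbd.
have bad (n : nat) : exists t, t <= n.+1%:R^-1 /\
    exists x, n.+1%:R * `|x| < `|S t x|.
  apply: contrapT => h; apply: nbd; exists n.+1%:R^-1, n.+1%:R; split => //.
    by rewrite ler1n.
  move=> t tn x; rewrite leNgt; apply/negP => bx; apply: h.
  by exists t; split => //; exists x.
have [t ht] := choice bad.
pose F := [set (S (t n) : X -> X) | n in [set: nat]].
have Fb : forall f, F f -> bounded_fun_norm f /\ linear f.
  move=> _ [n _ <-]; split; last exact: linearP.
  move=> r; have [C C0 hC] := linear_norm_bound (cS (t n)).
  by exists (C * r) => x xr; apply: le_trans (hC x) _; rewrite ler_wpM2l.
have ptb : pointwise_bounded F.
  move=> x; have /cvgrPdist_le/(_ 1 ltr01) := @semigroup_cvg0 x.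
  move=> [d /= d0 hd].
  have near0 s : s < d -> `|S s x| <= `|x| + 1.
    move=> sd; have [s0|s0] := leP s 0; first by rewrite S0// lerDl.
    have : `|x - S s x| <= 1.
      by apply: hd; rewrite /ball_/= sub0r normrN gtr0_norm.
    have := ler_normB x (x - S s x); rewrite opprB addrCA subrr addr0.
    by move=> h1 h2; lra.
  (* Times with index beyond [N] are below [d], where the orbit is within 1 of [x]; the finitely
     many remaining values are summed into [B]. *)
  pose N := Num.truncn (d^-1).
  pose B := \sum_(i < N.+1) `|S (t i) x|.
  have B0 : 0 <= B by rewrite sumr_ge0.
  exists (B + (`|x| + 1)) => _ [n _ <-].
  have [nN|Nn] := ltnP n N.+1.
    rewrite /B (bigD1 (Ordinal nN))//= -addrA lerDl addr_ge0//.
    by rewrite sumr_ge0.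
  apply: le_trans (near0 _ _) _; last by rewrite lerDr.
  apply: le_lt_trans (ht n).1 _.
  rewrite -[ltRHS]invrK ltf_pV2 ?posrE ?invr_gt0//.
  apply: lt_le_trans (truncnS_gt _) _.
  by rewrite ler_nat -/N; exact: leqW.
have [M hM] := Banach_Steinhauss Fb ptb 1.
have [_ [x hx]] := ht (Num.truncn M).
have x0 : 0 < `|x|.
  rewrite normr_gt0; apply/eqP => x0; move: hx.
  by rewrite x0 raddf0 normr0 mulr0 ltxx.
have := hM (S (t (Num.truncn M))) (ex_intro2 _ _ _ I erefl) (`|x|^-1 *: x).
rewrite normrZ normfV normr_id mulVf ?gt_eqF// => /(_ (lexx _)).
rewrite linearZ/= normrZ normfV normr_id ler_pdivrMl// => h.
have := lt_le_trans hx h; rewrite mulrC ltr_pM2l// => h'.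
by have := truncnS_gt M; rewrite ltNge ltW.
Qed.

Lemma semigroup_bound tau : exists2 M : R, 1 <= M &
  forall t x, t <= tau -> `|S t x| <= M * `|x|.
Proof.
have [cS S0 SD _] := hS.
have [d [C [d0 C1 hC]]] := bound_near0.
(* Time is cut into pieces of length [d], each costing a factor [C]; as [C >= 1], a shorter last
   piece costs no more. *)
have pow n t x : t <= n%:R * d -> `|S t x| <= C ^+ n * `|x|.
  elim: n t => [|n IH] t; first by rewrite mul0r expr0 mul1r => /S0 ->.
  move=> td; have [tld|dt] := leP t d.
    apply: le_trans (hC _ tld _) _; rewrite ler_wpM2r// exprS ler_peMr//.
      by lra.
    exact: exprn_ege1.
  have -> : t = d + (t - d) by lra.
  rewrite SD ?subr_ge0 ?(ltW d0) ?(ltW dt)// exprS -mulrA.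
  apply: le_trans (hC d (lexx _) _) _; rewrite ler_wpM2l//; first by lra.
  by apply: IH; move: td; rewrite -natr1 mulrDl mul1r; lra.
exists (C ^+ (Num.truncn (tau / d)).+1); first exact: exprn_ege1.
move=> t x tt; apply: pow; apply: le_trans tt _.
by rewrite -ler_pdivrMr// ltW// truncnS_gt.
Qed.

Lemma orbit_continuous x : continuous (fun t => S t x).
Proof.
have [cS S0 SD _] := hS => t0.
have [M M1 hM] := semigroup_bound (t0 + 1).
apply/cvgrPdist_le => e e0.
have M0 : 0 < M by lra.
have e1 : 0 < e / M by rewrite divr_gt0.
have /cvgrPdist_le/(_ _ e1)[d /= d0 hd] := @semigroup_cvg0 x.
(* Factoring out the earlier operator leaves a difference at time 0, so left and right continuity
   both follow from the limit at 0 and the bound [M], uniform up to [t0 + 1]. *)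
have key s t : 0 <= s -> s <= t -> t <= t0 + 1 -> t - s < d ->
    `|S s x - S t x| <= e.
  move=> s0 st tt ts; have -> : t = s + (t - s) by lra.
  rewrite SD ?subr_ge0// -raddfB; apply: le_trans (hM _ _ _) _; first lra.
  rewrite mulrC -ler_pdivlMr//; apply: hd => /=.
  by rewrite sub0r normrN ger0_norm// subr_ge0.
have S_max t : S t x = S (Num.max t 0) x.
  by case: leP => // t_0; rewrite !S0// ltW.
near=> t.
have tt1 : t < t0 + 1 by near: t; apply: lt_nbhsl; lra.
have td : `|t0 - t| < d by near: t; exact: cvgr_dist_lt.
have t0d : Num.max t 0 - Num.max t0 0 < d /\ Num.max t0 0 - Num.max t 0 < d.
  by move: td; rewrite ltr_norml; case: (leP t 0); case: (leP t0 0); lra.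
have [mt mt0] : 0 <= Num.max t 0 /\ 0 <= Num.max t0 0.
  by rewrite !le_max lexx !orbT.
have [t10|t10] := ltP (t0 + 1) 0.
  have -> : S t x = x by apply: S0; lra.
  have -> : S t0 x = x by apply: S0; lra.
  by rewrite subrr normr0 ltW.
rewrite (S_max t) (S_max t0).
have [mtt mtt0] : Num.max t 0 <= t0 + 1 /\ Num.max t0 0 <= t0 + 1.
  by rewrite !ge_max t10 !andbT; lra.
have [le_tt|lt_tt] := leP (Num.max t 0) (Num.max t0 0).
  by rewrite distrC key//; case: t0d.
by rewrite key//; [exact: ltW|case: t0d].
Unshelve. all: by end_near. Qed.

Lemma semigroup_funD s t x : 0 <= s -> 0 <= t -> S (s + t) x = S s (S t x).
Proof. by case: hS => _ _ + _; exact. Qed.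

Lemma semigroup_fun0 t x : t <= 0 -> S t x = x.
Proof. by case: hS => _ + _ _; exact. Qed.

Lemma functional_comp_semigroup (r : X -> R) t :
  functional r -> functional (fun x => r (S t x)).
Proof.
move=> hr; split=> [x y|a x|].
- by rewrite linearD functionalD.
- by rewrite linearZ/= functionalZ.
- have [_ _ [C C0 hC]] := hr; have [M M1 hM] := semigroup_bound t.
  exists (C * M); first by rewrite mulr_ge0//; lra.
  by move=> x; apply: le_trans (hC _) _; rewrite -mulrA ler_wpM2l// hM.
Qed.

End Semigroup.

(** * Primitives and the du Bois-Reymond lemma *)

Section Calculus.
Variable R : realType.
Local Notation mu := (@lebesgue_measure R).
Implicit Types (a b c t x : R) (f g F G : R -> R).

Lemma is_derive_eps f x (d : R) :
  (forall e, 0 < e ->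
    \forall y \near x, `|f y - f x - d * (y - x)| <= e * `|y - x|) ->
  is_derive x 1 f d.
Proof.
move=> fd.
have cvgd : (fun h => h^-1 *: ((f \o shift x) (h *: 1) - f x)) @ 0^' --> d.
  apply/cvgrPdist_le => e e0.
  have /nbhs_ballP[r /= r0 hr] := fd e e0.
  exists r => //= h; rewrite /= sub0r normrN => hr' h0.
  have := hr (h + x); rewrite /ball/= opprD addrCA subrr addr0 normrN addrK.
  move=> /(_ hr'); rewrite scaler1 => H.
  have -> : d - h^-1 *: (f (h + x) - f x) =
      - h^-1 * (f (h + x) - f x - d * h).
    by rewrite /GRing.scale/=; field.
  by rewrite normrM normrN normfV mulrC ler_pdivrMr ?normr_gt0.
apply: DeriveDef; last exact/cvg_lim.
by apply/cvg_ex; exists d.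
Qed.

(** Primitives live on the whole line, so that no one-sided derivative occurs at the ends of an
    interval. *)
Definition primitive F g := forall t, is_derive t 1 F (g t).

Lemma is_derive_continuous f x (d : R) : is_derive x 1 f d ->
  {for x, continuous f}.
Proof. by move=> [df _]; apply/differentiable_continuous/derivable1_diffP. Qed.

Lemma primitive_continuous F g : primitive F g -> continuous F.
Proof. by move=> Fg t; exact: is_derive_continuous (Fg t). Qed.

Lemma is_derive0_cst f a b : a <= b -> {within `[a, b], continuous f} ->
  (forall x, a < x < b -> is_derive x 1 f 0) -> f a = f b.
Proof.
move=> ab cf df.
have df' x : x \in `]a, b[ -> is_derive x 1 f ((fun=> 0) x).
  by rewrite in_itv/=; exact: df.
have [c _] := MVT_segment ab df' cf.
by rewrite mul0r => /eqP; rewrite subr_eq0 => /eqP.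
Qed.

Lemma primitive_mean F g a b (C : R) : a <= b -> primitive F g ->
  (forall x, a <= x <= b -> `|g x| <= C) -> `|F b - F a| <= C * (b - a).
Proof.
move=> ab Fg gC.
have cF : {within `[a, b], continuous F}.
  exact/continuous_subspaceT/(primitive_continuous Fg).
have [c cab ->] := MVT_segment ab (fun x _ => Fg x) cF.
rewrite normrM (@ger0_norm _ (b - a)) ?subr_ge0// ler_wpM2r ?subr_ge0//.
by apply: gC; move: cab; rewrite in_itv.
Qed.

Lemma integrable_continuous g a b : continuous g ->
  mu.-integrable `[a, b] (EFin \o g).
Proof.
move=> cg; apply: continuous_compact_integrable; first exact: segment_compact.
exact: continuous_subspaceT.
Qed.

Lemma integrable_continuous_oc g a b : continuous g ->
  mu.-integrable `]a, b] (EFin \o g).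
Proof.
move=> cg; apply: integrableS (integrable_continuous a b cg) => //.
by apply: subset_itvr; rewrite bnd_simp.
Qed.

Lemma integrable_continuous_oo g a b : continuous g ->
  mu.-integrable `]a, b[ (EFin \o g).
Proof.
move=> cg; apply: integrableS (integrable_continuous a b cg) => //.
exact: subset_itv_oo_cc.
Qed.

(** An integral from a base point is differentiable only to the right of that point. The integrals
    based at - n, normalised to vanish at 0, agree wherever they are defined and are glued
    together. *)
Lemma continuous_primitive g : continuous g -> exists G, primitive G g.
Proof.
move=> cg.
pose P (n : nat) x := \int[mu]_(t in `]- n%:R, x]) g t.
have dP n x : - n%:R < x -> is_derive x 1 (P n) (g x).
  move=> nx; have x1 : x < x + 1 by rewrite ltrDl.
  have nx' : (BRight (- n%:R) < BRight x)%O by rewrite bnd_simp.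
  have := continuous_FTC1 x1 (integrable_continuous_oc (- n%:R) _ cg) nx' (cg x).
  by rewrite derive1E => -[d1 d2]; exact: DeriveDef.
have PB (m n : nat) x : (m <= n)%N -> - m%:R <= x ->
    P n x - P n (- m%:R) = P m x.
  move=> mn mx; rewrite /P; apply: Rintegral_itvB.
  - exact: integrable_continuous_oc.
  - by rewrite bnd_simp lerN2 ler_nat.
  - by rewrite bnd_simp.
pose N x := (Num.truncn `|x|).+1.
have NP x : - (N x)%:R < x < (N x)%:R.
  by rewrite -ltr_norml; exact: truncnS_gt.
pose G x := P (N x) x - P (N x) 0.
have GE n x : (N x <= n)%N -> G x = P n x - P n 0.
  move=> Nn; rewrite /G -(PB _ _ x Nn) -?(PB _ _ 0 Nn).
  - by rewrite opprB addrA subrK.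
  - by rewrite oppr_le0.
  - by have /andP[/ltW] := NP x.
exists G => x.
(* The index [N y] may exceed [N x] by one for [y] near [x], hence the successor. *)
apply: (@near_eq_is_derive _ _ _ (fun y => P (N x).+1 y - P (N x).+1 0)).
- near=> y; apply/esym/GE; rewrite /N truncn_lt_nat//.
  have : `|x - y| < 1 by near: y; exact: cvgr_dist_lt.
  have := truncnS_gt `|x|; have := ler_normB x (x - y).
  by rewrite opprB addrCA subrr addr0 -[_.+2%:R]natr1; lra.
- rewrite -[g x]subr0; apply: (@is_deriveB _ _ _ (P (N x).+1) (cst (P (N x).+1 0))).
  apply: dP; have /andP[+ _] := NP x.
  by rewrite -[(N x).+1%:R]natr1; lra.
Unshelve. all: by end_near. Qed.

Lemma Rintegral_cc_primitive G g a b : a <= b -> continuous g ->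
  primitive G g -> \int[mu]_(t in `[a, b]) g t = G b - G a.
Proof.
rewrite le_eqVlt => /predU1P[<- _ _|ab cg Gg].
  by rewrite set_itv1 Rintegral_set1 subrr.
rewrite /Rintegral (@continuous_FTC2 _ g G)//.
- exact: continuous_subspaceT.
- have cG := primitive_continuous Gg; split.
  + by move=> t _; case: (Gg t).
  + exact/cvg_at_right_filter/cG.
  + exact/cvg_at_left_filter/cG.
- by move=> t _; rewrite derive1E; case: (Gg t).
Qed.

Lemma Rintegral_oo_primitive G g a b : a <= b -> continuous g ->
  primitive G g -> \int[mu]_(t in `]a, b[) g t = G b - G a.
Proof.
move=> ab cg Gg; rewrite -(Rintegral_cc_primitive ab cg Gg).
rewrite Rintegral_itv_bndo_bndc; last exact: integrable_continuous_oo.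
by rewrite Rintegral_itv_obnd_cbnd//; exact: integrable_continuous_oc.
Qed.

Lemma primitiveD F G f g : primitive F f -> primitive G g ->
  primitive (fun t => F t + G t) (fun t => f t + g t).
Proof. by move=> Ff Gg t; exact: is_deriveD (Ff t) (Gg t). Qed.

Lemma primitiveB F G f g : primitive F f -> primitive G g ->
  primitive (fun t => F t - G t) (fun t => f t - g t).
Proof. by move=> Ff Gg t; exact: is_deriveB (Ff t) (Gg t). Qed.

Lemma primitiveZ F f a : primitive F f ->
  primitive (fun t => a * F t) (fun t => a * f t).
Proof. by move=> Ff t; exact: (is_deriveZ a (Ff t)). Qed.

Lemma primitiveM F G f g : primitive F f -> primitive G g ->
  primitive (fun t => F t * G t) (fun t => F t * g t + f t * G t).
Proof.
move=> Ff Gg t; rewrite [f t * _]mulrC; exact: (is_deriveM (Ff t) (Gg t)).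
Qed.

Lemma primitive_shift F f a : primitive F f ->
  primitive (fun t => F (t + a)) (fun t => f (t + a)).
Proof.
move=> Ff t; rewrite -[f _]mulr1.
exact: (@is_derive1_comp _ F (shift a) t _ _ (Ff (t + a)) (is_derive_shift _ _ _)).
Qed.

Lemma primitive_cst a : primitive (fun=> a) (fun=> 0 : R).
Proof. by move=> t; exact: is_derive_cst. Qed.

Lemma primitive_ge0_homo F f a b : primitive F f -> (forall t, 0 <= f t) ->
  a <= b -> F a <= F b.
Proof.
move=> Ff f0 ab.
have cF : {within `[a, b], continuous F}.
  exact/continuous_subspaceT/(primitive_continuous Ff).
have [c _ E] := MVT_segment ab (fun x _ => Ff x) cF.
by rewrite -subr_ge0 E mulr_ge0// subr_ge0.
Qed.

Definition smooth f := forall n t, derivable (f^`(n))%classic t 1.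

(** Coinduction: a class in which every function has its derivative again in the class consists of
    smooth functions. *)
Lemma smooth_coind (P : (R -> R) -> Prop) f :
  (forall g, P g -> exists2 g', primitive g g' & P g') -> P f -> smooth f.
Proof.
move=> hP Pf n; elim: n f Pf => [|n IH] f Pf t.
  by rewrite derive1n0; have [g' fg' _] := hP _ Pf; case: (fg' t).
rewrite derive1Sn; apply: IH.
have [g' fg' Pg'] := hP _ Pf; rewrite (_ : f^`()%classic = g')//.
by apply/funext => s; rewrite derive1E; case: (fg' s).
Qed.

Lemma smooth_primitive f : smooth f -> primitive f f^`()%classic.
Proof.
by move=> sf t; rewrite derive1E; apply: DeriveDef => //; exact: (sf 0%N t).
Qed.

Lemma smooth_derive1 f : smooth f -> smooth f^`()%classic.
Proof. by move=> sf n t; rewrite -derive1Sn; exact: sf. Qed.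

Lemma smooth_continuous f : smooth f -> continuous f.
Proof. by move=> /smooth_primitive; exact: primitive_continuous. Qed.

Lemma smooth_lin a b f g : smooth f -> smooth g ->
  smooth (fun t => a * f t + b * g t).
Proof.
move=> sf sg; pose P h := exists f g, [/\ smooth f, smooth g &
  h = fun t => a * f t + b * g t].
apply: (@smooth_coind P); last by exists f, g.
move=> _ [f1 [g1 [sf1 sg1 ->]]].
exists (fun t => a * f1^`()%classic t + b * g1^`()%classic t).
  by apply: primitiveD; apply: primitiveZ; exact: smooth_primitive.
by exists f1^`()%classic, g1^`()%classic; split;
  [exact: smooth_derive1|exact: smooth_derive1|].
Qed.

Lemma smooth_of_primitive F f : primitive F f -> smooth f -> smooth F.
Proof.
move=> Ff sf; apply: (@smooth_coind (fun h => h = F \/ smooth h)); last by left.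
move=> g [->|sg]; first by exists f => //; right.
by exists g^`()%classic; [exact: smooth_primitive|right; exact: smooth_derive1].
Qed.

(** Serves at the ends of the support of the bump, where no single formula describes the function on
    both sides. *)
Lemma is_derive_quadratic f x (C : R) : f x = 0 ->
  (forall y, `|f y| <= C * (y - x) ^+ 2) -> is_derive x 1 f 0.
Proof.
move=> fx fC; apply: is_derive_eps => e e0.
have C0 : 0 <= C.
  by have := fC (x + 1); rewrite addrAC subrr add0r expr1n mulr1; exact: le_trans.
have C1 : 0 < C + 1 by lra.
near=> y; rewrite fx subr0 mul0r subr0 (le_trans (fC y))//.
rewrite -real_normK ?num_real// expr2 mulrA ler_wpM2r//.
have : `|x - y| <= e / (C + 1).
  by near: y; apply: cvgr_dist_le => //; rewrite divr_gt0.
rewrite ler_pdivlMr// distrC mulrDr mulr1 mulrC => h.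
by apply: le_trans h; rewrite lerDl.
Unshelve. all: by end_near. Qed.

(** The bound exp y >= y^(n + 2) / (n + 2)! at y = 1 / x absorbs a pole of order n and leaves two
    powers of x. *)
Lemma invX_expR_le (n : nat) x : 0 < x ->
  x^-1 ^+ n * expR (- x^-1) <= n.+2`!%:R * x ^+ 2.
Proof.
move=> x0; have xV0 : 0 < x^-1 by rewrite invr_gt0.
have := expR_ge1Dxn n.+1 (ltW xV0).
have f0 : 0 < n.+2`!%:R :> R by rewrite ltr0n fact_gt0.
move=> h; have {}h : x^-1 ^+ n.+2 / n.+2`!%:R <= expR x^-1 by lra.
rewrite expRN ler_pdivrMr ?expR_gt0//.
rewrite ler_pdivrMr// in h.
have -> : x^-1 ^+ n = x^-1 ^+ n.+2 * x ^+ 2.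
  by rewrite -addn2 exprD -mulrA -exprMn mulVf ?gt_eqF// expr1n mulr1.
rewrite [leRHS](_ : _ = expR x^-1 * n.+2`!%:R * x ^+ 2); last first.
  by rewrite mulrAC [_ * expR _]mulrC.
by rewrite ler_wpM2r// sqr_ge0.
Qed.

(** * A smooth bump on an interval *)

Section Bump.
Variables a b : R.
Hypothesis ab : a < b.

Let q : {poly R} := ('X - a%:P) * (b%:P - 'X).

Let qE t : q.[t] = (t - a) * (b - t).
Proof. by rewrite /q !hornerE. Qed.

Let q_gt0 t : a < t < b -> 0 < q.[t].
Proof. by move=> /andP[at_ tb]; rewrite qE mulr_gt0// subr_gt0. Qed.

(* This class of functions is closed under differentiation, whence the
   smoothness of [exp (- 1 / q)] extended by 0. *)
Let flat (p : {poly R}) (n : nat) t :=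
  if a < t < b then p.[t] * q.[t]^-1 ^+ n * expR (- q.[t]^-1) else 0.

(** The exponential leaves a factor q^2, and inside the interval q is at most b - a times the
    distance to either end; [p] is bounded there. *)
Let flat_bound p n : exists C : R, forall y, `|flat p n y| <= C * (y - a) ^+ 2 /\
  `|flat p n y| <= C * (y - b) ^+ 2.
Proof.
have cp : {within `[a, b], continuous (fun t => `|p.[t]|)}.
  apply: continuous_subspaceT => t; apply: continuous_comp.
    exact: continuous_horner.
  exact: norm_continuous.
have [c _ pc] := EVT_max (ltW ab) cp.
pose C := `|p.[c]| * (n.+2`!%:R * (b - a) ^+ 2).
have C0 : 0 <= C by apply: mulr_ge0 => //; apply: mulr_ge0 => //; exact: sqr_ge0.
exists C => y; rewrite /flat; case: ifPn => [/andP[ay yb]|_]; last first.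
  by rewrite normr0; split; apply: mulr_ge0 => //; exact: sqr_ge0.
have q0 : 0 < q.[y] by rewrite q_gt0// ay.
have H : `|p.[y] * q.[y]^-1 ^+ n * expR (- q.[y]^-1)| <=
    `|p.[c]| * (n.+2`!%:R * q.[y] ^+ 2).
  rewrite -mulrA normrM ler_pM//.
    by apply: pc; rewrite in_itv/= !ltW.
  rewrite ger0_norm; first exact: invX_expR_le.
  by rewrite mulr_ge0 ?expR_ge0// exprn_ge0// invr_ge0 ltW.
have sq : q.[y] ^+ 2 <= (b - a) ^+ 2 * (y - a) ^+ 2 /\
    q.[y] ^+ 2 <= (b - a) ^+ 2 * (y - b) ^+ 2.
  rewrite -(sqrrN (y - b)) opprB -!exprMn.
  by split; apply: lerXn2r; rewrite ?nnegrE; rewrite ?qE; nra.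
by split; apply: le_trans H _; rewrite -mulrA ler_wpM2l// -mulrA ler_wpM2l//;
  case: sq.
Qed.

(** The product rule for p q^(- n) exp (- 1 / q), over the common denominator q^(n + 2). *)
Let flat_deriv p n : primitive (flat p n)
  (flat (p^`() * q ^+ 2 - n%:R *: (p * q^`() * q) + p * q^`()) n.+2).
Proof.
move=> t; have [tab|tab] := boolP (a < t < b).
  rewrite /flat tab.
  apply: (@near_eq_is_derive _ _ _
    (fun t => p.[t] * q.[t]^-1 ^+ n * expR (- q.[t]^-1))).
    have /andP[at_ tb] := tab.
    near=> s; rewrite ifT//; apply/andP; split.
      by near: s; exact: lt_nbhsr.
    by near: s; exact: lt_nbhsl.
  have q0 := gt_eqF (q_gt0 tab).
  have dq := is_derive_poly q t; have dp := is_derive_poly p t.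
  have dV := is_deriveV (negbT q0) dq.
  have := is_deriveX n dV; rewrite (_ : _ ^+ n = fun s => q.[s]^-1 ^+ n);
    last by apply/funext => s; rewrite fctE.
  move=> dX.
  have dE := is_derive1_comp (is_derive_expR _) (is_deriveN dV).
  apply: is_derive_eq (is_deriveM (is_deriveM dp dX) dE) _.
  have pE (r : {poly R}) : (p^`() * r ^+ 2 - n%:R *: (p * r^`() * r)
      + p * r^`()).[t] = p^`().[t] * r.[t] ^+ 2
        - n%:R * (p.[t] * r^`().[t] * r.[t]) + p.[t] * r^`().[t].
    by rewrite !(hornerD, hornerN, hornerM, hornerZ, horner_exp).
  rewrite pE /= !fctE /GRing.scale/= {pE dX dE dV}.
  move: q0 => /negbT; move: (q.[t]) (q^`().[t]) (p.[t]) (p^`().[t]) => Q Q' P P'.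
  move: (expR _) => E Q0; case: n => [|m]; first by rewrite !expr0; field.
  by rewrite succnK !exprS; move: (Q^-1 ^+ m) => Y; field.
(* Outside the open interval the claimed derivative is 0: at the two ends by the quadratic bound,
   elsewhere because the function vanishes nearby. *)
have -> : flat (p^`() * q ^+ 2 - n%:R *: (p * q^`() * q) + p * q^`()) n.+2 t = 0.
  by rewrite /flat (negbTE tab).
have [C hC] := flat_bound p n.
have fa : flat p n a = 0 by rewrite /flat ltxx.
have fb : flat p n b = 0 by rewrite /flat ltxx andbF.
have [<-|ta] := eqVneq a t.
  by apply: (@is_derive_quadratic _ _ C) => // y; case: (hC y).
have [<-|tb] := eqVneq b t.
  by apply: (@is_derive_quadratic _ _ C) => // y; case: (hC y).
apply: (@near_eq_is_derive _ _ _ (cst (0 : R))).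
have [tlta|ge_ta] := ltP t a.
  near=> s; rewrite /flat ifF//; apply/negP => /andP[+ _]; apply/negP.
  by rewrite -leNgt ltW//; near: s; exact: lt_nbhsl.
have at_ : a < t by rewrite lt_neqAle ta.
move: tab; rewrite at_/= -leNgt => bt.
have bltt : b < t by rewrite lt_neqAle tb.
near=> s; rewrite /flat ifF//; apply/negP => /andP[_]; apply/negP.
by rewrite -leNgt ltW//; near: s; exact: lt_nbhsr.
Unshelve. all: by end_near. Qed.

Lemma smooth_bump : exists rho : R -> R, [/\ smooth rho,
  forall t, 0 <= rho t, forall t, ~~ (a < t < b) -> rho t = 0 &
  forall t, a < t < b -> 0 < rho t].
Proof.
exists (flat 1 0); split.
- apply: (@smooth_coind (fun f => exists p n, f = flat p n)); last by exists 1, 0%N.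
  move=> _ [p [n ->]]; eexists; first exact: flat_deriv.
  by eexists; eexists.
- move=> t; rewrite /flat; case: ifP => // _.
  by rewrite hornerC expr0 !mul1r expR_ge0.
- by move=> t /negbTE tab; rewrite /flat tab.
- by move=> t tab; rewrite /flat tab hornerC expr0 !mul1r expR_gt0.
Qed.

End Bump.

End Calculus.

(** * The du Bois-Reymond lemma for continuous functions *)

Section DuBoisReymond.
Variable R : realType.
Local Notation mu := (@lebesgue_measure R).
Implicit Types (a b c t x : R) (f g F G : R -> R).

Lemma test_function0 (tau : R) (phi : R -> R) t : test_function tau phi ->
  ~~ (0 < t < tau) -> phi t = 0.
Proof.
move=> [_ supp] t0; apply/eqP; apply: contraNT t0 => t0.
have /supp : closure [set t | phi t != 0] t by exact: subset_closure.
by rewrite /= in_itv.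
Qed.

(** Only the lower boundary term survives, since [phi] vanishes at [tau]. The lower end is kept free
    because Fubini will produce integrals over []s, tau[]. *)
Lemma test_function_by_parts (tau s : R) (phi K k : R -> R) : 0 <= s <= tau ->
  test_function tau phi -> primitive K k -> continuous k ->
  \int[mu]_(t in `]s, tau[) (K t * phi^`()%classic t + k t * phi t) =
  - (K s * phi s).
Proof.
move=> /andP[s0 st] tphi Kk ck; have [sphi _] := tphi.
rewrite (Rintegral_oo_primitive _ _ (primitiveM Kk (smooth_primitive sphi)))//.
  by rewrite (test_function0 tphi (t := tau)) ?mulr0 ?sub0r// ltxx andbF.
move=> t; apply: cvgD; apply: cvgM.
- exact: primitive_continuous Kk t.
- exact: smooth_continuous (smooth_derive1 sphi) t.
- exact: ck.
- exact: smooth_continuous sphi t.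
Qed.

(** The point [s] may be an end of the interval, out of reach of test functions; it is traded for a
    closed interval close to it and strictly inside, to the right of [s] unless [s] is [tau]. *)
Let inner_itv (tau s : R) (P : set R) : 0 < tau -> 0 <= s <= tau ->
  (\forall x \near s, P x) ->
  exists a b, [/\ 0 < a, a < b, b < tau & forall x, a <= x <= b -> P x].
Proof.
move=> tau0 /andP[s0 st] /nbhs_ballP[d /= d0 hd].
have [slt|ts] := ltP s tau.
  pose e := Num.min d (tau - s).
  have e0 : 0 < e by rewrite lt_min d0 subr_gt0.
  have [ed es] : e <= d /\ e <= tau - s by rewrite !ge_min !lexx orbT.
  exists (s + e / 3), (s + e / 2); split; [lra|lra|lra|].
  move=> x /andP[x1 x2]; apply: hd; rewrite /ball/= ltr_norml; lra.
pose e := Num.min d tau.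
have e0 : 0 < e by rewrite lt_min d0.
have [ed es] : e <= d /\ e <= tau by rewrite !ge_min !lexx orbT.
exists (tau - e / 2), (tau - e / 3); split; [lra|lra|lra|].
move=> x /andP[x1 x2]; apply: hd; rewrite /ball/= ltr_norml; lra.
Qed.

Let bump_total a b (tau : R) : 0 < a -> a < b -> b < tau ->
  exists (rho P : R -> R), [/\ smooth rho, primitive P rho, forall t, 0 <= rho t,
    forall t, ~~ (a <= t <= b) -> rho t = 0 & [/\ P 0 < P tau,
    forall t, t <= a -> P t = P 0 & forall t, b <= t -> P t = P tau]].
Proof.
move=> a0 ab bt.
have [rho [srho rho0 rho_out rho_in]] := smooth_bump ab.
have [P Prho] := continuous_primitive (smooth_continuous srho).
have cP x y : {within `[x, y], continuous P}.
  exact/continuous_subspaceT/(primitive_continuous Prho).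
have cst x y : x <= y -> (forall t, x < t < y -> ~~ (a < t < b)) -> P x = P y.
  move=> xy out; apply: (is_derive0_cst xy (cP _ _)) => t txy.
  by rewrite -(rho_out t (out t txy)).
have left t : t <= a -> P t = P a.
  move=> ta; apply: cst => // s /andP[_ sa].
  by rewrite negb_and -!leNgt ltW.
have right t : b <= t -> P b = P t.
  move=> ta; apply: cst => // s /andP[bs _].
  by rewrite negb_and -!leNgt (ltW bs) orbT.
have [c cab E] := MVT ab (fun x _ => Prho x) (cP a b).
have Pab : P a < P b.
  rewrite -subr_gt0 E mulr_gt0 ?subr_gt0//; apply: rho_in.
  by move: cab; rewrite in_itv.
exists rho, P; split => //.
  move=> t h; apply: rho_out; apply: contra h => /andP[? ?].
  by rewrite !ltW.
split.
- by rewrite left ?ltW// -(right tau (ltW bt)).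
- by move=> t ta; rewrite (left t ta) (left 0)// ltW.
- by move=> t tb; rewrite -right// -(right tau (ltW bt)).
Qed.

(** If D s < D t, test with a [phi] whose derivative is a normalised bump near [s] minus one near
    [t]: the integral is an average of [D] near [s] minus an average near [t], hence negative. *)
Let weak_derive0 (tau : R) (D : R -> R) : 0 < tau -> continuous D ->
  (forall phi, test_function tau phi ->
    \int[mu]_(t in `]0, tau[) (D t * phi^`()%classic t) = 0) ->
  forall s t, 0 <= s <= tau -> 0 <= t <= tau -> D t <= D s.
Proof.
move=> tau0 cD wD s t s0 t0; rewrite leNgt; apply/negP => Dst.
(* These two levels cut the gap between D s and D t into thirds. *)
pose m1 := (2 * D s + D t) / 3; pose m2 := (D s + 2 * D t) / 3.
have m12 : m1 < m2 by rewrite /m1 /m2; lra.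
have near1 : \forall x \near s, D x <= m1.
  have e0 : 0 < m1 - D s by rewrite /m1; lra.
  have /cvgrPdist_le/(_ _ e0) := cD s; apply: filterS => x.
  by rewrite ler_norml; lra.
have near2 : \forall x \near t, m2 <= D x.
  have e0 : 0 < D t - m2 by rewrite /m2; lra.
  have /cvgrPdist_le/(_ _ e0) := cD t; apply: filterS => x.
  by rewrite ler_norml; lra.
have [a1 [b1 [a10 ab1 b1t D1]]] := inner_itv tau0 s0 near1.
have [a2 [b2 [a20 ab2 b2t D2]]] := inner_itv tau0 t0 near2.
have [r1 [P1 [sr1 Pr1 r10 r1o [c10 P1l P1r]]]] := bump_total a10 ab1 b1t.
have [r2 [P2 [sr2 Pr2 r20 r2o [c20 P2l P2r]]]] := bump_total a20 ab2 b2t.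
pose c1 := P1 tau - P1 0; pose c2 := P2 tau - P2 0.
have c1_gt0 : 0 < c1 by rewrite subr_gt0.
have c2_gt0 : 0 < c2 by rewrite subr_gt0.
(* [phi] rises by 1 across the first bump and falls by 1 across the second; the constant makes it
   vanish before both, hence also after both. *)
pose phi x := (c1^-1 * P1 x + - c2^-1 * P2 x) + (c2^-1 * P2 0 - c1^-1 * P1 0).
pose psi x := c1^-1 * r1 x + - c2^-1 * r2 x.
have phipsi : primitive phi psi.
  move=> x; have := primitiveD (primitiveD (primitiveZ c1^-1 Pr1)
    (primitiveZ (- c2^-1) Pr2)) (primitive_cst (c2^-1 * P2 0 - c1^-1 * P1 0)) x.
  by rewrite addr0.
have dphi x : phi^`()%classic x = psi x by rewrite derive1E; case: (phipsi x).
have spsi : smooth psi by exact: smooth_lin.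
have tphi : test_function tau phi.
  split; first exact: smooth_of_primitive phipsi spsi.
  pose lo := Num.min a1 a2; pose hi := Num.max b1 b2.
  have [lo1 lo2] : lo <= a1 /\ lo <= a2 by rewrite !ge_min !lexx orbT.
  have [hi1 hi2] : b1 <= hi /\ b2 <= hi by rewrite !le_max !lexx orbT.
  have lohi : `[lo, hi]%classic `<=` `]0, tau[.
    apply: subset_itvSoo; rewrite bnd_simp.
      by rewrite lt_min a10.
    by rewrite gt_max b1t.
  apply: subset_trans lohi.
  rewrite [X in _ `<=` X](closure_id _).1; last exact: itv_closed.
  apply: closure_subset.
  move=> x /= phix; rewrite in_itv/=; apply: contraNT phix.
  rewrite negb_and -!ltNge => /orP[xlo|xhi].
    by rewrite /phi (P1l x) ?(P2l x)//; [apply/eqP; ring|lra|lra].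
  rewrite /phi (P1r x) ?(P2r x)//; [|lra|lra].
  rewrite (_ : _ + _ = c1^-1 * c1 - c2^-1 * c2); last by rewrite /c1 /c2; ring.
  by rewrite (mulVf (lt0r_neq0 c1_gt0)) (mulVf (lt0r_neq0 c2_gt0)) subrr.
have /= := wD _ tphi.
have cDr r : smooth r -> continuous (fun x => D x * r x).
  by move=> sr x; apply: cvgM; [exact: cD|exact: (smooth_continuous sr)].
have [Q1 Q1P] := continuous_primitive (cDr _ sr1).
have [Q2 Q2P] := continuous_primitive (cDr _ sr2).
have cDpsi := cDr _ spsi.
under eq_Rintegral do rewrite dphi.
have QP : primitive (fun x => c1^-1 * Q1 x + - c2^-1 * Q2 x) (fun x => D x * psi x).
  move=> x; rewrite /psi mulrDr !(mulrCA (D x)).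
  by apply: (primitiveD (primitiveZ _ Q1P) (primitiveZ _ Q2P)).
rewrite (Rintegral_oo_primitive (ltW tau0) cDpsi QP).
have h1 : Q1 tau - Q1 0 <= m1 * c1.
  have := @primitive_ge0_homo _ _ _ 0 tau (primitiveB (primitiveZ m1 Pr1) Q1P).
  rewrite /c1; move=> /(_ _ (ltW tau0)) h.
  suff: m1 * P1 0 - Q1 0 <= m1 * P1 tau - Q1 tau by lra.
  apply: h => x; rewrite -mulrBl; have [xab|xab] := boolP (a1 <= x <= b1).
    by rewrite mulr_ge0// subr_ge0 D1.
  by rewrite r1o// mulr0.
have h2 : m2 * c2 <= Q2 tau - Q2 0.
  have := @primitive_ge0_homo _ _ _ 0 tau (primitiveB Q2P (primitiveZ m2 Pr2)).
  rewrite /c2; move=> /(_ _ (ltW tau0)) h.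
  suff: Q2 0 - m2 * P2 0 <= Q2 tau - m2 * P2 tau by lra.
  apply: h => x; rewrite -mulrBl; have [xab|xab] := boolP (a2 <= x <= b2).
    by rewrite mulr_ge0// subr_ge0 D2.
  by rewrite r2o// mulr0.
have {}h1 : c1^-1 * (Q1 tau - Q1 0) <= m1 by rewrite ler_pdivrMl// mulrC.
have {}h2 : m2 <= c2^-1 * (Q2 tau - Q2 0) by rewrite ler_pdivlMl// mulrC.
lra.
Qed.

(** [K] satisfies the same weak identity by parts, so [g - K] has weak derivative 0. *)
Lemma du_bois_reymond (tau : R) (g k K : R -> R) : 0 < tau -> continuous g ->
  continuous k -> primitive K k ->
  (forall phi, test_function tau phi ->
    \int[mu]_(t in `]0, tau[) (g t * phi^`()%classic t) =
    - \int[mu]_(t in `]0, tau[) (k t * phi t)) ->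
  forall t, 0 <= t <= tau -> g t - g 0 = K t - K 0.
Proof.
move=> tau0 cg ck Kk wg.
have cK := primitive_continuous Kk.
have cD : continuous (fun t => g t - K t).
  by move=> t; apply: cvgB; [exact: cg|exact: cK].
have wD phi : test_function tau phi ->
    \int[mu]_(t in `]0, tau[) ((g t - K t) * phi^`()%classic t) = 0.
  move=> tphi; have [sphi _] := tphi.
  have cphi := smooth_continuous sphi.
  have cphi' := smooth_continuous (smooth_derive1 sphi).
  have ioo (h : R -> R) : continuous h -> mu.-integrable `]0, tau[ (EFin \o h).
    by move=> ch; exact: integrable_continuous_oo.
  have cM (h1 h2 : R -> R) : continuous h1 -> continuous h2 ->
      continuous (fun t => h1 t * h2 t).
    by move=> c1 c2 x; apply: cvgM; [exact: c1|exact: c2].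
  have tau00 : 0 <= (0 : R) <= tau by rewrite lexx ltW.
  have := test_function_by_parts tau00 tphi Kk ck.
  rewrite (test_function0 tphi) ?ltxx// mulr0 oppr0.
  rewrite RintegralD//; [|exact: ioo (cM _ _ cK cphi')|exact: ioo (cM _ _ ck cphi)].
  have -> : \int[mu]_(t in `]0, tau[) ((g t - K t) * phi^`()%classic t) =
      \int[mu]_(t in `]0, tau[) (g t * phi^`()%classic t - K t * phi^`()%classic t).
    by apply: eq_Rintegral => t _; rewrite mulrBl.
  rewrite RintegralB//; [|exact: ioo (cM _ _ cg cphi')|exact: ioo (cM _ _ cK cphi')].
  by rewrite wg//; lra.
move=> t t0; have tau00 : 0 <= (0 : R) <= tau by rewrite lexx ltW.
have := weak_derive0 tau0 cD wD t0 tau00; have := weak_derive0 tau0 cD wD tau00 t0.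
lra.
Qed.

End DuBoisReymond.

(** * Approximation by simple functions *)

Section SimpleApproximation.
Variables (R : realType) (X : normedModType R).
Local Notation mu := (@lebesgue_measure R).
Implicit Types (s : R -> X) (D : set R).

(* For complete [X] this is convertible to [simple_function] with real scalars. *)
Definition simple s :=
  finite_set (range s) /\ forall x, measurable (s @^-1` [set x]).

Lemma simple_preimage s (B : set X) : simple s -> measurable (s @^-1` B).
Proof.
move=> [fs ms]; rewrite (_ : _ @^-1` _ =
    \bigcup_(x in range s `&` B) s @^-1` [set x]).
  apply: fin_bigcup_measurable => //.
  exact: finite_setIl.
apply/seteqP; split=> [t Bt|t [x [_ Bx] /= ->]//].
by exists (s t) => //; split => //; exists t.
Qed.

Lemma simple_map2 s1 s2 (H : X -> X -> X) :
  simple s1 -> simple s2 -> simple (fun t => H (s1 t) (s2 t)).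
Proof.
move=> h1 h2; split; first exact: finite_image11 h1.1 h2.1.
move=> x; rewrite (_ : _ @^-1` _ = \bigcup_(y in range s1)
    (s1 @^-1` [set y] `&` s2 @^-1` [set z | H y z = x])).
  apply: fin_bigcup_measurable => [|y _]; first exact: h1.1.
  by apply: measurableI; [exact: h1.2|exact: simple_preimage].
apply/seteqP; split=> [t /= Ht|t [y _ /= [-> ->]]//].
by exists (s1 t) => //; exists t.
Qed.

Lemma simple_measurable_fun s (h : X -> R) : simple s ->
  measurable_fun setT (fun t => h (s t)).
Proof.
move=> ss _ B mB; rewrite setTI.
by rewrite (_ : _ @^-1` B = s @^-1` (h @^-1` B))//; exact: simple_preimage.
Qed.

Lemma simple_restrict s D : measurable D -> simple s ->
  simple (fun t => \1_D t *: s t).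
Proof.
move=> mD [fs ms]; split.
  apply: (@sub_finite_set _ _ (range s `|` [set 0])); last first.
    by rewrite finite_setU; split => //; exact: finite_set1.
  move=> _ [t _ <-]; rewrite indicE; case: (t \in D).
    by left; exists t => //; rewrite scale1r.
  by right; rewrite scale0r.
move=> x; rewrite (_ : _ @^-1` _ = (D `&` s @^-1` [set x]) `|`
    (~` D `&` [set t | 0 = x])).
  apply: measurableU; apply: measurableI => //; first exact: measurableC.
  have [->|x0] := pselect (0 = x).
    by rewrite (_ : mkset _ = setT)//; apply/seteqP.
  by rewrite (_ : mkset _ = set0)//; apply/seteqP; split => // t /= /x0.
apply/seteqP; split=> [t /=|t [|] [Dt /= <-]].
- rewrite indicE; case: (boolP (t \in D)) => [|] Dt /=.
    by rewrite scale1r => <-; left; split => //; exact/set_mem.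
  by rewrite scale0r => <-; right; split => //; rewrite -in_setE in_setC.
- by rewrite indicE mem_set// scale1r.
- by rewrite indicE memNset// scale0r.
Qed.

(** Convergence is asked at every point, not almost everywhere: composition with a continuous
    function is then Borel. *)
Definition simple_limit (f : R -> X) :=
  exists2 s : nat -> R -> X, (forall n, simple (s n)) &
    forall t, s n t @[n --> \oo] --> f t.

Lemma measurable_simple_limit (f : R -> X) (h : X -> R) : continuous h ->
  simple_limit f -> measurable_fun setT (fun t => h (f t)).
Proof.
move=> ch [s ss sf]; apply: (@measurable_fun_cvg _ _ _ _ (fun n t => h (s n t))).
  by move=> n; exact: simple_measurable_fun.
by move=> t _; apply: (cvg_comp (fun n => s n t) h (sf t)); exact: ch.
Qed.

(** For an almost everywhere limit the norm may fail to be Borel, so monotonicity is read off from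
    the supremum over simple functions below the integrand. *)
Lemma le_lower_integral D (f g : R -> \bar R) :
  (forall x, D x -> 0 <= f x)%E -> (forall x, D x -> f x <= g x)%E ->
  (\int[mu]_(x in D) f x <= \int[mu]_(x in D) g x)%E.
Proof.
move=> f0 fg; have g0 x : D x -> (0 <= g x)%E.
  by move=> Dx; apply: le_trans (f0 _ Dx) (fg _ Dx).
rewrite !ge0_integralE//; apply: le_ereal_sup => _ [h /= hf <-]; exists h => //=.
move=> x; apply: le_trans (hf x) _; rewrite /patch; case: ifPn => // /set_mem.
exact: fg.
Qed.

(* The integrals below are lower integrals unless the integrand is measurable,
   so that passing to a Borel version of [f] can only decrease them. *)
Lemma simple_limit_version D (f : R -> X) : measurable D ->
  (exists2 s : nat -> R -> X, (forall n, simple (s n)) &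
    {ae mu, forall t, D t -> s n t @[n --> \oo] --> f t}) ->
  (\int[mu]_(t in D) `|f t|%:E < +oo)%E ->
  exists g, [/\ simple_limit g, {ae mu, forall t, D t -> g t = f t} &
    mu.-integrable D (fun t => `|g t|%:E)].
Proof.
move=> mD [s ss [N [mN N0 sN]]] fD.
have mDN : measurable (D `\` N) by exact: measurableD.
pose g t := \1_(D `\` N) t *: f t.
have sg : simple_limit g.
  exists (fun n t => \1_(D `\` N) t *: s n t).
    by move=> n; exact: simple_restrict.
  move=> t; rewrite /g indicE; have [|] := boolP (t \in D `\` N).
    move=> /set_mem[Dt Nt] /=.
    under eq_cvg do rewrite scale1r; rewrite scale1r.
    have : ~ (~` [set t | D t -> s n t @[n --> \oo] --> f t]) t.
      by move=> h; apply: Nt; exact: sN.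
    by move=> /contrapT; exact.
  by move=> _ /=; under eq_cvg do rewrite scale0r; rewrite scale0r; exact: cvg_cst.
exists g; split => //.
  exists N; split => // t /= h; apply: contrapT => Nt; apply: h => Dt.
  by rewrite /g indicE mem_set ?scale1r.
apply/integrableP; split.
  apply/measurable_EFinP; apply: measurable_funS (measurable_simple_limit _ sg) => //.
  exact: norm_continuous.
apply: le_lt_trans fD; apply: le_lower_integral => t Dt; first exact: abse_ge0.
rewrite /= lee_fin normr_id /g normrZ indicE; case: (_ \in _) => /=.
  by rewrite normr1 mul1r.
by rewrite normr0 mul0r.
Qed.

Lemma simple_dist_measurable (f : R -> X) s : simple_limit f -> simple s ->
  measurable_fun setT (fun t => `|f t - s t|).
Proof.
move=> [r sr rf] ss; apply: (@measurable_fun_cvg _ _ _ _ (fun n t => `|r n t - s t|)).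
  move=> n; apply: (simple_measurable_fun (fun x => `|x|)).
  exact: (@simple_map2 _ _ (fun x y => x - y)).
by move=> t _; apply: cvg_norm; apply: cvgB; [exact: rf|exact: cvg_cst].
Qed.

Lemma simple_L1_approx D (f : R -> X) (e : R) : measurable D -> 0 < e ->
  simple_limit f -> mu.-integrable D (fun t => `|f t|%:E) ->
  exists s, [/\ simple s, mu.-integrable D (fun t => `|f t - s t|%:E) &
    \int[mu]_(t in D) `|f t - s t| <= e].
Proof.
move=> mD e0 lf fD; have [s ss sf] := lf.
have mnf : measurable_fun setT (fun t => `|f t|).
  by apply: (@measurable_simple_limit f (fun x => `|x|)) => //; exact: norm_continuous.
(* Truncating [s n] where it exceeds 2 |f| gives the integrable majorant 3 |f| for the distance. The
   truncation is eventually inactive where f is nonzero, and forces the value 0 where f is 0. *)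
pose B n := [set t | `|s n t| <= 2 * `|f t|].
have mB n : measurable (B n).
  have -> : B n = (fun t => 2 * `|f t| - `|s n t|) @^-1` `[0, +oo[.
    by apply/seteqP; split=> t /=; rewrite in_itv/= andbT subr_ge0.
  rewrite -[X in measurable X]setTI; apply: measurable_funB => //.
    exact: measurable_funM.
  exact: (simple_measurable_fun (fun x => `|x|)).
pose w n t := \1_(B n) t *: s n t.
have sw n : simple (w n) by exact: simple_restrict.
have wf t : w n t @[n --> \oo] --> f t.
  have [f0|f0] := eqVneq (f t) 0.
    have -> : (fun n => w n t) = fun=> 0.
      apply/funext => n; rewrite /w indicE; case: (boolP (t \in B n)) => [/set_mem|_].
        by rewrite /B/= f0 normr0 mulr0 normr_le0 => /eqP ->; rewrite scaler0.
      by rewrite scale0r.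
    by rewrite f0; exact: cvg_cst.
  have fp : 0 < `|f t| by rewrite normr_gt0.
  apply: cvg_trans (sf t); apply: near_eq_cvg; near=> n.
  rewrite /w indicE mem_set ?scale1r// /B/=.
  have : `|f t - s n t| <= `|f t|.
    by near: n; have /cvgrPdist_le/(_ _ fp) := sf t.
  have := ler_normB (f t) (f t - s n t); rewrite opprB addrCA subrr addr0; lra.
have wle n t : `|f t - w n t| <= 3 * `|f t|.
  rewrite /w indicE; case: (boolP (t \in B n)) => [/set_mem|_].
    rewrite /B/= scale1r => h; have := ler_normB (f t) (s n t); lra.
  by rewrite scale0r subr0; have := normr_ge0 (f t); lra.
have mdist n : measurable_fun D (fun t => `|f t - w n t|%:E).
  apply/measurable_EFinP; apply: measurable_funS (simple_dist_measurable lf (sw n)) => //.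
have i3 : mu.-integrable D (fun t => (3 * `|f t|)%:E).
  by under eq_fun do rewrite EFinM; exact: integrableZl.
have idist n : mu.-integrable D (fun t => `|f t - w n t|%:E).
  apply: le_integrable i3 => // [|t Dt]; first exact: mdist.
  rewrite /= lee_fin normr_id.
  by rewrite ger0_norm ?mulr_ge0.
have := @dominated_cvg _ _ _ mu D mD (fun n t => `|f t - w n t|%:E) (cst 0%E) _ mdist.
move=> /(_ (fun t => (3 * `|f t|)%:E)); rewrite integral0 => H.
have {}H : (\int[mu]_(t in D) `|f t - w n t|%:E)%E @[n --> \oo] --> 0%E.
  apply: H => //.
  - move=> t Dt; apply: cvg_EFin; first exact: nearW.
    have /cvg_norm : f t - w n t @[n --> \oo] --> (0 : X).
      by rewrite -(subrr (f t)); apply: cvgB => //; exact: cvg_cst.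
    by rewrite normr0.
  - by move=> n t Dt; rewrite /= lee_fin normr_id.
have /fine_cvgP[_ /cvgrPdist_le/(_ _ e0)] := H.
move=> [n _ /(_ n (leqnn n))] /=; rewrite sub0r normrN => h.
exists (w n); split => //.
by apply: le_trans h; rewrite /Rintegral ler_norm.
Unshelve. all: by end_near. Qed.

End SimpleApproximation.

(** * The measure of a set up to time t, and Fubini on a triangle *)

Section MeasureBelow.
Variable R : realType.
Local Notation mu := (@lebesgue_measure R).
Implicit Types (E D : set R) (t s : R).

Lemma integrable_bounded D (f : R -> R) (C : R) : measurable D ->
  (mu D < +oo)%E -> measurable_fun setT f -> (forall x, D x -> `|f x| <= C) ->
  mu.-integrable D (EFin \o f).
Proof.
move=> mD Dfin mf fC; apply: measurable_bounded_integrable => //.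
  exact: measurable_funS mf.
exists C; split; first exact: num_real.
by move=> M CM x /= Dx; apply: le_trans (fC x Dx) (ltW CM).
Qed.

Lemma lebesgue_itvoo_fin (a b : R) : (mu `]a, b[ < +oo)%E.
Proof. by rewrite lebesgue_measure_itv/=; case: ifP => // _; rewrite ltry. Qed.

Lemma lebesgue_itvoc (a b : R) : a <= b -> mu `]a, b] = (b - a)%:E.
Proof.
move=> ab; rewrite lebesgue_measure_itv/= lte_fin; case: ifPn => // h.
by rewrite (@le_anti _ _ a b) ?subrr// ab leNgt.
Qed.

Let mu_mono (A B : set R) : measurable A -> measurable B -> A `<=` B ->
  (mu A <= mu B)%E.
Proof. by move=> mA mB AB; apply: le_measure => //; rewrite inE. Qed.

(** For E inside []0, tau[] this is |E /\ [0, t]|; with a half-line it is Lipschitz on all of R. *)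
Definition measure_below E t : R := fine (mu (E `&` `]-oo, t])).

Section Below.
Variables (E : set R) (tau : R).
Hypotheses (mE : measurable E) (Etau : E `<=` `]0, tau[).

Let mEt t : measurable (E `&` `]-oo, t]).
Proof. exact: measurableI. Qed.

Lemma measure_belowE t : (measure_below E t)%:E = mu (E `&` `]-oo, t]).
Proof.
rewrite fineK// ge0_fin_numE//; apply: le_lt_trans (lebesgue_itvoo_fin 0 tau).
by apply: mu_mono => // x [/Etau].
Qed.

Lemma measure_below_ge0 t : 0 <= measure_below E t.
Proof. by rewrite fine_ge0. Qed.

Lemma measure_below_le0 t : t <= 0 -> measure_below E t = 0.
Proof.
move=> t0; rewrite /measure_below (_ : _ `&` _ = set0) ?measure0//.
apply/seteqP; split => // x [/Etau/=]; rewrite !in_itv/= => /andP[x0 _].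
by rewrite leNgt (le_lt_trans t0).
Qed.

Lemma measure_below_eq0 a t : E `<=` [set x | a <= x] -> t <= a ->
  measure_below E t = 0.
Proof.
move=> Ea ta; apply/eqP; rewrite eq_le measure_below_ge0 andbT -lee_fin.
rewrite measure_belowE; apply: le_trans (_ : (mu [set a] <= _)%E).
  apply: mu_mono => // x [/Ea/= ax].
  rewrite in_itv/= => xt; apply/eqP; rewrite eq_le ax andbT.
  exact: le_trans xt ta.
by rewrite lebesgue_measure_set1.
Qed.

Lemma measure_below_lipschitz s t : s <= t ->
  `|measure_below E t - measure_below E s| <= t - s.
Proof.
move=> st; have <- : fine (mu (E `&` `]s, t])) = measure_below E t - measure_below E s.
  have ES : E `&` `]-oo, t] = (E `&` `]-oo, s]) `|` (E `&` `]s, t]).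
    by rewrite -setIUr -itv_bndbnd_setU// bnd_simp.
  have dS : (E `&` `]-oo, s]) `&` (E `&` `]s, t]) = set0.
    apply/seteqP; split => // x [[_ /=] ] + [_ /=]; rewrite !in_itv/=.
    by move=> xs /andP[]; rewrite ltNge xs.
  have fS : mu (E `&` `]s, t]) \is a fin_num.
    rewrite ge0_fin_numE//; apply: le_lt_trans (lebesgue_itvoo_fin 0 tau).
    by apply: mu_mono => // [|x [/Etau]//]; exact: measurableI.
  have H : ((measure_below E t)%:E =
      (measure_below E s)%:E + mu (E `&` `]s, t]))%E.
    by rewrite !measure_belowE ES measureU//; exact: measurableI.
  have /= -> := congr1 fine H; rewrite fineD//=; lra.
rewrite ger0_norm ?fine_ge0// -lee_fin fineK; last first.
  rewrite ge0_fin_numE//; apply: le_lt_trans (lebesgue_itvoo_fin 0 tau).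
  by apply: mu_mono => // [|x [/Etau]//]; exact: measurableI.
rewrite -lebesgue_itvoc//; by apply: mu_mono => //; exact: measurableI.
Qed.

Lemma measure_below_continuous : continuous (measure_below E).
Proof.
move=> t; apply/cvgrPdist_le => e e0; near=> s.
have ts : `|t - s| <= e by near: s; exact: cvgr_dist_le.
apply: le_trans ts; have [le_st|/ltW le_ts] := leP s t.
  by rewrite (ger0_norm (x := t - s)) ?subr_ge0// measure_below_lipschitz.
rewrite distrC [`|t - s|]distrC (ger0_norm (x := s - t)) ?subr_ge0//.
exact: measure_below_lipschitz.
Unshelve. all: by end_near. Qed.

(** Fubini for 1_E(s) w(t) on the triangle s <= t: integrating in s first gives the measure of E up
    to t. *)
Lemma Rintegral_below (w : R -> R) : continuous w ->
  \int[mu]_(t in `]0, tau[) (measure_below E t * w t) =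
  \int[mu]_(s in `]0, tau[) (\1_E s * \int[mu]_(t in `]s, tau[) w t).
Proof.
move=> cw; have mw : measurable_fun setT w by exact: continuous_measurable_fun.
pose D : set R := `]0, tau[%classic.
have mD : measurable D by exact: measurable_itv.
have [C wC] : exists C, forall t, D t -> `|w t| <= C.
  have [tau0|tau0] := leP tau 0.
    exists 0 => t; rewrite /D/= in_itv/= => /andP[t0 ttau].
    by have := lt_trans t0 ttau; rewrite ltNge tau0.
  have cnw : {within `[0, tau], continuous (fun t => `|w t|)}.
    apply: continuous_subspaceT => t; apply: continuous_comp (cw t) _.
    exact: norm_continuous.
  have [c _ hc] := EVT_max (ltW tau0) cnw; exists `|w c| => t.
  by move=> /subset_itv_oo_cc; exact: hc.
(* Cutting [w] to [D] lets Fubini run over the whole plane; as [E] lies in [D], the integrand is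
   dominated by a multiple of the indicator of the square. *)
pose W t := \1_D t * w t.
have mW : measurable_fun setT W by apply: measurable_funM.
have WC t : `|W t| <= `|C| * \1_D t.
  rewrite /W indicE; case: (boolP (t \in D)) => [/set_mem tD|_].
    by rewrite mul1r mulr1 (le_trans (wC _ tD))// ler_norm.
  by rewrite mul0r mulr0 normr0.
pose T : set (R * R) := [set z | z.2 <= z.1].
pose F (z : R * R) := W z.1 * (\1_E z.2 * \1_T z).
have mT : measurable T.
  have -> : T = (fun z : R * R => z.1 - z.2) @^-1` `[0, +oo[.
    by apply/seteqP; split => z /=; rewrite /T/= in_itv/= andbT subr_ge0.
  rewrite -[X in measurable X]setTI; apply: measurable_funB => //.
have mF : measurable_fun setT F.
  apply: measurable_funM; first exact: (measurableT_comp mW measurable_fst).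
  apply: measurable_funM; last exact: measurable_indic.
  apply: measurableT_comp measurable_snd.
  exact: measurable_indic.
have mEF : measurable_fun setT (EFin \o F) by exact/measurable_EFinP.
have Fle t s : `|F (t, s)| <= `|C| * \1_D t * \1_D s.
  rewrite /F normrM ler_pM//.
  rewrite /= !indicE; case: (boolP (s \in E)) => [/set_mem/Etau sD|_]; last first.
    by rewrite mul0r normr0.
  by rewrite (mem_set sD) mul1r ger0_norm// ler_nat leq_b1.
have iD : mu.-integrable setT (EFin \o \1_D).
  exact: integrable_indic_itv.
have inner t : (\int[mu]_s `|(EFin \o F) (t, s)| <=
    (`|C| * \1_D t)%:E * mu D)%E.
  apply: le_trans (_ : (\int[mu]_s ((`|C| * \1_D t) * \1_D s)%:E <= _)%E).
    apply: ge0_le_integral => //.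
    - by apply: measurableT_comp => //; exact: measurableT_comp mEF _.
    - apply/measurable_EFinP; apply: measurable_funM => //.
    - by move=> s _; rewrite lee_fin.
  under eq_integral do rewrite EFinM.
  by rewrite integralZl// integral_indic// setIT.
have iF : (mu \x mu)%E.-integrable setT (EFin \o F).
  apply/integrable12ltyP => //.
  apply: le_lt_trans (_ : (\int[mu]_t ((`|C| * \1_D t)%:E * mu D) < +oo)%E).
    apply: ge0_le_integral => //.
    - by move=> t _; exact: integral_ge0.
    - apply: (@measurable_fun_fubini_tonelli_F _ _ _ _ _ mu
        (fun z => `|(EFin \o F) z|%E)) => //.
      exact: measurableT_comp.
    - apply: emeasurable_funM => //; apply/measurable_EFinP.
      exact: measurable_funM.
  have Dfin := lebesgue_itvoo_fin 0 tau.
  rewrite -(@fineK _ (mu D)) ?ge0_fin_numE//.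
  under eq_integral do rewrite -EFinM mulrAC EFinM.
  rewrite integralZl// integral_indic// setIT lte_mul_pinfty// lee_fin.
  by rewrite mulr_ge0 ?fine_ge0.
have innerW t : (\int[mu]_s (EFin \o F) (t, s) = (W t * measure_below E t)%:E)%E.
  transitivity (\int[mu]_s ((W t)%:E * (\1_(E `&` `]-oo, t]) s)%:E))%E.
    apply: eq_integral => s _; rewrite /F/= -EFinM; congr (W t * _)%:E.
    by rewrite indicI/= !indicE !mem_setE/= in_itv.
  rewrite integralZl//; last first.
    apply: le_integrable iD => //.
      by apply/measurable_EFinP; apply: measurable_indic; exact: mEt.
    move=> s _; rewrite /= lee_fin !indicE.
    case: (boolP (s \in E `&` _)) => [/set_mem[/Etau sD _]|_]; last first.
      by rewrite normr0.
    by rewrite (mem_set sD).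
  rewrite (integral_indic mu measurableT (mEt t)) setIT.
  rewrite [RHS](_ : _ = ((W t)%:E * (measure_below E t)%:E)%E)//.
  by congr (_ * _)%E; exact/esym/measure_belowE.
have innerE s : (\int[mu]_t (EFin \o F) (t, s) =
    (\1_E s * \int[mu]_(t in `]s, tau[) w t)%:E)%E.
  rewrite indicE; case: (boolP (s \in E)) => [sE|sE]; last first.
    rewrite mul0r; apply: integral0_eq => t _.
    by rewrite /F/= indicE (negbTE sE) mul0r mulr0.
  have iw : mu.-integrable setT (EFin \o w \_ `[s, tau[).
    rewrite -restrict_EFin; apply/integrable_restrict => //=; rewrite setTI.
    apply: integrableS (integrable_continuous s tau cw) => //.
    by apply: subset_itvl; rewrite bnd_simp.
  (* The triangle is closed, so its section is [[s, tau[], which differs from []s, tau[] by one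
     point. *)
  rewrite mul1r Rintegral_itv_obnd_cbnd; last exact: integrable_continuous_oo.
  rewrite Rintegral_mkcond /Rintegral fineK; last first.
    exact: (integrable_fin_num measurableT iw).
  apply: eq_integral => t _; congr (_%:E).
  have := Etau (set_mem sE); rewrite /F/W/= in_itv/= => /andP[s0 stau].
  have TE : ((t, s) \in T) = (s <= t).
    by apply/idP/idP => [/set_mem//|h]; exact: mem_set.
  rewrite !indicE sE mul1r patchE TE !mem_setE !in_itv/=.
  have [st|ts] := leP s t; last by rewrite mulr0.
  by rewrite (lt_le_trans s0 st)/= mulr1; case: ifP; rewrite ?mul1r ?mul0r.
have := Fubini iF.
under eq_integral do rewrite innerW.
under [in X in _ = X -> _]eq_integral do rewrite innerE.
move=> H; rewrite [LHS]Rintegral_mkcond [RHS]Rintegral_mkcond; congr fine.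
apply: etrans (etrans _ H) _; apply: eq_integral => t _; congr (_%:E).
  rewrite patchE /W indicE.
  by case: ifPn => _; rewrite ?mul1r ?mul0r// mulrC.
rewrite patchE; case: ifPn => // tD; rewrite indicE memNset ?mul0r// => /Etau tD'.
by move: tD; rewrite mem_set.
Qed.

End Below.

End MeasureBelow.

Lemma integrable_ext (R : realType) (A : set R) (F G : R -> R) :
  measurable A -> (forall t, A t -> F t = G t) ->
  (@lebesgue_measure R).-integrable A (fun t => (G t)%:E) ->
  (@lebesgue_measure R).-integrable A (fun t => (F t)%:E).
Proof.
move=> mA FG; apply: eq_integrable => // t; rewrite inE => At.
by rewrite FG.
Qed.

(** * Mild solutions *)

Section Mild.
Variables (R : realType) (X : completeNormedModType R).
Variables (S : R -> {linear X -> X}) (hS : semigroup S).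
Variables (tau : R) (tau0 : 0 < tau).
Local Notation mu := (@lebesgue_measure R).
Local Notation D := (`]0, tau[%classic : set R).
Implicit Types (r q : X -> R) (f g u v : R -> X) (E : set R).

(* The integrated form of [(r o S)' = - q o S]: unlike membership in the graph of
   the adjoint, it gives information on all orbits without density of the domain
   of the generator. *)
Definition weak_adjoint r q := [/\ functional r, functional q &
  forall x Q, primitive Q (fun t => q (S t x)) ->
    forall t, 0 <= t -> r (S t x) - r x = Q 0 - Q t].

(** Moving the derivative onto [phi] turns (r u)' + q u = r f into the vanishing of the integral of
    this expression. *)
Definition weak_integrand r q (phi : R -> R) f u t :=
  r (u t) * phi^`()%classic t - q (u t) * phi t + r (f t) * phi t.

Definition weakly_solves f u := forall r q phi,
  weak_adjoint r q -> test_function tau phi ->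
  \int[mu]_(t in D) weak_integrand r q phi f u t = 0.

(** The variation of constants formula tested on functionals, together with the weak equation. Both
    are additive in (f, u), so it suffices to verify them on atoms. *)
Definition mild f u := [/\ continuous u, u 0 = 0,
  forall r, functional r -> mu.-integrable D (fun t => (r (f t))%:E),
  forall r t, functional r -> 0 <= t <= tau ->
    mu.-integrable `]0, t[ (fun s => (r (S (t - s) (f s)))%:E) /\
    r (u t) = \int[mu]_(s in `]0, t[) r (S (t - s) (f s)) &
  weakly_solves f u].

Lemma continuous_functional r u : functional r -> continuous u ->
  continuous (fun t => r (u t)).
Proof.
move=> hr cu t; apply: (@continuous_comp _ _ _ u r); first exact: cu.
exact: functional_continuous.
Qed.

Lemma bounded_itv (phi : R -> R) : continuous phi ->
  exists2 C : R, 0 <= C & forall t, 0 <= t <= tau -> `|phi t| <= C.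
Proof.
move=> cphi; have cn : {within `[0, tau], continuous (fun t => `|phi t|)}.
  apply: continuous_subspaceT => t; apply: continuous_comp (cphi t) _.
  exact: norm_continuous.
by have [c _ hc] := EVT_max (ltW tau0) cn; exists `|phi c|.
Qed.

Lemma itvoo_le (t : R) : D t -> 0 <= t <= tau.
Proof. by rewrite /= in_itv/= => /andP[? ?]; rewrite !ltW. Qed.

Lemma integrableM_continuous (g phi : R -> R) :
  mu.-integrable D (fun t => (g t)%:E) -> continuous phi ->
  mu.-integrable D (fun t => (g t * phi t)%:E).
Proof.
move=> ig cphi; have [C C0 phiC] := bounded_itv cphi.
have iC : mu.-integrable D (fun t => (C%:E * (g t)%:E)%E) by exact: integrableZl.
apply: le_integrable iC => //.
  apply/measurable_EFinP; apply: measurable_funM.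
    by apply/measurable_EFinP; exact: measurable_int ig.
  by apply: measurable_funS (continuous_measurable_fun cphi).
move=> t Dt; rewrite -EFinM /= lee_fin !normrM mulrC ler_wpM2r//.
by rewrite (ger0_norm C0) phiC// itvoo_le.
Qed.

Lemma integrable_weak_integrand r q phi f u : functional r -> functional q ->
  test_function tau phi -> continuous u ->
  mu.-integrable D (fun t => (r (f t))%:E) ->
  mu.-integrable D (fun t => (weak_integrand r q phi f u t)%:E).
Proof.
move=> hr hq [sphi _] cu irf.
have cphi := smooth_continuous sphi.
have cphi' := smooth_continuous (smooth_derive1 sphi).
have i1 : mu.-integrable D (fun t => (r (u t) * phi^`()%classic t - q (u t) * phi t)%:E).
  apply: integrable_continuous_oo => t; apply: cvgB; apply: cvgM.
  - exact: (continuous_functional hr cu).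
  - exact: cphi'.
  - exact: (continuous_functional hq cu).
  - exact: cphi.
exact: (integrableD _ i1 (integrableM_continuous irf cphi)).
Qed.

Lemma mild0 : mild (fun=> 0) (fun=> 0).
Proof.
split => //.
- by move=> t; exact: cvg_cst.
- move=> r hr /=; rewrite (functional0 hr); exact: integrable0.
- move=> r t hr _ /=; rewrite (functional0 hr).
  have E0 s : r (S (t - s) 0) = 0 by rewrite linear0 (functional0 hr).
  split; first by rewrite (_ : (fun s => _) = cst 0%E);
    [exact: integrable0|apply/funext => s; rewrite E0].
  transitivity (\int[mu]_(s in `]0, t[) cst 0 s).
    by rewrite /Rintegral integral0.
  by apply: eq_Rintegral => s _; rewrite E0.
- move=> r q phi [hr hq _] _; rewrite /weak_integrand (functional0 hr) (functional0 hq).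
  by rewrite /Rintegral integral0_eq// => t _; rewrite !mul0r subr0 addr0.
Qed.

Lemma mildD f g u v : mild f u -> mild g v ->
  mild (fun t => f t + g t) (fun t => u t + v t).
Proof.
move=> [cu u0 irf mf wf] [cv v0 irg mg wg]; split.
- by move=> t; apply: cvgD; [exact: cu|exact: cv].
- by rewrite u0 v0 addr0.
- move=> r hr; apply: (integrable_ext (G := fun t => r (f t) + r (g t))) => //.
    by move=> t _; rewrite (functionalD hr).
  exact: (integrableD _ (irf r hr) (irg r hr)).
- move=> r t hr tt; have [i1 e1] := mf r t hr tt; have [i2 e2] := mg r t hr tt.
  have E0 s : r (S (t - s) (f s + g s)) = r (S (t - s) (f s)) + r (S (t - s) (g s)).
    by rewrite linearD (functionalD hr).
  split; last first.
    rewrite (functionalD hr) e1 e2 -RintegralD//.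
    by apply: eq_Rintegral => s _; rewrite E0.
  apply: (integrable_ext _ (fun s _ => E0 s)) => //.
  exact: (integrableD _ i1 i2).
- move=> r q phi hrq tphi; have [hr hq _] := hrq.
  have E0 t : weak_integrand r q phi (fun t => f t + g t) (fun t => u t + v t) t =
      weak_integrand r q phi f u t + weak_integrand r q phi g v t.
    rewrite /weak_integrand !(functionalD hr) !(functionalD hq); ring.
  transitivity (\int[mu]_(t in D) (weak_integrand r q phi f u t +
      weak_integrand r q phi g v t)).
    by apply: eq_Rintegral => t _; rewrite E0.
  rewrite RintegralD//; first by rewrite wf// wg// addr0.
  + by apply: integrable_weak_integrand => //; exact: irf.
  + by apply: integrable_weak_integrand => //; exact: irg.
Qed.

(* The semigroup law makes [S (t - s) (f s)] independent of [s] in [E] for this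
   [f], so the variation of constants formula is explicit. *)
Lemma mild_atom E a x : measurable E -> E `<=` D -> 0 <= a ->
  E `<=` [set t | a <= t] ->
  mild (fun t => \1_E t *: S (t - a) x)
       (fun t => measure_below E t *: S (t - a) x).
Proof.
move=> mE ED a0 Ea.
have corb : continuous (fun t => S (t - a) x).
  move=> t; apply: (@continuous_comp _ _ _ (fun t => t - a) (fun t => S t x)).
    by apply: cvgB; [exact: cvg_id|exact: cvg_cst].
  exact: (@orbit_continuous _ _ _ hS x).
have iE : mu.-integrable D (fun t => (\1_E t : R)%:E).
  apply: (@integrable_bounded _ _ _ 1) => //; first exact: lebesgue_itvoo_fin.
  by move=> t _; rewrite indicE ger0_norm// lern1 leq_b1.
have irE r : functional r -> mu.-integrable D (fun t => (r (\1_E t *: S (t - a) x))%:E).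
  move=> hr; apply: (integrable_ext (G := fun t => \1_E t * r (S (t - a) x))) => //.
    by move=> t _; rewrite (functionalZ hr).
  exact/integrableM_continuous/continuous_functional.
split => //.
- move=> t; apply: cvgZ; first exact: (measure_below_continuous mE ED).
  exact: corb.
- by rewrite (measure_below_le0 ED)// scale0r.
- move=> r t hr /andP[t0 tt]; pose c := r (S (t - a) x).
  have E0 s : s \in `]0, t[%classic -> r (S (t - s) (\1_E s *: S (s - a) x)) = \1_E s * c.
    rewrite inE/= in_itv/= => /andP[s0 st].
    rewrite linearZ/= (functionalZ hr) indicE.
    case: (boolP (s \in E)) => [/set_mem sE|_]; last by rewrite !mul0r.
    rewrite !mul1r -(semigroup_funD hS) ?subr_ge0 ?(ltW st)//; last exact: Ea.
    by rewrite addrA subrK.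
  have it : mu.-integrable `]0, t[ (fun s => (\1_E s : R)%:E).
    apply: (@integrable_bounded _ _ _ 1) => //; first exact: lebesgue_itvoo_fin.
    by move=> s _; rewrite indicE ger0_norm// lern1 leq_b1.
  split.
    apply: (integrable_ext (G := fun s => \1_E s * c)) => //.
      by move=> s sD; rewrite E0// inE.
    exact: (integrableZr _ c it).
  rewrite [RHS](_ : _ = \int[mu]_(s in `]0, t[) (\1_E s * c)); last first.
    exact: eq_Rintegral.
  rewrite (functionalZ hr) RintegralZr//; congr (_ * _).
  rewrite Rintegral_itv_bndo_bndc// /Rintegral integral_indic//.
  congr (fine (mu _)); apply/seteqP; split=> [s [sE /= st]|s [sE /= st]]; split => //.
    by move: (ED _ sE); rewrite /= !in_itv/= in st * => /andP[->].
  by move: st; rewrite /= !in_itv/= => /andP[].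
- move=> r q phi [hr hq rq] tphi; have [sphi _] := tphi.
  have [Q hQ] := continuous_primitive
    (continuous_functional hq (@orbit_continuous _ _ _ hS x)).
  (* For t >= a this is r (S (t - a) x). Before a the formula may differ, because the semigroup is
     extended by the identity, but there both coefficients of the orbit vanish. *)
  pose p t := (r x + Q 0) - Q (t - a).
  pose kappa t := 0 - q (S (t - a) x).
  have pk : primitive p kappa.
    exact: primitiveB (primitive_cst _) (primitive_shift _ hQ).
  have pE t : a <= t -> r (S (t - a) x) = p t.
    by move=> at_; have := rq _ _ hQ (t - a);
      rewrite subr_ge0 => /(_ at_); rewrite /p; lra.
  have ck : continuous kappa.
    move=> t; apply: cvgB; first exact: cvg_cst.
    exact: (continuous_functional hq corb).
  have cphi := smooth_continuous sphi.
  have cphi' := smooth_continuous (smooth_derive1 sphi).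
  have cp := primitive_continuous pk.
  pose w t := p t * phi^`()%classic t + kappa t * phi t.
  have cw : continuous w.
    by move=> t; apply: cvgD; apply: cvgM;
      [exact: cp|exact: cphi'|exact: ck|exact: cphi].
  have JE t : t \in D -> weak_integrand r q phi (fun t => \1_E t *: S (t - a) x)
       (fun t => measure_below E t *: S (t - a) x) t =
       measure_below E t * w t + \1_E t * (p t * phi t).
    move=> tD; rewrite /weak_integrand !(functionalZ hr) (functionalZ hq).
    have [at_|ta] := leP a t.
      by rewrite pE// /w /kappa; ring.
    rewrite (measure_below_eq0 mE ED Ea) ?ltW// indicE memNset ?mul0r ?addr0 ?subr0//.
    by move=> /Ea /=; rewrite leNgt ta.
  have cpp : continuous (fun t => p t * phi t).
    by move=> t; apply: cvgM; [exact: cp|exact: cphi].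
  rewrite [LHS](_ : _ = \int[mu]_(t in D)
    (measure_below E t * w t + \1_E t * (p t * phi t))); last exact: eq_Rintegral.
  rewrite RintegralD//; last first.
    exact: integrableM_continuous.
    apply: integrable_continuous_oo => t; apply: cvgM; last exact: cw.
    exact: (measure_below_continuous mE ED).
  (* After Fubini the inner integral over []s, tau[] is - p s * phi s by parts, which cancels the
     source term. *)
  rewrite (Rintegral_below mE ED cw) -RintegralD//.
  + rewrite (_ : \int[mu]_(s in _) _ = \int[mu]_(s in D) (cst 0 s)); last first.
      apply: eq_Rintegral => s; rewrite inE/= in_itv/= => /andP[s0 st].
      rewrite (test_function_by_parts _ tphi pk ck) ?(ltW s0) ?(ltW st)//.
      by rewrite mulrN addNr.
    by rewrite /Rintegral integral0.
  + apply: (integrable_ext (G := fun s => \1_E s * - (p s * phi s))) => //.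
      move=> s; rewrite /= in_itv/= => /andP[s0 st].
      by rewrite (test_function_by_parts _ tphi pk ck) ?(ltW s0) ?(ltW st).
    by apply: integrableM_continuous => // t; apply: cvgN; exact: cpp.
  + exact: integrableM_continuous.
Qed.

End Mild.

Section Clamp.
Variable R : realType.

(** Precomposition with this retraction extends functions continuous on [0, tau] to continuous
    functions on R. *)
Definition clamp (tau t : R) : R := Num.min (Num.max t 0) tau.

Lemma clamp_itv (tau t : R) : 0 < tau -> 0 <= clamp tau t <= tau.
Proof.
by move=> tau0; rewrite /clamp le_min le_max lexx orbT ge_min lexx orbT (ltW tau0).
Qed.

Lemma clamp_id (tau t : R) : 0 <= t <= tau -> clamp tau t = t.
Proof. by move=> /andP[t0 tt]; rewrite /clamp (max_idPl t0) (min_idPl tt). Qed.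

Lemma clamp_continuous (tau : R) : continuous (clamp tau).
Proof.
have cmax : continuous (fun t : R => Num.max t 0).
  by move=> t; apply: (@continuous_max _ _ id (cst 0)); [exact: cvg_id|exact: cvg_cst].
move=> t; have : {for t, continuous ((fun t => Num.max t 0) \min cst tau)}.
  by apply: continuous_min; [exact: cmax|exact: cvg_cst].
by [].
Qed.

End Clamp.

(** * Limits of mild solutions in L^1 *)

Section MildApproximation.
Variables (R : realType) (X : completeNormedModType R).
Variables (S : R -> {linear X -> X}) (hS : semigroup S).
Variables (tau : R) (tau0 : 0 < tau).
Local Notation mu := (@lebesgue_measure R).
Local Notation D := (`]0, tau[%classic : set R).
Local Notation mild := (mild S tau).
Implicit Types (r q : X -> R) (f g u v : R -> X) (E : set R).

Lemma le_Rintegral_subset (A B : set R) (w : R -> R) : measurable A ->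
  measurable B -> A `<=` B -> (forall t, B t -> 0 <= w t) ->
  mu.-integrable B (fun t => (w t)%:E) ->
  \int[mu]_(t in A) w t <= \int[mu]_(t in B) w t.
Proof.
move=> mA mB AB w0 iw; rewrite /Rintegral fine_le//.
- apply: integrable_fin_num => //; exact: integrableS iw.
- exact: integrable_fin_num.
- apply: ge0_subset_integral => //; exact: measurable_int iw.
Qed.

(** A functional norming u t - v t turns the tested formula into a norm estimate. The majorant [w]
    stands in for the norm of f - g, whose measurability is left open. *)
Lemma mild_dist_le (M : R) f u g v (w : R -> R) : 0 <= M ->
  (forall t x, t <= tau -> `|S t x| <= M * `|x|) ->
  mild f u -> mild g v -> mu.-integrable D (fun t => (w t)%:E) ->
  (forall t, D t -> `|f t - g t| <= w t) ->
  forall t, 0 <= t <= tau -> `|u t - v t| <= M * \int[mu]_(s in D) w s.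
Proof.
move=> M0 hM [_ _ _ mf _] [_ _ _ mg _] iw fgw t t01.
have /andP[t0 tt] := t01.
have [r [rD rZ r1 <-]] := norming_functional (u t - v t).
have hr : functional r.
  by split => //; exists 1 => // x; rewrite mul1r.
have [i1 e1] := mf r t hr t01; have [i2 e2] := mg r t hr t01.
have subD : `]0, t[%classic `<=` D by apply: subset_itvl; rewrite bnd_simp.
have iwt : mu.-integrable `]0, t[ (fun s => (w s)%:E) by exact: integrableS iw.
rewrite (functionalB hr) e1 e2 -RintegralB//.
apply: (@le_trans _ _ (\int[mu]_(s in `]0, t[) (M * w s))).
  apply: le_Rintegral => //.
  - exact: (integrableB _ i1 i2).
  - exact: (integrableZl _ M iwt).
  - move=> s /= st; have sD := subD _ st; move: st; rewrite in_itv/= => /andP[s0 st].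
    rewrite -(functionalB hr) -linearB (le_trans (ler_norm _))// (le_trans (r1 _))//.
    rewrite (le_trans (hM _ _ _))//; first by lra.
    by rewrite ler_wpM2l// fgw.
rewrite RintegralZl// ler_wpM2l//; apply: le_Rintegral_subset => // s /fgw.
exact: le_trans.
Qed.

Definition approximable f := forall e : R, 0 < e -> exists g u, mild g u /\
  forall t, D t -> `|f t - g t| <= e.

(** By continuity at 0, S (t - n d) x stays within e of x on the slice [n d, (n + 1) d[, so the
    constant x on E is approximated by one atom per slice. *)
Lemma approximable_indic E x : measurable E -> E `<=` D ->
  approximable (fun t => \1_E t *: x).
Proof.
move=> mE ED e e0.
have /cvgrPdist_le/(_ _ e0)[d /= d0 hd] := @semigroup_cvg0 _ _ _ hS x.
have Sd t : 0 <= t -> t < d -> `|x - S t x| <= e.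
  by move=> t0 td; apply: hd; rewrite /= sub0r normrN ger0_norm.
(* The error is carried with the indicator: errors on disjoint slices then do not accumulate. *)
have key n : exists g u, mild g u /\ forall t,
    `|\1_(E `&` `]-oo, (n%:R * d)[) t *: x - g t| <= \1_(E `&` `]-oo, (n%:R * d)[) t * e.
  elim: n => [|n [g [u [gu hg]]]].
    exists (fun=> 0), (fun=> 0); split; first exact: mild0.
    move=> t; rewrite indicE memNset ?scale0r ?subr0 ?normr0 ?mul0r// => -[/ED].
    by rewrite /= !in_itv/= => /andP[t0 _]; rewrite ltNge ltW.
  pose F := E `&` `[n%:R * d, n.+1%:R * d[%classic.
  have mF : measurable F by exact: measurableI.
  have FD : F `<=` D by move=> t [/ED].
  have nd0 : 0 <= n%:R * d by rewrite mulr_ge0// ltW.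
  have Fa : F `<=` [set t | n%:R * d <= t].
    by move=> t [_ /=]; rewrite in_itv/= => /andP[].
  have mFx := mild_atom hS tau0 x mF FD nd0 Fa.
  exists (fun t => g t + \1_F t *: S (t - n%:R * d) x),
    (fun t => u t + measure_below F t *: S (t - n%:R * d) x); split.
    exact: (mildD tau0 gu mFx).
  move=> t.
  have -> : \1_(E `&` `]-oo, (n.+1%:R * d)[) t =
      \1_(E `&` `]-oo, (n%:R * d)[) t + \1_F t :> R.
    rewrite /F !indicI/= -mulrDr; congr (_ * _); rewrite !indicE !mem_setE !in_itv/=.
    have nn : n%:R * d < n.+1%:R * d by rewrite ltr_pM2r// ltr_nat.
    have [h|h] := ltP t (n%:R * d).
      by rewrite (lt_trans h nn) addr0.
    by rewrite add0r.
  rewrite scalerDl mulrDl opprD addrACA (le_trans (ler_normD _ _))// lerD//.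
  rewrite -scalerBr normrZ indicE; case: (boolP (t \in F)) => [/set_mem tF|_].
    rewrite normr1 !mul1r; apply: Sd; first by rewrite subr_ge0; exact: Fa.
    case: tF => _ /=; rewrite in_itv/= -natr1 => /andP[_]; lra.
  by rewrite normr0 !mul0r.
have [g [u [gu hg]]] := key (Num.truncn (tau / d)).+1.
have EE : E `&` `]-oo, ((Num.truncn (tau / d)).+1%:R * d)[ = E.
  apply/seteqP; split=> [t []//|t Et]; split => //=; rewrite in_itv/=.
  have := ED _ Et; rewrite /= in_itv/= => /andP[_ tt].
  rewrite (lt_le_trans tt)// -ler_pdivrMr//; exact/ltW/truncnS_gt.
exists g, u; split => // t _; have := hg t; rewrite EE => /le_trans; apply.
by rewrite indicE; case: (_ \in _); rewrite ?mul1r// mul0r ltW.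
Qed.

Lemma approximableD f g : approximable f -> approximable g ->
  approximable (fun t => f t + g t).
Proof.
move=> hf hg e e0; have e20 : 0 < e / 2 by rewrite divr_gt0.
have [f1 [u [fu Hf]]] := hf _ e20; have [g1 [v [gv Hg]]] := hg _ e20.
exists (fun t => f1 t + g1 t), (fun t => u t + v t); split; first exact: mildD.
move=> t Dt; rewrite opprD addrACA (le_trans (ler_normD _ _))//.
by rewrite [leRHS]splitr lerD// ?Hf// Hg.
Qed.

Lemma approximable_simple s : simple s -> approximable s.
Proof.
move=> [fs ms].
pose l := finmap.enum_fset (fset_set (range s)).
have ll : forall l' : seq X,
    approximable (fun t => \sum_(x <- l') \1_(D `&` s @^-1` [set x]) t *: x).
  elim=> [|x l' IH].
    move=> e e0; exists (fun=> 0), (fun=> 0); split; first exact: mild0.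
    by move=> t _; rewrite big_nil subr0 normr0 ltW.
  have ax : approximable (fun t => \1_(D `&` s @^-1` [set x]) t *: x).
    by apply: approximable_indic => //; exact: measurableI.
  move=> e e0; have [g [u [gu hg]]] := approximableD ax IH e0.
  by exists g, u; split => // t Dt; rewrite big_cons; exact: hg.
move=> e e0; have [g [u [gu hg]]] := ll l e e0.
exists g, u; split => // t Dt; have := hg t Dt; congr (`|_ - _| <= _).
have sl : s t \in l by rewrite /l in_fset_set// inE; exists t.
rewrite (bigD1_seq (s t))//=; last exact: finmap.fset_uniq.
rewrite indicE mem_set// scale1r big1 ?addr0// => x xs.
rewrite indicE memNset ?scale0r// => -[_ /= sx].
by rewrite sx eqxx in xs.
Qed.

Definition mild_L1_limit f u := forall e : R, 0 < e -> exists g v (w : R -> R),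
  [/\ mild g v, mu.-integrable D (fun t => (w t)%:E),
      forall t, D t -> `|f t - g t| <= w t, \int[mu]_(t in D) w t <= e &
      forall t, 0 <= t <= tau -> `|u t - v t| <= e].

Let inv_nat (e : R) : 0 < e -> exists n : nat, n.+1%:R^-1 <= e.
Proof.
move=> e0; exists (Num.truncn e^-1); rewrite -[leRHS]invrK lef_pV2 ?posrE ?invr_gt0//.
exact/ltW/truncnS_gt.
Qed.

(** By [mild_dist_le] the solutions for approximations of quality 1 / (n + 1) are uniformly Cauchy
    on [0, tau]; clamping the time makes the estimate uniform on R and the limit continuous
    there. *)
Lemma mild_L1_limit_exists f :
  (forall e : R, 0 < e -> exists g v (w : R -> R),
    [/\ mild g v, mu.-integrable D (fun t => (w t)%:E),
        forall t, D t -> `|f t - g t| <= w t & \int[mu]_(t in D) w t <= e]) ->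
  exists u, [/\ continuous u, u 0 = 0 & mild_L1_limit f u].
Proof.
move=> Hf; have [M M1 hM] := semigroup_bound hS tau.
have M0 : 0 <= M by lra.
have /choice[G HG] (n : nat) : exists p : (R -> X) * (R -> X) * (R -> R),
    [/\ mild p.1.1 p.1.2, mu.-integrable D (fun t => (p.2 t)%:E),
    forall t, D t -> `|f t - p.1.1 t| <= p.2 t & \int[mu]_(t in D) p.2 t <= n.+1%:R^-1].
  have [|g [v [w [h1 h2 h3 h4]]]] := Hf (n.+1%:R^-1); first by [].
  by exists (g, v, w).
pose cl : R -> R := clamp tau.
pose U n t := (G n).1.2 (cl t).
have UD n m t : `|U n t - U m t| <= M * (n.+1%:R^-1 + m.+1%:R^-1).
  have [g1 i1 w1 e1] := HG n; have [g2 i2 w2 e2] := HG m.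
  apply: (@le_trans _ _ (M * \int[mu]_(t in D) ((G n).2 t + (G m).2 t))).
    apply: (mild_dist_le M0 hM g1 g2) => //;
      [exact: (integrableD _ i1 i2)| |exact: clamp_itv].
    move=> s Ds; rewrite (le_trans (ler_distD (f s) _ _))// distrC.
    by rewrite lerD// ?w1// w2.
  by rewrite ler_wpM2l// RintegralD// lerD.
have Un n m t : (n <= m)%N -> `|U n t - U m t| <= M * 2 * n.+1%:R^-1.
  move=> nm; apply: le_trans (UD n m t) _; rewrite -mulrA ler_wpM2l//.
  rewrite mulr2n mulrDl mul1r lerD// lef_pV2 ?posrE// ler_nat.
  exact: nm.
have Ucvg t : cvgn (fun n => U n t).
  apply: cauchy_cvg; apply: cauchy_exP => e e0; rewrite /fmapE -ball_normE /ball_.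
  have e1 : 0 < e / (M * 2 + 1) by rewrite divr_gt0//; lra.
  have [n hn] := inv_nat e1.
  exists (U n t), n => // m /= nm.
  apply: le_lt_trans (Un n m t nm) _.
  move: hn; rewrite ler_pdivlMr; last by lra.
  have : 0 < n.+1%:R^-1 :> R by [].
  by move: (n.+1%:R^-1) => y; nra.
pose u t := lim (U n t @[n --> \oo]).
have uU n t : `|U n t - u t| <= M * 2 * n.+1%:R^-1.
  apply/ler_addgt0Pr => e e0.
  have /cvgrPdist_le/(_ _ e0)[m _ hm] := Ucvg t.
  have := hm (maxn n m) (leq_maxr n m); rewrite -/(u t) distrC => h.
  rewrite (le_trans (ler_distD (U (maxn n m) t) _ _))// lerD// ?h//.
  exact/Un/leq_maxl.
have small e : 0 < e -> exists n, M * 2 * n.+1%:R^-1 <= e /\ n.+1%:R^-1 <= e.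
  move=> e0; have e1 : 0 < e / (M * 2) by rewrite divr_gt0//; lra.
  have e2 : 0 < Num.min e (e / (M * 2)) by rewrite lt_min e0.
  have [n] := inv_nat e2; rewrite le_min => /andP[h1 h2]; exists n; split => //.
  by move: h2; rewrite ler_pdivlMr ?mulr_gt0//; [rewrite mulrC|lra].
exists u; split.
- move=> t; apply/cvgrPdist_le => e e0.
  have e3 : 0 < e / 3 by rewrite divr_gt0.
  have [n [hn _]] := small _ e3.
  have cU : continuous (U n).
    have [[cv _ _ _ _] _ _ _] := HG n.
    by move=> s; apply: (@continuous_comp _ _ _ cl); [exact: clamp_continuous|exact: cv].
  near=> s.
  have h1 : `|U n t - U n s| <= e / 3 by near: s; have /cvgrPdist_le/(_ _ e3) := cU t.
  have h2 := le_trans (uU n t) hn; have h3 := le_trans (uU n s) hn.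
  have h4 := ler_distD (U n t) (u t) (u s); rewrite [`|u t - U n t|]distrC in h4.
  have h5 := ler_distD (U n s) (U n t) (u s); lra.
- apply/eqP; rewrite -normr_le0; apply/ler_addgt0Pr => e e0; rewrite add0r.
  have [n [hn _]] := small _ e0.
  have [[_ v0 _ _ _] _ _ _] := HG n.
  have c0 : cl 0 = 0 by apply: clamp_id; rewrite lexx ltW.
  have := uU n 0; rewrite /U c0 v0 sub0r normrN => h.
  exact: le_trans h hn.
- move=> e e0; have [n [hn1 hn2]] := small _ e0.
  have [h1 h2 h3 h4] := HG n.
  exists (G n).1.1, (G n).1.2, (G n).2; split => //; first exact: le_trans h4 hn2.
  move=> t tt; have := uU n t; rewrite /U /cl clamp_id// distrC => h.
  exact: le_trans h hn1.
Unshelve. all: by end_near. Qed.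

Lemma mild_L1_limit_weakly_solves f u : continuous u ->
  (forall r, functional r -> mu.-integrable D (fun t => (r (f t))%:E)) ->
  mild_L1_limit f u -> weakly_solves S tau f u.
Proof.
move=> cu irf lim r q phi hrq tphi; have [hr hq _] := hrq.
have [sphi _] := tphi.
have [_ _ [C1 C10 rC]] := hr; have [_ _ [C2 C20 qC]] := hq.
have [C3 C30 phiC] := bounded_itv tau0 (smooth_continuous sphi).
have [C4 C40 phiC'] := bounded_itv tau0 (smooth_continuous (smooth_derive1 sphi)).
pose C := C1 * C4 + C2 * C3.
have C0 : 0 <= C by rewrite addr_ge0// mulr_ge0.
apply/eqP; rewrite -normr_le0; apply/ler_addgt0Pr => e e0; rewrite add0r.
(* The error in u integrates to at most C tau e / B and the error in f to C1 C3 e / B; the summand 1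
   makes B positive. *)
pose B := C * tau + C1 * C3 + 1.
have B0 : 0 < B.
  by rewrite ltr_wpDl// addr_ge0// mulr_ge0// ltW.
have [|g [v [w [mgv iw fgw we uv]]]] := lim (e / B); first by rewrite divr_gt0.
have [cv _ irg _ wgv] := mgv.
have i1 := integrable_weak_integrand tau0 hr hq tphi cu (irf r hr).
have i2 := integrable_weak_integrand tau0 hr hq tphi cv (irg r hr).
have -> : \int[mu]_(t in D) weak_integrand r q phi f u t = \int[mu]_(t in D)
    (weak_integrand r q phi f u t - weak_integrand r q phi g v t).
  by rewrite RintegralB// (wgv _ _ _ hrq tphi) subr0.
have Dfin : fine (mu D) = tau.
  by rewrite lebesgue_measure_itv/= lte_fin tau0/= oppr0 addr0.
have icst : mu.-integrable D (fun=> (C * (e / B))%:E).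
  apply: (@integrable_bounded _ _ (fun=> C * (e / B)) `|C * (e / B)|) => //.
  exact: lebesgue_itvoo_fin.
have icw : mu.-integrable D (fun t => (C1 * C3 * w t)%:E).
  exact: (integrableZl _ (C1 * C3) iw).
apply: le_trans (le_normr_Rintegral _ _) _ => //.
  exact: (integrableB _ i1 i2).
apply: (@le_trans _ _ (\int[mu]_(t in D) (C * (e / B) + C1 * C3 * w t))).
  apply: le_Rintegral => //.
  - exact: (integrable_abse (integrableB _ i1 i2)).
  - exact: (integrableD _ icst icw).
  - move=> t Dt.
    have tt : 0 <= t <= tau by move: Dt; rewrite /= in_itv/= => /andP[? ?]; rewrite !ltW.
    rewrite /weak_integrand.
    rewrite (_ : _ - _ = r (u t - v t) * phi^`()%classic t - q (u t - v t) * phi t +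
      r (f t - g t) * phi t); last by rewrite !(functionalB hr) (functionalB hq); ring.
    have uvt := uv t tt.
    have b1 : `|r (u t - v t)| <= C1 * (e / B).
      by rewrite (le_trans (rC _))// ler_wpM2l.
    have b2 : `|q (u t - v t)| <= C2 * (e / B).
      by rewrite (le_trans (qC _))// ler_wpM2l.
    have b3 : `|r (f t - g t)| <= C1 * w t.
      by rewrite (le_trans (rC _))// ler_wpM2l// fgw.
    rewrite (le_trans (ler_normD _ _))// lerD//.
      rewrite (le_trans (ler_normB _ _))// /C mulrDl lerD// normrM.
        rewrite mulrAC ler_pM// phiC'//.
      by rewrite mulrAC ler_pM// phiC.
    by rewrite normrM mulrAC ler_pM// phiC.
rewrite RintegralD// Rintegral_cst// Dfin RintegralZl//.
apply: (@le_trans _ _ (C * (e / B) * tau + C1 * C3 * (e / B))).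
  by rewrite lerD2l ler_wpM2l// mulr_ge0.
rewrite (_ : _ + _ = (B - 1) * (e / B)); last by rewrite /B; ring.
rewrite mulrBl mul1r mulrC divfK ?gt_eqF// lerBlDr lerDl.
by rewrite divr_ge0// ltW.
Qed.

(** Both sides are compared with the same approximating mild solution. For a constant f this
    identifies the limit with an integral over an orbit. *)
Lemma mild_L1_limit_convolution f u r t : functional r -> 0 <= t <= tau ->
  mu.-integrable `]0, t[ (fun s => (r (S (t - s) (f s)))%:E) ->
  mild_L1_limit f u ->
  r (u t) = \int[mu]_(s in `]0, t[) r (S (t - s) (f s)).
Proof.
move=> hr t01 irf lim; have [_ _ [C C0 rC]] := hr; have /andP[t0 tt] := t01.
have [M M1 hM] := semigroup_bound hS tau.
apply/eqP; rewrite -subr_eq0 -normr_le0; apply/ler_addgt0Pr => e e0; rewrite add0r.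
pose B := C + C * M + 1.
have B0 : 0 < B by rewrite ltr_wpDl// addr_ge0// mulr_ge0//; lra.
have [|g [v [w [[_ _ _ mg _] iw fgw we uv]]]] := lim (e / B).
  by rewrite divr_gt0.
have [irg eg] := mg r t hr t01.
have subD : `]0, t[%classic `<=` D by apply: subset_itvl; rewrite bnd_simp.
have iwt : mu.-integrable `]0, t[ (fun s => (w s)%:E) by exact: integrableS iw.
have icw : mu.-integrable `]0, t[ (fun s => (C * M * w s)%:E).
  exact: (integrableZl _ (C * M) iwt).
have h1 : `|r (u t) - r (v t)| <= C * (e / B).
  by rewrite -(functionalB hr) (le_trans (rC _))// ler_wpM2l// uv.
have h2 : `|r (v t) - \int[mu]_(s in `]0, t[) r (S (t - s) (f s))| <= C * M * (e / B).
  rewrite eg -RintegralB//.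
  apply: le_trans (le_normr_Rintegral _ _) _ => //.
    exact: (integrableB _ irg irf).
  apply: (@le_trans _ _ (\int[mu]_(s in `]0, t[) (C * M * w s))).
    apply: le_Rintegral => //.
    - exact: (integrable_abse (integrableB _ irg irf)).
    - move=> s st; have Ds := subD _ st; move: st; rewrite /= in_itv/= => /andP[s0 st].
      rewrite -(functionalB hr) -linearB (le_trans (rC _))// -mulrA ler_wpM2l//.
      rewrite (le_trans (hM _ _ _))//; first lra.
      by rewrite ler_wpM2l//; [lra|rewrite distrC fgw].
  rewrite RintegralZl// ler_wpM2l//; first by rewrite mulr_ge0//; lra.
  apply: le_trans we; apply: le_Rintegral_subset => // s /fgw; exact: le_trans.
rewrite (le_trans (ler_distD (r (v t)) _ _))//.
rewrite (le_trans (lerD h1 h2))//.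
rewrite (_ : _ + _ = (B - 1) * (e / B)); last by rewrite /B; ring.
rewrite mulrBl mul1r mulrC divfK ?gt_eqF// lerBlDr lerDl.
by rewrite divr_ge0// ltW.
Qed.

End MildApproximation.

Lemma primitive_uniq_on (R : realType) (F G f g : R -> R) (a b : R) : a <= b ->
  primitive F f -> primitive G g -> (forall t, a < t < b -> f t = g t) ->
  F b - F a = G b - G a.
Proof.
move=> ab Ff Gg fg.
have cFG : {within `[a, b], continuous (fun t => F t - G t)}.
  exact/continuous_subspaceT/(primitive_continuous (primitiveB Ff Gg)).
have := @is_derive0_cst _ _ a b ab cFG; suff H : forall x, a < x < b ->
    is_derive x (1 : R) (fun t => F t - G t) 0 by move=> /(_ H); lra.
move=> t tab; have := primitiveB Ff Gg t.
by rewrite fg// subrr.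
Qed.

Lemma primitive_mean_near (R : realType) (F f : R -> R) (a b c e : R) :
  primitive F f -> (forall x, `|x - a| <= `|b - a| -> `|f x - c| <= e) ->
  `|F b - F a - c * (b - a)| <= e * `|b - a|.
Proof.
move=> Ff fc.
have H := primitiveB Ff (primitiveZ c (fun t => is_derive_id t (1 : R))).
have Hc x y : x <= y -> (forall t, x <= t <= y -> `|f t - c| <= e) ->
    `|F y - F x - c * (y - x)| <= e * (y - x).
  move=> xy h; have /= := @primitive_mean _ _ _ x y e xy H.
  rewrite (_ : F y - c * y - (F x - c * x) = F y - F x - c * (y - x)); last by ring.
  by apply => t txy; rewrite mulr1; exact: h.
have [ab|ba] := leP a b.
  rewrite (ger0_norm (x := b - a)) ?subr_ge0//; apply: Hc => // t tab.
  by apply: fc; rewrite !ger0_norm; lra.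
rewrite -normrN (_ : - (F b - F a - c * (b - a)) = F a - F b - c * (a - b)); last by ring.
rewrite [`|b - a|]distrC (ger0_norm (x := a - b)); last by lra.
apply: Hc; first exact: ltW.
by move=> t tab; apply: fc; rewrite !ler0_norm; lra.
Qed.

(** * The generator and its adjoint *)

Section Generator.
Variables (R : realType) (X : completeNormedModType R).
Variables (S : R -> {linear X -> X}) (hS : semigroup S).
Local Notation mu := (@lebesgue_measure R).
Implicit Types (r q : X -> R) (x y z : X).

Lemma functional_separates z z' : (forall r, functional r -> r z = r z') -> z = z'.
Proof.
move=> h; have [r [rD rZ r1 rz]] := norming_functional (z - z').
have hr : functional r by split => //; exists 1 => // x; rewrite mul1r.
apply/eqP; rewrite -subr_eq0 -normr_eq0 -rz (functionalB hr) (h _ hr).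
by rewrite subrr.
Qed.

Lemma orbit_functional_continuous r x : functional r ->
  continuous (fun t => r (S t x)).
Proof.
by move=> hr; apply: continuous_functional => //; exact: (@orbit_continuous _ _ _ hS x).
Qed.

Let primitive_reflect (F f : R -> R) (a : R) : primitive F f ->
  primitive (fun t => - F (a - t)) (fun t => f (a - t)).
Proof.
move=> Ff t; rewrite -[f _]opprK; apply: is_deriveN.
have d : is_derive t (1 : R) (fun t => a - t) (- 1).
  by rewrite -[X in is_derive _ _ _ X]sub0r; apply: is_deriveB.
by have := @is_derive1_comp _ F (fun t => a - t) t _ _ (Ff (a - t)) d; rewrite mulrN1.
Qed.

(* [z] is the integral of the orbit of [x] over [0, h]: the value at time [h]
   of the mild solution with constant right-hand side [x]. *)
Lemma orbit_integral_exists h x : 0 <= h -> exists z, forall r G, functional r ->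
  primitive G (fun s => r (S s x)) -> r z = G h - G 0.
Proof.
rewrite le_eqVlt => /predU1P[<-|h0].
  by exists 0 => r G hr _; rewrite (functional0 hr) subrr.
have [|u [_ _ lim]] := @mild_L1_limit_exists R X S hS h h0 (fun=> x) _.
  move=> e e0; have eh : 0 < e / h by rewrite divr_gt0.
  have mD : measurable (`]0, h[%classic : set R) by [].
  have [g [v [gv hg]]] := approximable_indic hS h0 x mD (@subset_refl _ _) eh.
  exists g, v, (fun=> e / h); split => //.
  - apply: (@integrable_bounded _ _ (fun=> e / h) `|e / h|) => //.
    exact: lebesgue_itvoo_fin.
  - by move=> t Dt; have := hg t Dt; rewrite indicE mem_set// scale1r.
  - have Dfin : fine (mu `]0, h[) = h.
      by rewrite lebesgue_measure_itv/= lte_fin h0/= oppr0 addr0.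
    by rewrite Rintegral_cst// Dfin divfK ?gt_eqF.
exists (u h) => r G hr Gr.
have cr : continuous (fun s => r (S (h - s) x)).
  move=> s; apply: (@continuous_comp _ _ _ (fun s => h - s) (fun s => r (S s x))).
    by apply: cvgB; [exact: cvg_cst|exact: cvg_id].
  exact: orbit_functional_continuous.
rewrite (mild_L1_limit_convolution hS hr _ _ lim).
- rewrite (Rintegral_oo_primitive (ltW h0) cr (primitive_reflect h Gr)).
  by rewrite subrr subr0; lra.
- by rewrite lexx ltW.
- exact: integrable_continuous_oo.
Qed.

Definition real_generator x y := h^-1 *: (S h x - x) @[h --> 0^'+] --> y.

(** [Z b - Z a] plays the integral of the orbit over [a, b]; a norming functional reduces the
    estimate to the real mean value inequality. *)
Lemma orbit_integral_mean (Z : R -> X) x y (a b c : R) :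
  (forall h r G, 0 <= h -> functional r -> primitive G (fun s => r (S s x)) ->
    r (Z h) = G h - G 0) ->
  0 <= a -> a <= b -> (forall s, a <= s <= b -> `|S s x - y| <= c) ->
  `|Z b - Z a - (b - a) *: y| <= c * (b - a).
Proof.
move=> HZ a0 ab hc.
have [r [rD rZ r1 <-]] := norming_functional (Z b - Z a - (b - a) *: y).
have hr : functional r by split => //; exists 1 => // w; rewrite mul1r.
have [G Gr] := continuous_primitive (orbit_functional_continuous (x := x) hr).
rewrite !(functionalB hr) (functionalZ hr) !(HZ _ r G)//; last by lra.
rewrite (le_trans (ler_norm _))//.
have H := primitiveB Gr (primitiveZ (r y) (fun t => is_derive_id t (1 : R))).
have /= := @primitive_mean _ _ _ a b c ab H.
rewrite (_ : G b - r y * b - (G a - r y * a) =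
  G b - G 0 - (G a - G 0) - (b - a) * r y); last by ring.
apply=> s sab; rewrite mulr1 -(functionalB hr).
by apply: le_trans (r1 _) _; exact: hc.
Qed.

(** The averages of the orbit over [0, h] tend to x, and they lie in the domain: the generator sends
    the integral over [0, h] to S h x - x. *)
Lemma real_generator_dense x e : 0 < e -> exists z y,
  real_generator z y /\ `|x - z| <= e.
Proof.
move=> e0.
have /choice[Z HZ0] h : exists z, 0 <= h -> forall r G, functional r ->
    primitive G (fun s => r (S s x)) -> r z = G h - G 0.
  have [h0|h0] := leP 0 h; last by exists 0.
  by have [z hz] := orbit_integral_exists x h0; exists z.
have HZ h r G : 0 <= h -> functional r -> primitive G (fun s => r (S s x)) ->
    r (Z h) = G h - G 0 by move=> h0; exact: HZ0.
have Z0 : Z 0 = 0.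
  apply: functional_separates => r hr.
  have [G Gr] := continuous_primitive (orbit_functional_continuous (x := x) hr).
  by rewrite (HZ _ _ G)// subrr (functional0 hr).
(* The semigroup law shifts the orbit, so its integral over [0, h] becomes the one over
   [t, h + t]. *)
have SZ t h : 0 <= t -> 0 <= h -> S t (Z h) = Z (h + t) - Z t.
  move=> t0 h0; apply: functional_separates => r hr.
  have [G Gr] := continuous_primitive (orbit_functional_continuous (x := x) hr).
  have hrt := functional_comp_semigroup hS t hr.
  have [G' Gr'] := continuous_primitive (orbit_functional_continuous (x := x) hrt).
  rewrite (functionalB hr) !(HZ _ r G) ?addr_ge0//.
  rewrite (HZ _ _ G' h0 hrt Gr').
  have := primitive_uniq_on h0 Gr' (primitive_shift t Gr).
  rewrite add0r => ->; first by lra.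
  move=> s /andP[s0 _]; rewrite addrC (semigroup_funD hS)//; exact: ltW.
have near_orbit c d : 0 < d -> exists2 h, 0 < h &
    forall s, c - h <= s <= c + h -> `|S s x - S c x| <= d.
  move=> d0; have /cvgrPdist_le/(_ _ d0) := @orbit_continuous _ _ _ hS x c.
  move=> /nbhs_ballP[h /= h0 hh]; exists (h / 2); first by rewrite divr_gt0.
  move=> s sc; rewrite distrC; apply: hh; rewrite /ball/= ltr_norml; lra.
have [h h0 hh] := near_orbit 0 e e0.
exists (h^-1 *: Z h), (h^-1 *: (S h x - x)); split.
  suff H : real_generator (Z h) (S h x - x).
    rewrite /real_generator.
    have -> : (fun t => t^-1 *: (S t (h^-1 *: Z h) - h^-1 *: Z h)) =
        fun t => h^-1 *: (t^-1 *: (S t (Z h) - Z h)).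
      by apply/funext => t; rewrite linearZ/= -scalerBr !scalerA mulrC.
    by apply: cvgZr; exact: H.
  apply/cvgrPdist_le => d d0; have d20 : 0 < d / 2 by rewrite divr_gt0.
  have [h1 h10 hh1] := near_orbit h _ d20.
  have [h2 h20 hh2] := near_orbit 0 _ d20.
  near=> t.
  have t0 : 0 < t by near: t; exact: nbhs_right_gt.
  have th1 : t < h1 by near: t; exact: nbhs_right_lt.
  have th2 : t < h2 by near: t; exact: nbhs_right_lt.
  have b1 : `|Z (h + t) - Z h - t *: S h x| <= d / 2 * t.
    have := @orbit_integral_mean Z x (S h x) h (h + t) (d / 2) HZ (ltW h0).
    rewrite (_ : h + t - h = t); last by ring.
    apply; first by lra.
    by move=> s st; apply: hh1; lra.
  have b2 : `|Z t - t *: x| <= d / 2 * t.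
    have := @orbit_integral_mean Z x x 0 t (d / 2) HZ (lexx _) (ltW t0).
    rewrite Z0 !subr0; apply => s st.
    by have := hh2 s; rewrite (semigroup_fun0 hS x (lexx 0)); apply; lra.
  rewrite (SZ _ _ (ltW t0) (ltW h0)).
  rewrite (_ : _ - _ = - (t^-1 *: ((Z (h + t) - Z h - t *: S h x)
      - (Z t - t *: x)))); last first.
    have -> : Z (h + t) - Z h - t *: S h x - (Z t - t *: x) =
        Z (h + t) - Z t - Z h - t *: (S h x - x).
      by rewrite scalerBr !opprB [LHS](AC (3*2) (1*5*2*(4*3))).
    by rewrite [in RHS]scalerBr scalerA mulVf ?gt_eqF// scale1r opprB.
  rewrite normrN normrZ (@gtr0_norm _ t^-1) ?invr_gt0// ler_pdivrMl// mulrC.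
  rewrite (le_trans (ler_normB _ _))//; lra.
have := @orbit_integral_mean Z x x 0 h e HZ (lexx _) (ltW h0).
rewrite Z0 !subr0 => H.
have -> : x - h^-1 *: Z h = - (h^-1 *: (Z h - h *: x)).
  by rewrite scalerBr scalerA mulVf ?gt_eqF// scale1r opprB.
rewrite normrN normrZ gtr0_norm ?invr_gt0// ler_pdivrMl// mulrC.
apply: H => s sh; have := hh s; rewrite (semigroup_fun0 hS x (lexx 0)); apply; lra.
Unshelve. all: by end_near. Qed.

Lemma real_generator_semigroup (t : R) x y : 0 <= t -> real_generator x y ->
  real_generator (S t x) (S t y).
Proof.
move=> t0 xy; have [cS _ _ _] := hS.
apply: cvg_trans (_ : S t (h^-1 *: (S h x - x)) @[h --> 0^'+] --> S t y); last first.
  by apply: (cvg_comp _ (S t) xy); exact: cS.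
apply: near_eq_cvg; near=> h.
have h0 : 0 <= h by near: h; exact: nbhs_right_ge.
rewrite linearZ/= linearB; congr (_ *: (_ - _)).
by rewrite -!(semigroup_funD hS)// addrC.
Unshelve. all: by end_near. Qed.

(** The generator is a right derivative at 0. For s > t the operator S t factors out; for s < t the
    factor is S s, which costs the additional term S t y - S s y and the uniform bound M. *)
Lemma orbit_derive r x y (t : R) : functional r -> real_generator x y -> 0 < t ->
  is_derive t (1 : R) (fun s => r (S s x)) (r (S t y)).
Proof.
move=> hr xy t0; have [_ _ [C C0 rC]] := hr.
have [M M1 hM] := semigroup_bound hS t.
apply: is_derive_eps => e e0.
(* C M comes from the difference quotient at 0 and C from moving y along its orbit. *)
pose d := e / (C * M + C + 1).
have CM : 0 < C * M + C + 1 by rewrite ltr_wpDl// addr_ge0// mulr_ge0//; lra.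
have d0 : 0 < d by rewrite divr_gt0.
have [h1 h10 hh1] : exists2 h1, 0 < h1 &
    forall h, 0 < h -> h < h1 -> `|S h x - x - h *: y| <= d * h.
  have /cvgrPdist_le/(_ _ d0) := xy; rewrite near_withinE => /nbhs_ballP[h1 /= h10 hh].
  exists h1 => // h h0 hh1; have := hh h; rewrite /ball/= sub0r normrN gtr0_norm//.
  move=> /(_ hh1 h0) H.
  have -> : S h x - x - h *: y = - (h *: (y - h^-1 *: (S h x - x))).
    by rewrite scalerBr scalerA divff ?gt_eqF// scale1r opprB.
  by rewrite normrN normrZ gtr0_norm// mulrC ler_wpM2r// ltW.
have [h2 h20 hh2] : exists2 h2, 0 < h2 &
    forall s, `|t - s| < h2 -> `|S t y - S s y| <= d.
  have /cvgrPdist_le/(_ _ d0) := @orbit_continuous _ _ _ hS y t.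
  by move=> /nbhs_ballP[h2 /= h20 hh]; exists h2.
near=> s.
have s0 : 0 < s by near: s; exact: lt_nbhsr.
have st1 : `|t - s| < h1 by near: s; exact: cvgr_dist_lt.
have st2 : `|t - s| < h2 by near: s; exact: cvgr_dist_lt.
have dE : e = d * (C * M + C + 1) by rewrite /d divfK ?gt_eqF.
rewrite -(functionalB hr).
have [st|ts|->] := ltrgtP s t; last by
  rewrite !subrr mulr0 (functional0 hr) subr0 normr0 mulr0.
- rewrite -normrN (_ : - (r (S s x - S t x) - r (S t y) * (s - t)) =
      r (S s (S (t - s) x - x - (t - s) *: y))
      - (t - s) * r (S t y - S s y)); last first.
    have -> : S s (S (t - s) x - x - (t - s) *: y) = S t x - S s x - (t - s) *: S s y.
      rewrite 2!linearB linearZ/= -(semigroup_funD hS) ?(ltW s0) ?subr_ge0 ?(ltW st)//.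
      by rewrite (_ : s + (t - s) = t)//; ring.
    by rewrite !(functionalB hr) (functionalZ hr); ring.
  have ts0 : 0 < t - s by lra.
  have b1 : `|r (S s (S (t - s) x - x - (t - s) *: y))| <= C * (M * (d * (t - s))).
    rewrite (le_trans (rC _))// ler_wpM2l// (le_trans (hM _ _ (ltW st)))//.
    rewrite ler_wpM2l//; first lra.
    by apply: hh1 => //; move: st1; rewrite gtr0_norm.
  have b2 : `|(t - s) * r (S t y - S s y)| <= (t - s) * (C * d).
    rewrite normrM gtr0_norm// ler_wpM2l ?(ltW ts0)// (le_trans (rC _))// ler_wpM2l//.
    exact: hh2.
  rewrite (le_trans (ler_normB _ _))// (le_trans (lerD b1 b2))// dE.
  rewrite -subr_ge0 (_ : _ - _ = d * (t - s)); last by ring.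
  by rewrite mulr_ge0// ltW.
- have st0 : 0 < s - t by lra.
  rewrite (_ : r (S s x - S t x) - r (S t y) * (s - t) =
      r (S t (S (s - t) x - x - (s - t) *: y))); last first.
    have -> : S t (S (s - t) x - x - (s - t) *: y) = S s x - S t x - (s - t) *: S t y.
      rewrite 2!linearB linearZ/= -(semigroup_funD hS) ?(ltW t0) ?(ltW st0)//.
      by rewrite (_ : t + (s - t) = s)//; ring.
    by rewrite !(functionalB hr) (functionalZ hr); ring.
  rewrite (le_trans (rC _))//.
  apply: (@le_trans _ _ (C * (M * (d * (s - t))))).
    rewrite ler_wpM2l// (le_trans (hM _ _ (lexx t)))// ler_wpM2l//; first lra.
    by apply: hh1 => //; move: st1; rewrite distrC gtr0_norm.
  rewrite dE -subr_ge0 (_ : _ - _ = (C + 1) * (d * (s - t))); last by ring.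
  by apply: mulr_ge0; [lra|rewrite mulr_ge0// ltW].
Unshelve. all: by end_near. Qed.

Lemma orbit_FTC r x y G (t : R) : functional r -> real_generator x y ->
  primitive G (fun s => r (S s y)) -> 0 <= t -> r (S t x) - r x = G t - G 0.
Proof.
move=> hr xy Gr t0.
have cF : {within `[0, t], continuous (fun s => r (S s x) - G s)}.
  apply: continuous_subspaceT => s; apply: cvgB.
    exact: (orbit_functional_continuous (x := x) hr).
  exact: (primitive_continuous Gr).
have := is_derive0_cst t0 cF.
suff H : forall s, 0 < s < t -> is_derive s (1 : R) (fun s => r (S s x) - G s) 0.
  by move=> /(_ H); rewrite (semigroup_fun0 hS x (lexx 0)); lra.
move=> s /andP[s0 _]; rewrite -(subrr (r (S s y))).
by apply: is_deriveB; [exact: orbit_derive|exact: Gr].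
Qed.

(** [real_generator] plays the part of - A, whence the sign. *)
Definition real_adjoint r q :=
  [/\ functional r, functional q & forall x y, real_generator x y -> q x = - r y].

(** On the domain of the generator this is [orbit_FTC]. Both sides depend on x in a bounded linear
    way, so density of the domain extends it to all x. *)
Lemma real_adjoint_weak r q : real_adjoint r q -> weak_adjoint S r q.
Proof.
move=> [hr hq rq]; split => // x Q Qx t t0.
have [_ _ [C1 C10 rC]] := hr; have [_ _ [C2 C20 qC]] := hq.
have [M M1 hM] := semigroup_bound hS t.
pose B := C1 * M + C1 + C2 * M * t.
have B0 : 0 <= B by rewrite !addr_ge0// !mulr_ge0//; lra.
apply/eqP; rewrite -subr_eq0 -normr_le0; apply/ler_addgt0Pr => e e0; rewrite add0r.
have eB : 0 < e / (B + 1) by rewrite divr_gt0//; lra.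
have [z [y [zy xz]]] := real_generator_dense x eB.
have [P Pz] := continuous_primitive (orbit_functional_continuous (x := z) hq).
have [G Gy] := continuous_primitive (orbit_functional_continuous (x := y) hr).
have E1 := orbit_FTC hr zy Gy t0.
have E2 : P t - P 0 = - (G t - G 0).
  rewrite (primitive_uniq_on t0 Pz (primitiveZ (-1) Gy)); first by ring.
  move=> s /andP[s0 _]; rewrite mulN1r; apply: rq.
  exact: real_generator_semigroup (ltW s0) zy.
have b1 : `|r (S t (x - z))| <= C1 * (M * `|x - z|).
  by rewrite (le_trans (rC _))// ler_wpM2l// hM.
have b2 : `|r (x - z)| <= C1 * `|x - z| by exact: rC.
have b3 : `|(Q t - P t) - (Q 0 - P 0)| <= C2 * (M * `|x - z|) * (t - 0).
  apply: (primitive_mean t0 (primitiveB Qx Pz)) => s /andP[s0 st].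
  rewrite -(functionalB hq) -linearB (le_trans (qC _))// ler_wpM2l// hM//.
have -> : r (S t x) - r x - (Q 0 - Q t) =
    r (S t (x - z)) - r (x - z) + ((Q t - P t) - (Q 0 - P 0)).
  by rewrite (linearB (S t)) !(functionalB hr); lra.
rewrite (le_trans (ler_normD _ _))//.
rewrite (le_trans (lerD (le_trans (ler_normB _ _) (lerD b1 b2)) b3))//.
rewrite (_ : _ + _ = B * `|x - z|); last by rewrite /B; ring.
rewrite (le_trans (ler_wpM2l B0 xz))// mulrA ler_pdivrMr; last by lra.
by rewrite mulrC ler_wpM2l ?ltW//; lra.
Qed.

(* For every functional [xi] and [h >= 0], the functional
   [x |-> \int_0^h xi (S s x) ds] is in the domain of the adjoint. *)
Lemma real_adjoint_separates z :
  (forall r q, real_adjoint r q -> r z = 0) -> z = 0.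
Proof.
move=> Hz; apply: functional_separates => xi hxi; rewrite (functional0 hxi).
have [_ _ [C C0 xiC]] := hxi.
have cxi x := orbit_functional_continuous (x := x) hxi.
have [Gz Gzxi] := continuous_primitive (cxi z).
(* Once the integrals of xi along the orbit of z vanish for all h, so does the integrand at time 0,
   which is xi z. *)
have Gz0 h : 0 <= h -> Gz h - Gz 0 = 0.
  move=> h0; have [M M1 hM] := semigroup_bound hS h.
  pose r x := \int[mu]_(s in `[0, h]) xi (S s x).
  have rE x G : primitive G (fun s => xi (S s x)) -> r x = G h - G 0.
    exact: Rintegral_cc_primitive.
  have ixi x : mu.-integrable `[0, h] (EFin \o (fun s => xi (S s x))).
    exact: integrable_continuous.
  (* On the graph of the generator [orbit_FTC] gives r y = xi (S h x) - xi x, which dictates the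
     second functional. *)
  rewrite -(rE _ _ Gzxi); apply: (Hz r (fun x => xi x - xi (S h x))); split.
  - split.
    + move=> x y; rewrite /r -RintegralD//; apply: eq_Rintegral => s _.
      by rewrite linearD (functionalD hxi).
    + move=> a x; rewrite /r -RintegralZl//; apply: eq_Rintegral => s _.
      by rewrite linearZ/= (functionalZ hxi).
    + exists (C * M * h); first by rewrite !mulr_ge0//; lra.
      move=> x; have [G Gx] := continuous_primitive (cxi x).
      rewrite (rE _ _ Gx) mulrAC -[X in _ * X]subr0.
      apply: (primitive_mean h0 Gx) => s /andP[_ sh].
      by rewrite (le_trans (xiC _))// -mulrA ler_wpM2l// hM.
  - have hh := functional_comp_semigroup hS h hxi.
    split.
    + by move=> x y; rewrite linearD !(functionalD hxi); ring.
    + by move=> a x; rewrite linearZ/= !(functionalZ hxi); ring.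
    + have [_ _ [C' C'0 hC']] := hh; exists (C + C'); first by rewrite addr_ge0.
      move=> x; rewrite (le_trans (ler_normB _ _))// mulrDl lerD//.
  - move=> x y xy; have [G Gy] := continuous_primitive (cxi y).
    by rewrite (rE _ _ Gy) -(orbit_FTC hxi xy Gy h0); ring.
apply/eqP; rewrite -normr_le0; apply/ler_addgt0Pr => e e0; rewrite add0r.
have /cvgrPdist_le/(_ _ e0) := cxi z 0; rewrite (semigroup_fun0 hS z (lexx 0)).
move=> /nbhs_ballP[d /= d0 hd].
have d20 : 0 < d / 2 by rewrite divr_gt0.
have := @primitive_mean_near _ Gz _ 0 (d / 2) (xi z) e Gzxi.
rewrite (Gz0 _ (ltW d20)) sub0r normrN !subr0 (gtr0_norm d20)
  (normrM (xi z)) (gtr0_norm d20) ler_pM2r//.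
apply=> s; rewrite subr0 => sd; rewrite distrC; apply: hd.
by rewrite /ball/= sub0r normrN; lra.
Qed.

End Generator.

(** * Weak solutions in a real Banach space *)

Lemma lebesgue_ae2 (R : realType) (P Q U : R -> Prop) :
  (forall t, P t -> Q t -> U t) ->
  {ae @lebesgue_measure R, forall t, P t} ->
  {ae @lebesgue_measure R, forall t, Q t} ->
  {ae @lebesgue_measure R, forall t, U t}.
Proof.
move=> PQU hP hQ; apply: negligibleS (negligibleU hP hQ) => t /= nU.
by apply: contrapT => /not_orP[/contrapT Pt /contrapT Qt]; exact/nU/PQU.
Qed.

Lemma lebesgue_ae (R : realType) (P U : R -> Prop) : (forall t, P t -> U t) ->
  {ae @lebesgue_measure R, forall t, P t} ->
  {ae @lebesgue_measure R, forall t, U t}.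
Proof. by move=> PU hP; apply: (lebesgue_ae2 _ hP (hP)) => t /PU. Qed.

Section RealWeak.
Variables (R : realType) (X : completeNormedModType R).
Variables (S : R -> {linear X -> X}) (hS : semigroup S).
Variables (tau : R) (tau0 : 0 < tau).
Local Notation mu := (@lebesgue_measure R).
Local Notation D := (`]0, tau[%classic : set R).
Implicit Types (r q : X -> R) (f u v : R -> X) (g h : R -> R).

Lemma W11_eq g1 g2 h : (forall t, 0 <= t <= tau -> g1 t = g2 t) ->
  W11_derivative_real tau g1 h -> W11_derivative_real tau g2 h.
Proof.
move=> g12 [i1 i2 w]; split => //.
  by apply: (integrable_ext (G := g1)) => // t /itvoo_le /g12.
move=> phi tphi; rewrite -w//; apply: eq_Rintegral => t; rewrite inE => /itvoo_le tt.
by rewrite g12.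
Qed.

Lemma W11_addZ (a : R) g1 h1 g2 h2 : W11_derivative_real tau g1 h1 ->
  W11_derivative_real tau g2 h2 ->
  W11_derivative_real tau (fun t => g1 t + a * g2 t) (fun t => h1 t + a * h2 t).
Proof.
move=> [ig1 ih1 w1] [ig2 ih2 w2].
have iaZ (w : R -> R) : mu.-integrable D (fun t => (w t)%:E) ->
    mu.-integrable D (fun t => (a * w t)%:E).
  by move=> iw; exact: (integrableZl _ a iw).
split.
- exact: (integrableD _ ig1 (iaZ _ ig2)).
- exact: (integrableD _ ih1 (iaZ _ ih2)).
move=> phi tphi; have [sphi _] := tphi.
have cphi := smooth_continuous sphi.
have cphi' := smooth_continuous (smooth_derive1 sphi).
have split_int (v1 v2 psi : R -> R) : continuous psi ->
    mu.-integrable D (fun t => (v1 t)%:E) -> mu.-integrable D (fun t => (v2 t)%:E) ->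
    \int[mu]_(t in D) ((v1 t + a * v2 t) * psi t) =
    \int[mu]_(t in D) (v1 t * psi t) + a * \int[mu]_(t in D) (v2 t * psi t).
  move=> cpsi iv1 iv2; rewrite -RintegralZl//; last exact: integrableM_continuous.
  rewrite -RintegralD//.
  - by apply: eq_Rintegral => t _; ring.
  - exact: integrableM_continuous.
  - exact/iaZ/integrableM_continuous.
by rewrite !split_int// w1// w2//; ring.
Qed.

Lemma W11_0 : W11_derivative_real tau (fun=> 0) (fun=> 0).
Proof.
split; [exact: integrable0|exact: integrable0|].
move=> phi _; rewrite /Rintegral !integral0_eq ?oppr0// => t _; by rewrite mul0r.
Qed.

Lemma W11_primitive K k : primitive K k -> continuous k ->
  W11_derivative_real tau K k.
Proof.
move=> Kk ck; have cK := primitive_continuous Kk.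
split; [exact: integrable_continuous_oo|exact: integrable_continuous_oo|].
move=> phi tphi; have [sphi _] := tphi.
have cphi := smooth_continuous sphi.
have cphi' := smooth_continuous (smooth_derive1 sphi).
have tau00 : 0 <= (0 : R) <= tau by rewrite lexx ltW.
have := test_function_by_parts tau00 tphi Kk ck.
rewrite (test_function0 tphi) ?ltxx// mulr0 oppr0.
rewrite RintegralD//; first by lra.
- by apply: integrable_continuous_oo => t; apply: cvgM; [exact: cK|exact: cphi'].
- by apply: integrable_continuous_oo => t; apply: cvgM; [exact: ck|exact: cphi].
Qed.

Definition real_weak f u := forall r q, real_adjoint S r q ->
  exists2 h, W11_derivative_real tau (fun t => r (u t)) h &
    {ae mu, forall t, D t -> h t + q (u t) = r (f t)}.

Lemma real_weak_eq f u v : (forall t, 0 <= t <= tau -> u t = v t) ->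
  real_weak f u -> real_weak f v.
Proof.
move=> uv wu r q hrq; have [h Wh hae] := wu r q hrq; exists h.
  by apply: W11_eq Wh => t /uv ->.
by apply: lebesgue_ae hae => t + Dt; rewrite -uv ?itvoo_le//; exact.
Qed.

Lemma real_weak_addZ (a : R) f1 u1 f2 u2 : real_weak f1 u1 -> real_weak f2 u2 ->
  real_weak (fun t => f1 t + a *: f2 t) (fun t => u1 t + a *: u2 t).
Proof.
move=> w1 w2 r q hrq; have [hr hq _] := hrq.
have [h1 W1 ae1] := w1 r q hrq; have [h2 W2 ae2] := w2 r q hrq.
exists (fun t => h1 t + a * h2 t).
  apply: W11_eq (W11_addZ a W1 W2) => t _.
  by rewrite (functionalD hr) (functionalZ hr).
apply: lebesgue_ae2 ae1 ae2 => t e1 e2 Dt.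
rewrite !(functionalD hr) !(functionalD hq) !(functionalZ hr) !(functionalZ hq).
by rewrite -e1// -e2//; ring.
Qed.

(** Serves twice: y = 0 carries initial values, and general y provides a source with an explicit
    final value. *)
Lemma real_weak_orbit x y :
  real_weak (fun t => S t y) (fun t => S t x + t *: S t y).
Proof.
move=> r q hrq; have [hr hq rq] := hrq; have [_ _ waE] := real_adjoint_weak hS hrq.
have prim z : exists2 p, primitive p (fun t => - q (S t z)) &
    forall t, 0 <= t -> r (S t z) = p t.
  have [Q Qz] := continuous_primitive (orbit_functional_continuous hS (x := z) hq).
  exists (fun t => r z + Q 0 - Q t).
    by move=> t; rewrite -[- _]sub0r; exact: primitiveB (primitive_cst _) Qz t.
  by move=> t t0; have := waE z Q Qz t t0; lra.
have [p pk pE] := prim x; have [p' pk' pE'] := prim y.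
have cq z : continuous (fun t => - q (S t z)).
  by move=> t; apply: cvgN; exact: (orbit_functional_continuous hS (x := z) hq).
exists (fun t => - q (S t x) + (t * - q (S t y) + 1 * p' t)).
  have H := primitiveD pk (primitiveM (fun t => is_derive_id t (1 : R)) pk').
  apply: (@W11_eq (fun t => p t + t * p' t)).
    by move=> t /andP[t0 _]; rewrite (functionalD hr) (functionalZ hr) pE// pE'.
  apply: W11_primitive => //.
  move=> t; apply: cvgD; first exact: cq.
  apply: cvgD; apply: cvgM; [exact: cvg_id|exact: cq|exact: cvg_cst|].
  exact: (primitive_continuous pk').
apply: aeW => t /itvoo_le /andP[t0 _].
by rewrite (functionalD hq) (functionalZ hq) pE'//; ring.
Qed.

(* [s |-> r (S (t0 - s) (u s))] has derivative 0 for [r] in the domain of the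
   adjoint. *)
Lemma real_weak_unique u : continuous u -> u 0 = 0 -> real_weak (fun=> 0) u ->
  forall t, 0 <= t <= tau -> u t = 0.
Proof.
move=> cu u0 wu t0 t01; have /andP[t00 t0t] := t01.
(* By du Bois-Reymond, r o u is a genuine primitive of - q o u, not only a weak one. *)
have rint r q K : real_adjoint S r q -> primitive K (fun t => - q (u t)) ->
    forall t, 0 <= t <= tau -> r (u t) = K t - K 0.
  move=> hrq Kq t tt; have [hr hq _] := hrq.
  have [h [_ ih Wh] hae] := wu r q hrq.
  have cru := continuous_functional hr cu.
  have cqu : continuous (fun t => - q (u t)).
    by move=> s; apply: cvgN; exact: (continuous_functional hq cu).
  have := du_bois_reymond tau0 cru cqu Kq.
  rewrite u0 (functional0 hr); move=> /(_ _ t tt); rewrite subr0; apply.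
  move=> phi tphi; rewrite Wh//; congr (- _).
  have [sphi _] := tphi; have cphi := smooth_continuous sphi.
  have ihphi := integrableM_continuous tau0 ih cphi.
  have iqphi : mu.-integrable D (fun t => (- q (u t) * phi t)%:E).
    by apply: integrable_continuous_oo => s; apply: cvgM; [exact: cqu|exact: cphi].
  rewrite /Rintegral; congr fine; apply: ae_eq_integral => //.
  - exact: measurable_int ihphi.
  - exact: measurable_int iqphi.
  apply: lebesgue_ae hae => s hs Ds; congr (_%:E).
  by have := hs Ds; rewrite (functional0 hr) => e; congr (_ * _); lra.
apply: (real_adjoint_separates hS) => r q hrq; have [hr hq rq] := hrq.
have [M M1 hM] := semigroup_bound hS (t0 + 1).
(* The bound M, valid for times up to [t0 + 1], turns the separate continuity of u and of the orbits
   into joint continuity. *)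
have near_joint s : 0 <= s <= t0 -> forall d, 0 < d ->
    \forall s' \near s,
      (forall sigma, `|sigma - s| <= `|s' - s| ->
         `|S (t0 - s') (u sigma) - S (t0 - s) (u s)| <= d) /\
      (forall rho, `|rho - (t0 - s)| <= `|s' - s| ->
         `|S rho (u s) - S (t0 - s) (u s)| <= d).
  move=> /andP[s0 st] d d0.
  have d1 : 0 < d / (2 * M) by rewrite divr_gt0//; lra.
  have d2 : 0 < d / 2 by rewrite divr_gt0.
  have /cvgrPdist_le/(_ _ d1)/nbhs_ballP[e1 /= e10 he1] := cu s.
  have /cvgrPdist_le/(_ _ d2)/nbhs_ballP[e2 /= e20 he2] :=
    @orbit_continuous _ _ _ hS (u s) (t0 - s).
  near=> s'.
  have h1 : `|s - s'| < e1 by near: s'; exact: cvgr_dist_lt.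
  have h2 : `|s - s'| < e2 by near: s'; exact: cvgr_dist_lt.
  have h3 : `|s - s'| < 1 by near: s'; exact: cvgr_dist_lt.
  have Srho rho : `|rho - (t0 - s)| <= `|s' - s| ->
      `|S rho (u s) - S (t0 - s) (u s)| <= d / 2.
    move=> hrho; rewrite distrC; apply: he2; rewrite /ball/= distrC.
    by rewrite (le_lt_trans hrho)// distrC.
  split; last by move=> rho /Srho; lra.
  move=> sigma hsig.
  rewrite (le_trans (ler_distD (S (t0 - s') (u s)) _ _))// [leRHS]splitr lerD//.
    rewrite -linearB (le_trans (hM _ _ _))//.
      by move: h3; rewrite ltr_norml; lra.
    have M0 : 0 < M by lra.
    have : `|u sigma - u s| <= d / (2 * M).
      rewrite distrC; apply: he1; rewrite /ball/= distrC.
      by rewrite (le_lt_trans hsig)// distrC.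
    rewrite invfM mulrA ler_pdivlMr// mulrC; exact.
  apply: Srho; rewrite (_ : t0 - s' - (t0 - s) = s - s'); last by ring.
  by rewrite distrC.
pose F s := r (S (t0 - s) (u s)).
have [_ _ [C1 C10 rC]] := hr; have [_ _ [C2 C20 qC]] := hq.
have dF s : 0 < s < t0 -> is_derive s (1 : R) F 0.
  move=> /andP[s0 st]; apply: is_derive_eps => e e0.
  pose d := e / (2 * (C2 + 1)).
  have d0 : 0 < d by rewrite divr_gt0//; lra.
  have st0 : 0 <= s <= t0 by rewrite !ltW.
  near=> s'.
  have s'0 : 0 < s' by near: s'; exact: lt_nbhsr.
  have s't : s' < t0 by near: s'; exact: lt_nbhsl.
  have [hsig hrho] : (forall sigma, `|sigma - s| <= `|s' - s| ->
         `|S (t0 - s') (u sigma) - S (t0 - s) (u s)| <= d) /\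
      (forall rho, `|rho - (t0 - s)| <= `|s' - s| ->
         `|S rho (u s) - S (t0 - s) (u s)| <= d).
    by near: s'; exact: near_joint.
  (* To first order, moving s inside u changes F at rate - c, and moving s inside the semigroup at
     rate c. *)
  pose c := q (S (t0 - s) (u s)).
  (* [rint] is applied to r o S (t0 - s'), which remains in the domain of the adjoint because the
     semigroup preserves the graph of the generator. *)
  have hrq' : real_adjoint S (fun x => r (S (t0 - s') x)) (fun x => q (S (t0 - s') x)).
    split; [exact: (functional_comp_semigroup hS (t0 - s') hr)
      |exact: (functional_comp_semigroup hS (t0 - s') hq)|].
    move=> x y xy; apply: rq; apply: (real_generator_semigroup hS) => //.
    by rewrite subr_ge0 ltW.
  have [hr' hq' _] := hrq'.
  have cq' : continuous (fun t => - q (S (t0 - s') (u t))).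
    by move=> x; apply: cvgN; exact: (continuous_functional hq' cu).
  have [K Kq] := continuous_primitive cq'.
  have [Q Qq] := continuous_primitive (orbit_functional_continuous hS (x := u s) hq).
  have [_ _ waE] := real_adjoint_weak hS hrq.
  have e1 : r (S (t0 - s') (u s')) - r (S (t0 - s') (u s)) = K s' - K s.
    by rewrite !(rint _ _ K hrq' Kq); lra.
  have e2 : r (S (t0 - s') (u s)) - r (S (t0 - s) (u s)) = Q (t0 - s) - Q (t0 - s').
    have := waE (u s) Q Qq (t0 - s'); have := waE (u s) Q Qq (t0 - s).
    by rewrite !subr_ge0 => /(_ (ltW st)) ? /(_ (ltW s't)); lra.
  have b1 : `|K s' - K s - (- c) * (s' - s)| <= C2 * d * `|s' - s|.
    apply: (primitive_mean_near Kq) => x hx.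
    rewrite opprK addrC -(functionalB hq) (le_trans (qC _))// ler_wpM2l//.
    by rewrite distrC hsig.
  have b2 : `|Q (t0 - s') - Q (t0 - s) - c * (t0 - s' - (t0 - s))| <=
      C2 * d * `|t0 - s' - (t0 - s)|.
    apply: (primitive_mean_near Qq) => x.
    rewrite (_ : t0 - s' - (t0 - s) = - (s' - s)); last by ring.
    rewrite normrN => hx.
    by rewrite -(functionalB hq) (le_trans (qC _))// ler_wpM2l// hrho.
  rewrite mul0r subr0 /F.
  rewrite (_ : _ - _ = (K s' - K s - (- c) * (s' - s)) -
      (Q (t0 - s') - Q (t0 - s) - c * (t0 - s' - (t0 - s)))); last by lra.
  rewrite (le_trans (ler_normB _ _))// (le_trans (lerD b1 b2))//.
  rewrite (_ : t0 - s' - (t0 - s) = - (s' - s)); last by ring.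
  rewrite normrN -mulrDl ler_wpM2r//.
  have : d * (2 * (C2 + 1)) = e by rewrite /d divfK// gt_eqF//; lra.
  by move=> <-; lra.
have cF : {within `[0, t0], continuous F}.
  apply: continuous_in_subspaceT => s; rewrite inE/= in_itv/= => st.
  apply/cvgrPdist_le => e e0.
  pose d := e / (C1 + 1).
  have d0 : 0 < d by rewrite divr_gt0//; lra.
  near=> s'.
  have [hsig _] : (forall sigma, `|sigma - s| <= `|s' - s| ->
         `|S (t0 - s') (u sigma) - S (t0 - s) (u s)| <= d) /\
      (forall rho, `|rho - (t0 - s)| <= `|s' - s| ->
         `|S rho (u s) - S (t0 - s) (u s)| <= d).
    by near: s'; exact: near_joint.
  rewrite /F -(functionalB hr) (le_trans (rC _))//.
  have := hsig s' (lexx _); rewrite distrC => h.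
  rewrite (le_trans (ler_wpM2l C10 h))//.
  have : d * (C1 + 1) = e by rewrite /d divfK// gt_eqF//; lra.
  by move=> <-; lra.
have := is_derive0_cst t00 cF dF.
rewrite /F subr0 u0 linear0 (functional0 hr) subrr (semigroup_fun0 hS)//.
Unshelve. all: by end_near. Qed.

Lemma real_weak_exists f :
  (exists2 s : nat -> R -> X, (forall n, simple (s n)) &
    {ae mu, forall t, D t -> s n t @[n --> \oo] --> f t}) ->
  (\int[mu]_(t in D) `|f t|%:E < +oo)%E ->
  exists u, [/\ continuous u, u 0 = 0 & real_weak f u].
Proof.
move=> sf fint; have mD : measurable D by exact: measurable_itv.
have [g [lg gf ig]] := simple_limit_version mD sf fint.
have irg r : functional r -> mu.-integrable D (fun t => (r (g t))%:E).
  move=> hr; have [_ _ [C C0 rC]] := hr.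
  have iC : mu.-integrable D (fun t => (C%:E * `|g t|%:E)%E) by exact: integrableZl.
  apply: le_integrable iC => //.
    apply/measurable_EFinP; apply: measurable_funS (measurable_simple_limit _ lg) => //.
    exact: functional_continuous.
  move=> t Dt; rewrite -EFinM /= lee_fin normrM normr_id (ger0_norm C0).
  exact: rC.
have [|u [cu u0 lim]] := @mild_L1_limit_exists _ _ _ hS _ tau0 g.
  (* Half of e goes to the L^1 distance from g to a simple s, the other half to a uniform
     approximation of s by atoms over the length tau. *)
  move=> e e0; have e20 : 0 < e / 2 by rewrite divr_gt0.
  have [s [ss is_ hs]] := simple_L1_approx mD e20 lg ig.
  have et : 0 < e / 2 / tau by rewrite divr_gt0.
  have [g' [v [gv hg']]] := approximable_simple hS tau0 ss et.
  have ic : mu.-integrable D (fun=> (e / 2 / tau)%:E).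
    apply: (@integrable_bounded _ _ (fun=> e / 2 / tau) `|e / 2 / tau|) => //.
    exact: lebesgue_itvoo_fin.
  exists g', v, (fun t => `|g t - s t| + e / 2 / tau); split => //.
  - exact: (integrableD _ is_ ic).
  - move=> t Dt; rewrite (le_trans (ler_distD (s t) _ _))// lerD2l.
    exact: hg'.
  - have Dfin : fine (mu D) = tau.
      by rewrite lebesgue_measure_itv/= lte_fin tau0/= oppr0 addr0.
    rewrite RintegralD// Rintegral_cst// Dfin divfK ?gt_eqF//.
    by rewrite [leRHS]splitr lerD2r.
exists u; split => // r q hrq; have [hr hq _] := hrq.
have wsol := mild_L1_limit_weakly_solves tau0 cu irg lim.
have iqu : mu.-integrable D (fun t => (q (u t))%:E).
  exact/integrable_continuous_oo/continuous_functional.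
exists (fun t => r (g t) - q (u t)); last first.
  by apply: lebesgue_ae gf => t h Dt; rewrite -h// subrK.
split.
- exact/integrable_continuous_oo/continuous_functional.
- exact: (integrableB _ (irg r hr) iqu).
move=> phi tphi; have [sphi _] := tphi.
have cphi := smooth_continuous sphi.
have cphi' := smooth_continuous (smooth_derive1 sphi).
have i1 : mu.-integrable D (fun t => (r (u t) * phi^`()%classic t)%:E).
  apply: integrableM_continuous => //.
  exact/integrable_continuous_oo/continuous_functional.
have i2 : mu.-integrable D (fun t => ((r (g t) - q (u t)) * phi t)%:E).
  apply: integrableM_continuous => //; exact: (integrableB _ (irg r hr) iqu).
have := wsol r q phi (real_adjoint_weak hS hrq) tphi.
rewrite (_ : \int[mu]_(t in D) _ = \int[mu]_(t in D) (r (u t) * phi^`()%classic t +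
  (r (g t) - q (u t)) * phi t)); last first.
  by apply: eq_Rintegral => t _; rewrite /weak_integrand; ring.
by rewrite RintegralD//; lra.
Qed.

End RealWeak.

(** * Continuous functions as limits of step functions *)

Section ContinuousFunctions.
Variables (R : realType) (X : normedModType R).
Local Notation mu := (@lebesgue_measure R).
Implicit Types (f u : R -> X).

Lemma continuous_comp_clamp tau u : 0 < tau ->
  {within `[0, tau], continuous u} -> continuous (fun t => u (clamp tau t)).
Proof.
move=> tau0 cu t; have cl s : `[0, tau]%classic (clamp tau s).
  by rewrite /= in_itv/=; exact: clamp_itv.
have := (subspace_continuousP _ u).1 cu (clamp tau t) (cl t).
move=> H A /H hA.
have {}hA : nbhs (clamp tau t) [set s | `[0, tau]%classic s -> A (u s)] by [].
have {}hA : \forall s \near t, `[0, tau]%classic (clamp tau s) -> A (u (clamp tau s)).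
  exact: (@clamp_continuous R tau t _ hA).
suff : \forall s \near t, A (u (clamp tau s)) by [].
by apply: filterS hA => s; apply; exact: cl.
Qed.

(** Each stage overwrites the values from n h on by f (n h), so for 0 <= t < m h the result is f at
    the last grid point not after t. *)
Let steps f (h : R) : nat -> R -> X := fix steps m := match m with
  | 0%N => fun=> f 0
  | n.+1 => fun t => \1_(`]-oo, (n%:R * h)[%classic) t *: steps n t +
                     \1_(`[n%:R * h, +oo[%classic) t *: f (n%:R * h)
  end.

Lemma simple_cst (x : X) : simple (cst x : R -> X).
Proof.
split; first exact: finite_image_cst.
move=> y; rewrite (_ : _ @^-1` _ = [set _ | x = y]); last by [].
have [->|xy] := pselect (x = y).
  by rewrite (_ : mkset _ = setT)//; apply/seteqP.
by rewrite (_ : mkset _ = set0)//; apply/seteqP; split.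
Qed.

Let simple_steps f h m : simple (steps f h m).
Proof.
elim: m => [|m IH] /=; first exact: simple_cst.
apply: (simple_map2 (fun x y => x + y)); first exact: simple_restrict.
by apply: (simple_restrict (s := cst _)) => //; exact: simple_cst.
Qed.

Let stepsE f h m t : 0 <= h -> 0 <= t -> exists2 g, 0 <= g <= t &
  steps f h m t = f g /\ (t < m%:R * h -> t - g <= h).
Proof.
move=> h0 t0; elim: m => [|m [g gt [gE gh]]] /=.
  by exists 0; rewrite ?lexx// mul0r; split => //; rewrite ltNge t0.
have [tm|mt] := ltP t (m%:R * h).
  exists g => //; split; last by move=> _; exact: gh.
  rewrite !indicE mem_set/= ?in_itv//= memNset/= ?in_itv/= ?andbT; last first.
    by rewrite leNgt tm.
  by rewrite scale1r scale0r addr0.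
exists (m%:R * h); first by rewrite mulr_ge0.
rewrite !indicE memNset/= ?in_itv/=; last by rewrite ltNge mt.
rewrite mem_set/= ?in_itv/= ?mt// scale1r scale0r add0r; split => //.
by rewrite -natr1 mulrDl mul1r; lra.
Qed.

Lemma continuous_simple_limit tau f : continuous f ->
  exists2 s : nat -> R -> X, (forall n, simple (s n)) &
    forall t, 0 <= t <= tau -> s n t @[n --> \oo] --> f t.
Proof.
move=> cf; pose h (n : nat) : R := n.+1%:R^-1.
pose m n := (Num.truncn (tau / h n)).+1.
exists (fun n => steps f (h n) (m n)); first by move=> n; exact: simple_steps.
move=> t /andP[t0 tt]; apply/cvgrPdist_le => e e0.
have /cvgrPdist_le/(_ _ e0)/nbhs_ballP[d /= d0 hd] := cf t.
near=> n.
have hn0 : 0 < h n by rewrite /h invr_gt0.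
have [g /andP[g0 gt] [gE gh]] := stepsE f (m n) (ltW hn0) t0.
suff : `|f t - steps f (h n) (m n) t| <= e by [].
rewrite gE.
apply: hd; rewrite /ball/= ger0_norm ?subr_ge0//.
have hnd : h n < d by near: n; exact: (near_infty_natSinv_lt (PosNum d0)).
apply: le_lt_trans hnd; apply: gh; apply: le_lt_trans tt _.
by rewrite -ltr_pdivrMr// truncnS_gt.
Unshelve. all: by end_near. Qed.

End ContinuousFunctions.

(** * Transfer to the scalar field *)

Section ScalarParts.
Variables (R : realType) (k : scalar_kind).
Local Notation K := (scalars R k).
Local Notation mu := (@lebesgue_measure R).
Implicit Types (z w : K).

(** Im z = Re (- i z), and c0 = 0 for real scalars: imaginary parts are covered by real parts of
    another functional. *)
Lemma im_part_re : exists c0 : K, forall z, im_part z = re_part (c0 * z).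
Proof.
case: k => /=; first by exists 0 => z; rewrite mul0r.
by exists (Complex 0 (- 1)) => -[x y] /=; rewrite mul0r mulN1r opprK add0r.
Qed.

Lemma re_part_separates z w : (forall c, re_part (c * z) = re_part (c * w)) -> z = w.
Proof.
case: k z w => /= [z w /(_ 1)|[x y] [x' y'] H]; first by rewrite !mul1r.
have := H (Complex 1 0); have := H (Complex 0 (- 1)).
by rewrite /= !mul0r !mul1r !mulN1r !opprK !add0r !subr0 => -> ->.
Qed.

Lemma norm_le_parts z : `|z| <= of_real k (`|re_part z| + `|im_part z|).
Proof.
case: k z => /= [z|[x y]]; first by rewrite normr0 addr0.
rewrite normc_def/= lecR -[leRHS]ger0_norm ?addr_ge0// -sqrtr_sqr ler_wsqrtr//.
rewrite sqrrD !real_normK ?num_real// -addrA lerD2l lerDr.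
by rewrite mulrn_wge0// mulr_ge0.
Qed.

Lemma W11_parts (tau : R) (D : set R) (g a b : R -> K) (h1 h2 : R -> R) :
  W11_derivative_real tau (@re_part R k \o g) h1 ->
  W11_derivative_real tau (@im_part R k \o g) h2 ->
  {ae mu, forall t, D t -> h1 t + re_part (a t) = re_part (b t)} ->
  {ae mu, forall t, D t -> h2 t + im_part (a t) = im_part (b t)} ->
  exists2 h : R -> K, W11_derivative tau g h &
    {ae mu, forall t, D t -> h t + a t = b t}.
Proof.
case: k g a b => /= g a b W1 W2 e1 e2.
  exists h1 => //; split => //; exact: W11_0.
exists (fun t => Complex (h1 t) (h2 t)).
  by split; [exact: W1|exact: W2].
apply: lebesgue_ae2 e1 e2 => t h1t h2t Dt; move: (h1t Dt) (h2t Dt).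
by case: (a t) (b t) => [x y] [x' y'] /= <- <-.
Qed.

End ScalarParts.

Lemma functional_of_continuous (R : realType) (X : normedModType R) (r : X -> R) :
  (forall x y, r (x + y) = r x + r y) -> (forall (a : R) x, r (a *: x) = a * r x) ->
  {for 0, continuous r} -> functional r.
Proof.
move=> rD rZ cr; split => //.
have r0 : r 0 = 0 by rewrite -(scale0r 0) rZ mul0r.
have /cvgrPdist_le/(_ 1 ltr01)/nbhs_ballP[d /= d0 hd] := cr.
have d20 : 0 < d / 2 by rewrite divr_gt0.
exists (2 / d); first by rewrite divr_ge0// ltW.
move=> x; have [->|x0] := eqVneq x 0; first by rewrite r0 !normr0 mulr0.
have nx : 0 < `|x| by rewrite normr_gt0.
pose c := d / 2 / `|x|.
have c0 : 0 < c by rewrite divr_gt0.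
have := hd (c *: x); rewrite r0 sub0r normrN rZ normrM (gtr0_norm c0).
rewrite -ball_normE /ball_/= sub0r normrN normrZ (gtr0_norm c0) divfK ?gt_eqF//.
move=> H; have {}H : c * `|r x| <= 1 by apply: H; lra.
have -> : 2 / d * `|x| = c^-1 by rewrite /c !invfM !invrK; ring.
by rewrite -[leRHS]mul1r ler_pdivlMr// mulrC.
Qed.

Section Transfer.
Variables (R : realType) (k : scalar_kind).
Variable X : completeNormedModType (scalars R k).
Local Notation K := (scalars R k).
Local Notation Y := (realify X).
Local Notation mu := (@lebesgue_measure R).

Definition realify_map (f : {linear X -> X}) : Y -> Y := f.

Lemma realify_map_linear (f : {linear X -> X}) : linear (realify_map f).
Proof. by move=> a x y; exact: linearP. Qed.

HB.instance Definition _ (f : {linear X -> X}) :=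
  GRing.isLinear.Build R Y Y _ (realify_map f) (realify_map_linear f).

Definition realify_linear (f : {linear X -> X}) : {linear Y -> Y} := realify_map f.

Lemma functional_re_part (x' : dual X) (c : K) :
  functional (fun x : Y => re_part (c * x' x)).
Proof.
apply: functional_of_continuous.
- by move=> x y; rewrite (linearD x') mulrDr re_partD.
- by move=> a x; rewrite realified_scaleE linearZ/= mulrCA re_part_of_realM.
apply/cvgrPdist_le => e e0.
have cx := @dual_continuous _ _ _ x' (0 : X).
have c1 : 0 < re_part `|c| + 1.
  by rewrite ltr_wpDl// -(ler_of_real k) of_real0 re_partK.
have e1 : 0 < of_real k (e / (re_part `|c| + 1)).
  by rewrite -(of_real0 R k) ltr_of_real divr_gt0.
have /cvgrPdist_le/(_ _ e1) := cx; apply: filterS => x hx.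
rewrite -[X in X <= _]/(`|re_part (c * x' 0) - re_part (c * x' x)|).
have -> : re_part (c * x' 0) - re_part (c * x' x) = re_part (c * (x' 0 - x' x)).
  by rewrite mulrBr; apply/eqP; rewrite subr_eq -re_partD subrK.
rewrite (le_trans (ler_norm_re_part _))// -(ler_of_real k) re_partK// normrM.
rewrite (le_trans (ler_wpM2l (normr_ge0 c) hx))//.
rewrite -{1}[`|c|]re_partK// -of_realM ler_of_real.
have c0 : 0 <= re_part `|c| by rewrite -(ler_of_real k) of_real0 re_partK.
by rewrite mulrA ler_pdivrMr// mulrC ler_wpM2l ?ltW//; lra.
Qed.

End Transfer.

(* In the complex case the functional is [x |-> r x - i r (i x)]. *)
Lemma scalar_of_functional (R : realType) (k : scalar_kind)
    (X : completeNormedModType (scalars R k)) (r : realify X -> R) :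
  functional r -> exists x' : X -> scalars R k,
    [/\ scalar x', forall x, re_part (x' x) = r x &
    exists2 C : R, 0 <= C & forall x, `|x' x| <= of_real k (C * re_part `|x|)].
Proof.
case: k X r => X r [rD rZ [C C0 rC]].
  exists r; split => //; last by exists C.
  by move=> a x y; rewrite -rZ -rD.
pose j : R[i] := Complex 0 1.
exists (fun x => Complex (r x) (- r (j *: x))); split => //.
  have rZ' (a : R) (x : X) : r (Complex a 0 *: x) = a * r x by exact: rZ.
  have rD' (x y : X) : r (x + y) = r x + r y by exact: rD.
  have rN (x : X) : r (- x) = - r x.
    have := rZ' (- 1) x; rewrite mulN1r => <-; congr r.
    rewrite (_ : Complex (- 1) 0 = - 1 :> R[i]) ?scaleN1r//.
    by apply/eqP; rewrite eq_complex/= oppr0 !eqxx.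
  have aE (a b : R) : Complex a b = Complex a 0 + Complex b 0 * j :> R[i].
    by apply/eqP; rewrite eq_complex/= !mulr0 !mulr1 subrr !addr0 add0r !eqxx.
  have jj : j * j = - 1.
    by apply/eqP; rewrite eq_complex/= !mulr0 !mulr1 sub0r addr0 oppr0 !eqxx.
  move=> [a b] x y.
  have E1 : r (Complex a b *: x + y) = a * r x + b * r (j *: x) + r y.
    by rewrite rD' aE scalerDl rD' rZ' -scalerA rZ'.
  have E2 : r (j *: (Complex a b *: x + y)) = a * r (j *: x) - b * r x + r (j *: y).
    rewrite scalerDr rD' scalerA mulrC -scalerA aE scalerDl rD' rZ' -scalerA rZ'.
    by rewrite scalerA jj scaleN1r rN mulrN.
  rewrite E1 E2; apply/eqP; rewrite eq_complex/=; apply/andP; split; apply/eqP; ring.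
exists (C + C); first by rewrite addr_ge0.
move=> x; apply: le_trans (norm_le_parts _) _; rewrite ler_of_real/= normrN mulrDl.
rewrite lerD//.
have := rC (j *: x); rewrite realified_normE normrZ.
by rewrite (_ : `|j| = 1) ?mul1r// normc_def/= expr0n/= expr1n add0r sqrtr1.
Qed.

Lemma dual_of_functional (R : realType) (k : scalar_kind)
    (X : completeNormedModType (scalars R k)) (r : realify X -> R) :
  functional r -> exists x' : dual X, forall x, re_part (x' x) = r x.
Proof.
move=> /scalar_of_functional[x' [lx' x're [C C0 x'C]]].
pose f : {scalar X} := HB.pack x' (GRing.isLinear.Build _ _ _ _ x' lx').
have cf : continuous f.
  move=> x; apply/cvgrPdist_le => e e0.
  have C1 : 0 < C + 1 by lra.
  have e1 : 0 < of_real k (re_part e / (C + 1)).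
    by rewrite -(of_real0 R k) ltr_of_real divr_gt0// -(ltr_of_real k) of_real0
      re_partK// ltW.
  near=> y.
  rewrite -(linearB f) (le_trans (x'C _))// -[leRHS]re_partK ?(ltW e0)// ler_of_real.
  have : `|x - y| <= of_real k (re_part e / (C + 1)).
    by near: y; exact: cvgr_dist_le.
  rewrite -[X in X <= _]re_partK// ler_of_real ler_pdivlMr// => h.
  have n0 : 0 <= re_part `|x - y| by rewrite -(ler_of_real k) of_real0 re_partK.
  by lra.
by exists (Dual cf).
Unshelve. all: by end_near. Qed.

Section WeakSolutions.
Variables (R : realType) (k : scalar_kind).
Variable X : completeNormedModType (scalars R k).
Variables (T : R -> {linear X -> X}) (hT : C0_semigroup T).
Variables (A : X -> X -> Prop) (hA : forall x y, generator T x y <-> A x (- y)).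
Variables (tau : R) (tau0 : 0 < tau).
Local Notation K := (scalars R k).
Local Notation Y := (realify X).
Local Notation mu := (@lebesgue_measure R).
Local Notation D := (`]0, tau[%classic : set R).

(** The values of [T] at negative times are arbitrary and are replaced by [T 0], the identity. *)
Let S (t : R) : {linear Y -> Y} := realify_linear (T (Num.max t 0)).

Let SE (t : R) (x : Y) : 0 <= t -> S t x = T t x.
Proof. by move=> t0; rewrite -[LHS]/(T (Num.max t 0) x) (max_idPl t0). Qed.

Let hS : semigroup S.
Proof.
have [cT T0 TD Tr] := hT; split.
- by move=> t; apply: cT; rewrite le_max lexx orbT.
- by move=> t x t0; rewrite -[LHS]/(T (Num.max t 0) x) (max_idPr t0) T0.
- by move=> s t x s0 t0; rewrite !SE ?addr_ge0// TD.
- move=> x; apply: cvg_trans (Tr x); apply: near_eq_cvg; near=> t.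
  by rewrite SE//; near: t; exact: nbhs_right_ge.
Unshelve. all: by end_near. Qed.

Let generatorE x y : generator T x y <-> real_generator S x y.
Proof.
by split=> H; apply: cvg_trans H; apply: near_eq_cvg; near=> t;
  rewrite [S t x]SE//; near: t; exact: nbhs_right_ge.
Unshelve. all: by end_near. Qed.

Let generatorZ (c : K) x y : generator T x y -> generator T (c *: x) (c *: y).
Proof.
rewrite /generator => H.
have -> : (fun h => of_real k h^-1 *: (T h (c *: x) - c *: x)) =
    fun h => c *: (of_real k h^-1 *: (T h x - x)).
  by apply/funext => t; rewrite linearZ/= -scalerBr !scalerA mulrC.
by apply: cvgZr; exact: H.
Qed.

Let real_adjoint_of_adjoint (x' y' : dual X) (c : K) : adjoint A x' y' ->
  real_adjoint S (fun x => re_part (c * x' x)) (fun x => re_part (c * y' x)).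
Proof.
move=> xy; split; [exact: functional_re_part|exact: functional_re_part|].
move=> x y /generatorE /hA /xy ->.
by rewrite linearN mulrN re_partN.
Qed.

(** The hypothesis sees real parts only, but the domain is stable under all scalars c, and the real
    parts of c z for all c determine z. *)
Let adjoint_of_real_adjoint (x' y' : dual X) :
  real_adjoint S (fun x => re_part (x' x)) (fun x => re_part (y' x)) ->
  adjoint A x' y'.
Proof.
move=> [hr _ rq] x y xy; apply: re_part_separates => c.
have : generator T x (- y) by apply/hA; rewrite opprK.
move=> /(@generatorZ c) /generatorE /rq.
rewrite !linearZ/= => ->; rewrite linearN mulrN.
by rewrite re_partN opprK.
Qed.

Lemma real_weak_of_weak_solution (f u : R -> X) :
  weak_solution A tau f u -> real_weak S tau (f : R -> Y) u.
Proof.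
move=> [_ wu] r q hrq; have [hr hq rq] := hrq.
have [x' x'r] := dual_of_functional hr; have [y' y'q] := dual_of_functional hq.
have xy : adjoint A x' y'.
  apply: adjoint_of_real_adjoint.
  by rewrite (funext x'r) (funext y'q).
have [h [Wh _] hae] := wu _ _ xy; exists (fun t => re_part (h t)).
  by apply: W11_eq Wh => t _; exact: x'r.
apply: lebesgue_ae hae => t ht Dt.
by rewrite -x'r -y'q -ht// re_partD.
Qed.

Lemma weak_solution_of_real_weak (f u : R -> X) :
  {within `[0, tau], continuous u} -> real_weak S tau (f : R -> Y) u ->
  weak_solution A tau f u.
Proof.
move=> cu wu; split => // x' y' xy.
have [h1 W1 e1] := wu _ _ (real_adjoint_of_adjoint 1 xy).
have [c0 c0E] := im_part_re R k.
have [h2 W2 e2] := wu _ _ (real_adjoint_of_adjoint c0 xy).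
apply: (W11_parts (h1 := h1) (h2 := h2)).
- by apply: W11_eq W1 => t _; rewrite mul1r.
- by apply: W11_eq W2 => t _; rewrite -c0E.
- by apply: lebesgue_ae e1 => t + Dt; rewrite !mul1r; exact.
- by apply: lebesgue_ae e2 => t + Dt; rewrite -!c0E; exact.
Qed.

Lemma weak_solution_unique (f u v : R -> X) : weak_solution A tau f u ->
  weak_solution A tau f v -> u 0 = v 0 -> {in `[0, tau], u =1 v}.
Proof.
move=> wu wv uv0 t; rewrite in_itv/= => tt.
have [cu _] := wu; have [cv _] := wv.
have c0 : clamp tau 0 = 0 by apply: clamp_id; rewrite lexx ltW.
pose d t : Y := (u (clamp tau t) : Y) + (-1) *: (v (clamp tau t) : Y).
have cd : continuous d.
  move=> s; apply: cvgD; first exact: (@continuous_comp_clamp R Y tau u tau0 cu).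
  by apply: cvgZr; exact: (@continuous_comp_clamp R Y tau v tau0 cv).
have d0 : d 0 = 0 by rewrite /d c0 uv0 scaleN1r subrr.
have wd : real_weak S tau (fun=> 0 : Y) d.
  have := real_weak_addZ tau0 (-1) (real_weak_of_weak_solution wu)
    (real_weak_of_weak_solution wv).
  have -> : (fun t => (f t : Y) + -1 *: (f t : Y)) = fun=> 0.
    by apply/funext => s; rewrite scaleN1r subrr.
  by apply: real_weak_eq => s ss; rewrite /d clamp_id.
have := real_weak_unique hS tau0 cd d0 wd tt.
by rewrite /d clamp_id// scaleN1r => /eqP; rewrite subr_eq0 => /eqP.
Qed.

(** The source is fixed before x: in (i) => (ii) the initial value is that of a solution which (i)
    provides for this source. *)
Lemma weak_solution_orbit (y : X) : exists2 f : R -> X,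
  {within `[0, tau], continuous f} & forall x : X, exists u : R -> X,
  [/\ weak_solution A tau f u, u 0 = x & u tau = T tau (x + of_real k tau *: y)].
Proof.
have co z : continuous (fun t => S t z) by exact: (@orbit_continuous _ _ _ hS z).
exists (fun t => S t y); first exact/continuous_subspaceT/co.
move=> x; exists (fun t => (S t x : Y) + t *: (S t y : Y)); split.
- apply: weak_solution_of_real_weak; last exact: real_weak_orbit.
  apply: continuous_subspaceT => t; apply: cvgD; first exact: co.
  by apply: (@cvgZ R Y); [exact: cvg_id|exact: co].
- by rewrite scale0r addr0 (semigroup_fun0 hS).
- by rewrite !SE ?ltW// linearD linearZ.
Qed.

Lemma weak_solution_exists (f : R -> X) : bochner_integrable `]0, tau[ f ->
  exists y : X, forall x : X,
  exists u : R -> X, [/\ weak_solution A tau f u, u 0 = x & u tau = T tau x + y].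
Proof.
move=> [sf fint].
have [w [cw w0 ww]] := @real_weak_exists R Y S hS tau tau0 f sf fint.
exists (w tau) => // x.
have co z : continuous (fun t => S t z) by exact: (@orbit_continuous _ _ _ hS z).
exists (fun t => (S t x : Y) + 1 *: w t); split.
- apply: weak_solution_of_real_weak.
    apply: continuous_subspaceT => t; apply: cvgD; first exact: co.
    by apply: (@cvgZr R Y); exact: cw.
  have := real_weak_addZ tau0 1 (real_weak_orbit hS tau0 x 0) ww.
  have -> : (fun t => S t 0 + 1 *: (f t : Y)) = f.
    by apply/funext => t; rewrite linear0 add0r scale1r.
  by apply: real_weak_eq => t _; rewrite linear0 scaler0 addr0.
- by rewrite w0 scaler0 addr0 (semigroup_fun0 hS).
- by rewrite SE ?ltW// scale1r.
Qed.

Lemma continuous_bochner_integrable (f : R -> X) :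
  {within `[0, tau], continuous f} -> bochner_integrable `]0, tau[ f.
Proof.
move=> cf.
have cg := @continuous_comp_clamp R Y tau f tau0 cf.
have Dcl t : D t -> clamp tau t = t.
  by rewrite /= in_itv/= => /andP[t0 tt]; rewrite clamp_id// !ltW.
have [s ss sg] := @continuous_simple_limit R Y tau _ cg.
split.
  exists s => //; apply: aeW => t Dt; have := sg t.
  rewrite Dcl//; apply.
  by move: Dt; rewrite /= in_itv/= => /andP[t0 tt]; rewrite !ltW.
have cn : continuous (fun t => `|(f (clamp tau t) : Y)|).
  by move=> t; apply: cvg_norm; exact: cg.
have /integrableP[_] := @integrable_continuous_oo R _ 0 tau cn.
apply: le_lt_trans; rewrite le_eqVlt; apply/orP; left; apply/eqP.
apply: eq_integral => t; rewrite inE => /Dcl tE.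
by rewrite /= tE ger0_norm ?normr_ge0.
Qed.

End WeakSolutions.

(** * The equivalence *)

Theorem theorem2p2 (R : realType) (k : scalar_kind)
    (X : completeNormedModType (scalars R k))
    (T : R -> {linear X -> X}) (hT : C0_semigroup T)
    (A : X -> X -> Prop) (hA : forall x y, generator T x y <-> A x (- y))
    (tau : R) (htau : 0 < tau) (Phi : {linear X -> X}) :
  [<->
    forall f : R -> X, {within `[0, tau], continuous f} ->
      exists_unique_on tau (fun u =>
        weak_solution A tau f u /\ u 0 = Phi (u tau));
    bijective (fun x : X => x - Phi (T tau x));
    forall f : R -> X, bochner_integrable `]0, tau[ f ->
      forall y0 : X, exists_unique_on tau (fun u =>
        weak_solution A tau f u /\ u 0 = Phi (u tau) + y0)
  ].
Proof.
have orbit := weak_solution_orbit hT hA htau.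
have unique := weak_solution_unique hT hA htau.
have itv0 : (0 : R) \in `[0, tau] by rewrite in_itv/= lexx ltW.
have itvtau : tau \in `[0, tau] by rewrite in_itv/= lexx ltW.
tfae.
- move=> wp.
  have inj : injective (fun x : X => x - Phi (T tau x)).
    move=> x y /= xy.
    have zE : x - y = Phi (T tau (x - y)).
      rewrite 2!linearB; move/eqP: xy; rewrite subr_eq => /eqP {1}->.
      by rewrite addrAC (addrAC y) subrr add0r addrC.
    (* One source serves all initial values, so the orbits of x - y and of 0 solve the same boundary
       value problem; uniqueness identifies them. *)
    have [f cf orb] := orbit 0; have [w _ wE] := wp _ cf.
    have [u [wu u0 ut]] := orb (x - y); have [v [wv v0 vt]] := orb 0.
    move: ut vt; rewrite !scaler0 !addr0 linear0 => ut vt.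
    have uw : {in `[0, tau], u =1 w} by apply: wE; rewrite u0 ut.
    have vw : {in `[0, tau], v =1 w} by apply: wE; rewrite v0 vt linear0.
    by apply/eqP; rewrite -subr_eq0 -u0 uw// -vw// v0.
  have surj (y : X) : exists x : X, x - Phi (T tau x) = y.
    (* The scalar cancels the factor tau, so the solution from u 0 ends at T tau (u 0 + y). *)
    have [f cf orb] := orbit (of_real k tau^-1 *: y).
    have [u [wu u0] _] := wp _ cf; have [v [wv v0 vt]] := orb (u 0).
    move: vt; rewrite scalerA -of_realM divff ?gt_eqF// of_real1 scale1r => vt.
    exists (u 0 + y); rewrite -vt -(unique f u v)// -u0 addrAC subrr.
    by rewrite add0r.
  have [g gE] := choice surj.
  by exists g => // x; apply: inj; rewrite gE.
- move=> [g gK Kg] f bf y0.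
  have [w wE] := weak_solution_exists hT hA htau bf.
  have [u [wu u0 ut]] := wE (g (Phi w + y0)).
  (* For a solution with final value T tau (v 0) + w, the boundary condition determines v 0 through
     the inverse g. *)
  have bc v : v 0 = Phi (T tau (v 0) + w) + y0 -> v 0 = g (Phi w + y0).
    move=> v0; apply: (can_inj gK); rewrite Kg; apply/eqP.
    by rewrite subr_eq addrC addrA -linearD -v0.
  exists u.
    split => //; rewrite ut u0 linearD -addrA; apply/eqP.
    by rewrite addrC -subr_eq [X in X == _]Kg.
  move=> v [wv v0]; apply: (unique f) => //; rewrite u0; apply: bc.
  (* Uniqueness for the initial value problem shows that v has the final value required by [bc]. *)
  have [v' [wv' v'0 v't]] := wE (v 0).
  by rewrite -v't {1}v0 (unique f v v').
- move=> H f cf.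
  have bf := continuous_bochner_integrable htau cf.
  have [u [wu u0] uE] := H f bf 0; exists u; first by rewrite u0 addr0.
  by move=> v [wv v0]; apply: uE; rewrite addr0.
Qed.
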